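(* Let $d\ge 3$, let $(\Psi_{\mathrm C}^j)_{j=0}^\infty$ be the sequence of polynomial curvelets on $\mathbb S^{d-1}$ and let $\Psi_{\mathrm C}^{j,r,s}$ be the rotated, weighted curvelets, both as defined in the context. Then the system $$\mathcal X[(\Psi_{\mathrm C}^j)_{j=0}^\infty]=\{\Psi_{\mathrm C}^{j,r,s} : r=1,\dots,r_j,\ s=1,\dots,s_j,\ j\in\mathbb N_0\}$$ is a Parseval frame for $L^2(\mathbb S^{d-1})$. In particular, for each $f\in L^2(\mathbb S^{d-1})$, $$f=\sum_{j=0}^\infty\sum_{r=1}^{r_j}\sum_{s=1}^{s_j}\langle f,\Psi_{\mathrm C}^{j,r,s}\rangle_{\mathbb S^{d-1}}\,\Psi_{\mathrm C}^{j,r,s}$$ with unconditional convergence in $L^2(\mathbb S^{d-1})$.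
   Context: Notation. $\mathbb S^{d-1}$ is the unit sphere of $\mathbb R^d$, $e^1,\dots,e^d$ the canonical basis, $\omega_{d-1}$ the rotation-invariant probability measure on $\mathbb S^{d-1}$, $\langle f_1,f_2\rangle_{\mathbb S^{d-1}}=\int f_1\overline{f_2}\,d\omega_{d-1}$. $\Pi_N(\mathbb S^{m})$ is the space of (complex) spherical polynomials of degree at most $N$ on $\mathbb S^m$ (restrictions of polynomials of degree $\le N$). For $g\in SO(d)$, $T^d(g)f=f(g^{-1}\cdot)$. $SO(d-1)$ is identified with $\{h\in SO(d): he^d=e^d\}$. For $\nu\in\mathbb S^{d-1}$, $g_\nu$ is an arbitrary element of $SO(d)$ with $g_\nu e^d=\nu$; for $\nu'\in\mathbb S^{d-2}$, $h_{\nu'}$ is an arbitrary element of $SO(d-1)$ with $h_{\nu'}e^{d-1}=(\nu',0)$. Curvelets. Let $q\in\mathbb N$ and let $\phi\in C^q([0,\infty))$ be real-valued, non-increasing, with $\phi(t)=1$ for $t\in[0,1/2]$ and $\phi(t)=0$ for $t\ge1$. Put $\kappa(t)=\sqrt{\phi^2(t/2)-\phi^2(t)}$, so $\operatorname{supp}\kappa\subset[1/2,2]$. Let $\dim\mathcal H_n^d=\frac{(2n+d-2)(n+d-3)!}{(d-2)!\,n!}$ (the dimension of the space $\mathcal H_n^d$ of spherical harmonics of degree $n$) and $$A_n=\frac{2^{(2-d)/2}}{\sqrt{\Gamma(d/2)}}\prod_{i=0}^{d-3}\sqrt{\frac{(2n+d-i-2)\,\Gamma(n+\frac{d-i-2}{2})}{\Gamma(n+\frac{d-i-1}{2})}},$$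 the positive constant such that $x\mapsto A_n(x_d+\mathrm i x_{d-1})^n$ has $L^2(\mathbb S^{d-1})$-norm $1$. The polynomial curvelets are $\Psi_{\mathrm C}^0\equiv1$ and, for $j\in\mathbb N$, $$\Psi_{\mathrm C}^j(x)=\sqrt2\sum_{n=0}^\infty\sqrt{\dim\mathcal H_n^d}\;\kappa\!\left(\tfrac{n}{2^{j-1}}\right)A_n\,\Re\{(x_d+\mathrm i x_{d-1})^n\},\qquad x\in\mathbb S^{d-1}.$$ Frame. For each $j\in\mathbb N$ let points $\eta_{j,r}\in\mathbb S^{d-1}$, $\eta'_{j,s}\in\mathbb S^{d-2}$ and weights $\omega_{j,r},\omega'_{j,s}>0$ ($r=1,\dots,r_j$, $s=1,\dots,s_j$) be such that $\int_{\mathbb S^{d-1}}f\,d\omega_{d-1}=\sum_{r}\omega_{j,r}f(\eta_{j,r})$ for all $f\in\Pi_{2^{j+1}}(\mathbb S^{d-1})$ and $\int_{\mathbb S^{d-2}}f\,d\omega_{d-2}=\sum_s\omega'_{j,s}f(\eta'_{j,s})$ for all $f\in\Pi_{2^{j+1}}(\mathbb S^{d-2})$. For $j=0$ put $r_0=s_0=1$, $\omega_{0,1}=\omega'_{0,1}=1$, with $\eta_{0,1},\eta'_{0,1}$ arbitrary. Then $\Psi_{\mathrm C}^{j,r,s}=\sqrt{\omega_{j,r}\omega'_{j,s}}\;T^d(g_{\eta_{j,r}}h_{\eta'_{j,s}})\Psi_{\mathrm C}^j$. A Parseval frame is a system with $\sum_{j,r,s}|\langle f,\Psi_{\mathrm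 C}^{j,r,s}\rangle|^2=\|f\|_{L^2}^2$ for all $f\in L^2(\mathbb S^{d-1})$. *)

(* Defs.v *)
From HB Require Import structures.
From mathcomp Require Import all_boot all_order all_algebra.
(* mpoly's notations clash with those of mathcomp-analysis *)
From mathcomp Require Import -(notations) mpoly.
From mathcomp Require Import all_classical all_reals all_analysis.
From mathcomp Require Import complex.

Set Implicit Arguments.
Unset Strict Implicit.
Unset Printing Implicit Defensive.

Import Order.TTheory GRing.Theory Num.Theory.
Import numFieldNormedType.Exports.

Local Open Scope classical_set_scope.
Local Open Scope ring_scope.
Local Open Scope complex_scope.

(* Vectors of R^d are columns.  Coordinates are numbered from 0, so that     *)
(* x_d and x_{d-1} are [coordn x d.-1] and [coordn x d.-2], and e^d and        *)
(* e^{d-1} are [unit_vec R d d.-1] and [unit_vec R d d.-2].                        *)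

Definition coordn (R : realType) (d : nat) (x : 'cV[R]_d) (k : nat) : R :=
  if insub k is Some i then x (i : 'I_d) 0 else 0.

Definition unit_vec (R : realType) (d k : nat) : 'cV[R]_d :=
  \col_(i < d) ((i : nat) == k)%:R.

(* (v, 0): the last coordinate is 0 because d.-1 is out of range for v. *)
Definition embed0 (R : realType) (d : nat) (v : 'cV[R]_d.-1) : 'cV[R]_d :=
  \col_(i < d) coordn v i.

(* S^{d-1}: the index is the dimension of the ambient space. *)
Definition sphere (R : realType) (d : nat) : set 'cV[R]_d :=
  [set x | \sum_(i < d) x i 0 ^+ 2 = 1].
Arguments sphere R d : clear implicits.

Definition SOgroup (R : realType) (d : nat) : set 'M[R]_d :=
  [set g | g *m g^T = 1%:M /\ \det g = 1].
Arguments SOgroup R d : clear implicits.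

(* SO(d-1), identified with the stabiliser of e^d in SO(d). *)
Definition SOstab (R : realType) (d : nat) : set 'M[R]_d :=
  [set h | SOgroup R d h /\ h *m unit_vec R d d.-1 = unit_vec R d d.-1].
Arguments SOstab R d : clear implicits.

Definition rotate (R : realType) (d : nat) (g : 'M[R]_d)
    (f : 'cV[R]_d -> R[i]) : 'cV[R]_d -> R[i] :=
  fun x => f (invmx g *m x).

(* A Borel probability measure on S^{d-1} is represented by a Borel          *)
(* probability measure on R^d giving mass 1 to the sphere; correspondingly   *)
(* a function on S^{d-1} is a function on R^d of which only the restriction  *)
(* to the sphere is used.                                                    *)

Definition borel_vec (R : realType) (d : nat) :=
  g_sigma_algebraType (@open 'cV[R]_d).

Definition rotation_invariant (R : realType) (d : nat)
    (mu : probability (borel_vec R d) R) : Prop :=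
  mu (sphere R d) = 1%E /\
  forall g : 'M[R]_d, SOgroup R d g -> forall A : set (borel_vec R d),
    measurable A -> mu [set x : 'cV[R]_d | A (g *m x)] = mu A.

Section L2.
Variables (R : realType) (d : nat) (mu : probability (borel_vec R d) R).
Implicit Types f : 'cV[R]_d -> R[i].

Definition cintegral f : R[i] :=
  (\int[mu]_(x in sphere R d) complex.Re (f x)) +i*
  (\int[mu]_(x in sphere R d) complex.Im (f x)).

Definition inner f1 f2 : R[i] := cintegral (fun x => f1 x * (f2 x)^*).

(* Valued in \bar R, so that an infinite norm is not collapsed to 0. *)
Definition sqnorm f : \bar R :=
  (\int[mu]_(x in sphere R d) ((ComplexField.Normc.normc (f x)) ^+ 2)%:E)%E.

Definition L2 : set ('cV[R]_d -> R[i]) :=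
  [set f | [/\ measurable_fun (sphere R d : set (borel_vec R d))
                 (fun x => complex.Re (f x)),
               measurable_fun (sphere R d : set (borel_vec R d))
                 (fun x => complex.Im (f x)) &
               (sqnorm f < +oo)%E]].

Definition L2_cvg (s : nat -> 'cV[R]_d -> R[i]) f : Prop :=
  (fun N => sqnorm (fun x => f x - s N x)) @ \oo --> 0%E.

Definition parseval_frame (I : choiceType) (psi : I -> 'cV[R]_d -> R[i]) : Prop :=
  (forall i, L2 (psi i)) /\
  forall f, L2 f ->
    (\esum_(i in [set: I]) ((ComplexField.Normc.normc (inner f (psi i))) ^+ 2)%:E)%E
      = sqnorm f.

(* For a countably infinite I, the bijections nat -> I are the orderings of   *)
(* the series.                                                               *)
Definition unconditional_L2_sum (I : choiceType) (u : I -> 'cV[R]_d -> R[i]) f :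
    Prop :=
  forall e : nat -> I, bijective e ->
    L2_cvg (fun N x => \sum_(k < N) u (e k) x) f.

Definition spherical_poly (N : nat) : set ('cV[R]_d -> R[i]) :=
  [set f | exists p : mpoly d R[i],
     (mpoly.msize p <= N.+1)%N /\
     forall x, sphere R d x -> f x = meval (fun i => (x i 0)%:C) p].

Definition quadrature (N n : nat) (pt : 'I_n -> 'cV[R]_d) (w : 'I_n -> R) : Prop :=
  forall f, spherical_poly N f -> cintegral f = \sum_(r < n) (w r)%:C * f (pt r).

End L2.

(* D k is the k-th derivative of f on [0, +oo[, one-sided at 0. *)
Definition C_halfline (R : realType) (q : nat) (f : R -> R) : Prop :=
  exists D : nat -> R -> R,
    [/\ (forall t : R, 0 <= t -> D 0%N t = f t),
        (forall k, (k < q)%N -> forall t : R, 0 <= t ->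
           (fun s => (D k s - D k t) / (s - t)) @ within `[0, +oo[ t^'
             --> D k.+1 t) &
        (forall k, (k <= q)%N -> {within `[0, +oo[, continuous (D k)})].

Definition Gamma (R : realType) (x : R) : R :=
  \int[lebesgue_measure]_(t in `]0, +oo[) (t `^ (x - 1) * expR (- t)).

Section Curvelets.
Variables (R : realType) (d : nat) (phi : R -> R).

Definition kappa (t : R) : R := Num.sqrt (phi (t / 2) ^+ 2 - phi t ^+ 2).

(* dim H_n^d, for d >= 3. *)
Definition dimH (n : nat) : R :=
  ((2 * n + d - 2) * (n + d - 3)`!)%:R / ((d - 2)`! * n`!)%:R.

(* The normalisation of (x_d + i x_{d-1})^n in L^2(S^{d-1}), in closed form. *)
Definition A_const (n : nat) : R :=
  2 `^ ((2 - d%:R) / 2) / Num.sqrt (Gamma (d%:R / 2)) *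
  \prod_(0 <= i < d - 2)
    Num.sqrt ((2 * n%:R + d%:R - i%:R - 2) *
                Gamma (n%:R + (d%:R - i%:R - 2) / 2) /
              Gamma (n%:R + (d%:R - i%:R - 1) / 2)).

Definition curvelet_series (j : nat) (x : 'cV[R]_d) : R :=
  Num.sqrt 2 * \big[+%R/0]_(0 <= n <oo)
    (Num.sqrt (dimH n) * kappa (n%:R / 2 ^+ j.-1) * A_const n *
     complex.Re ((coordn x d.-1 +i* coordn x d.-2) ^+ n)).

Definition curvelet (j : nat) (x : 'cV[R]_d) : R[i] :=
  if j == 0%N then 1 else (curvelet_series j x)%:C.

End Curvelets.

Definition curvelet_rot (R : realType) (d : nat) (phi : R -> R)
    (g : 'cV[R]_d -> 'M[R]_d) (h : 'cV[R]_d.-1 -> 'M[R]_d)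
    (j : nat) (w w' : R) (eta : 'cV[R]_d) (eta' : 'cV[R]_d.-1) :
    'cV[R]_d -> R[i] :=
  fun x => (Num.sqrt (w * w'))%:C *
           rotate (g eta *m h eta') (curvelet phi j) x.

(* Main.v *)
Require Import Defs.
From HB Require Import structures.
From mathcomp Require Import all_boot all_order all_algebra.
From mathcomp Require Import -(notations) mpoly.
From mathcomp Require Import all_classical all_reals all_analysis.
From mathcomp Require Import measurable_realfun complex.
From mathcomp Require Import ring lra zify.

Set Implicit Arguments.
Unset Strict Implicit.
Unset Printing Implicit Defensive.

Import Order.TTheory GRing.Theory Num.Theory.
Import numFieldNormedType.Exports.

Local Open Scope classical_set_scope.
Local Open Scope ring_scope.
Local Open Scope complex_scope.

(** Every curvelet is a superposition of waves x |-> Re (<u, x> + i <z, x>)^n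
    with orthonormal u and z. Rotating the curvelet by g h replaces the last
    two basis vectors by u = eta and z = g (eta', 0) ([curvelet_rotE]). The
    proof computes, for every level j > 0, the kernel K_j(x, y) = sum over (r,
    s) of Psi(x) Psi(y), which determines the energy sum over (r, s) of <f,
    Psi>^2 as a quadratic form in f.

    Expand K_j by pairs of degrees (n, m), both below 2^j. The sum over s
    samples a polynomial of degree at most n + m on the small sphere, and the
    sum over r then samples one on the large sphere. The quadratures are exact
    there, so both sums are integrals against rotation invariant measures, and
    the result is a function of <x, y> only ([wave_kernel_zonal]). The
    Funk-Hecke formula says that convolution with a zonal kernel acts on waves
    of degree n by a scalar ([funk_hecke_monomial]). A zonal kernel that
    consists of waves of degree n in one variable and of degree m in the other
    is therefore a multiple of the Gegenbauer kernel P_n(<x, y>) for n = m and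
    zero otherwise; the norm of a single wave gives the multiple
    ([wave_kernelE]). The constants A_n are chosen so that K_j(x, y) = sum of
    kappa(n / 2^(j-1))^2 dim H_n P_n(<x, y>) ([rcurvelet_kernel]). The squares
    kappa^2 telescope; level 0 is the projection onto the constants, the term n
    = 0. Hence the levels up to J add up to the kernel with the weights phi(n /
    2^J)^2, which lie between 0 and 1 and equal 1 for n <= 2^(J-1). The energy
    of these levels is thus squeezed between the squared norms of two
    orthogonal projections of f onto spaces of polynomials ([level_poly_ge],
    [level_poly_le]), and Parseval's identity is equivalent to the density of
    the polynomials in L2.

    For the density ([L2_dens]), the normalised kernels (1 + <x, y>)^M form an
    approximate identity. They approximate Lipschitz functions uniformly;
    indicators of open sets, of Borel sets, simple functions and finally all
    square integrable functions follow by dominated convergence and Dynkin's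
    theorem.

    The harmonic analysis reduces to moments. Invariance determines the moments
    of linear forms, and polarisation and a recursion determine all the mixed
    moments of two forms ([moment2], [mom_rec]). Gegenbauer polynomials are
    defined by Laplace's integral, an average of waves over the equator, and
    inherit the Funk-Hecke formula from the waves; their recursions produce dim
    H_n. Integral operators are discretised by the quadratures, which makes
    them of finite rank.

    Finally, the curvelets are real, so real and imaginary parts of f can be
    treated separately. For a finite set F of indices, Parseval's identity
    bounds the squared norm of f - sum over F of <f, Psi> Psi by the part of
    the energy outside F ([sq_residual]). This bound does not see the order of
    summation, and gives the convergence of the ordered series and of all
    rearrangements ([frame_cvg]). *)

(** * The Gamma function and the normalising constant *)

Section GammaFunction.
Variable R : realType.
Implicit Types x t : R.
Local Notation leb := (@lebesgue_measure R).

Definition gamma_fun x t : R := t `^ (x - 1) * expR (- t).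

(** The extended-real integral keeps the functional equation an identity before
    finiteness is known; finiteness then has to be established at 1/2 and 1
    only. *)
Definition Gammae x : \bar R := (\int[leb]_(t in `]0%R, +oo[) (gamma_fun x t)%:E)%E.

Lemma GammaE x : Gamma x = fine (Gammae x).
Proof. by []. Qed.

Lemma gamma_fun_ge0 x t : 0 <= gamma_fun x t.
Proof. by rewrite mulr_ge0 ?powR_ge0 ?expR_ge0. Qed.

Lemma measurable_gamma_fun x (D : set (measurableTypeR R)) :
  measurable_fun D (fun t => (gamma_fun x t)%:E).
Proof.
apply/measurable_EFinP; apply: measurable_funTS.
apply: measurable_funM; first exact: measurable_powR.
by apply: measurableT_comp => //; exact: measurable_oppr.
Qed.

(** Compact intervals away from 0, on which the powers of t are smooth. *)
Definition exhaust (n : nat) : set R := `[n.+2%:R^-1, n.+2%:R].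

Lemma exhaust_lt n : n.+2%:R^-1 < n.+2%:R :> R.
Proof.
by rewrite (@lt_le_trans _ _ 1)// ?ler1n// invf_lt1// ltr1n.
Qed.

Lemma bigcup_exhaust : \bigcup_n exhaust n = [set` `]0, +oo[].
Proof.
apply/seteqP; split => [x [n _]|x]; rewrite /exhaust/= !in_itv/= ?andbT.
  by move=> /andP[+ _]; apply: lt_le_trans; rewrite invr_gt0.
move=> x0; pose m := Num.truncn (Num.max x x^-1).
have hm : Num.max x x^-1 <= m.+2%:R.
  apply: ltW; apply: lt_trans (_ : m.+1%:R < _); last by rewrite ltr_nat.
  by apply: Num.Theory.truncnS_gt.
exists m => //=; rewrite in_itv/=.
move: hm; rewrite ge_max => /andP[-> h]; rewrite andbT.
by rewrite invf_ple// posrE.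
Qed.

Lemma Gammae_cvg x :
  (\int[leb]_(t in exhaust n) (gamma_fun x t)%:E)%E @[n --> \oo] --> Gammae x.
Proof.
rewrite /Gammae -bigcup_exhaust.
apply: ge0_nondecreasing_set_cvg_integral.
- apply/nondecreasing_seqP => n; rewrite subsetEset; apply: subset_itv.
    by rewrite bnd_simp lef_pV2 ?posrE// ler_nat.
  by rewrite bnd_simp ler_nat.
- by move=> n; exact: measurable_itv.
- by move=> n; exact: measurable_gamma_fun.
- by move=> n t _; rewrite lee_fin gamma_fun_ge0.
Qed.

Lemma gamma_parts x (a b : R) : 0 < a -> a < b -> 
  (\int[leb]_(t in `[a, b]) (gamma_fun (x + 1) t)%:E =
   (gamma_fun (x + 1) a - gamma_fun (x + 1) b)%:E +
   x%:E * \int[leb]_(t in `[a, b]) (gamma_fun x t)%:E)%E.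
Proof.
move=> a0 ab.
pose F := (fun t : R => t `^ x); pose f := (fun t : R => x * t `^ (x - 1)).
pose G := (fun t : R => - expR (- t)); pose g := (fun t : R => expR (- t)).
have dF t : 0 < t -> is_derive t 1 F (f t).
  by move=> t0; exact: is_derive1_powR.
have dG t : is_derive t 1 G (g t).
  rewrite /G /g; apply: is_derive_eq.
  by rewrite /GRing.scale/=; ring.
have cp : {within `[a, b], continuous (fun t : R => t `^ (x - 1))}.
  apply: derivable_within_continuous => t /[!in_itv]/= /andP[at_ _].
  by apply: derivable_powR; rewrite in_itv/= andbT (lt_le_trans a0).
have cf : {within `[a, b], continuous f}.
  by move=> t; apply: cvgM; [exact: cvg_cst|exact: cp].
have cg : {within `[a, b], continuous g}.
  apply: derivable_within_continuous => t _.
  have -> : g = - G by apply/funext => u; rewrite /g /G /= opprK.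
  by apply: derivableN; have [] := dG t.
have ccF t : 0 < t -> {for t, continuous F}.
  move=> t0; apply: differentiable_continuous; apply/derivable1_diffP.
  by have [] := dF t t0.
have ccG t : {for t, continuous G}.
  apply: differentiable_continuous; apply/derivable1_diffP.
  by have [] := dG t.
have oF : derivable_oo_LRcontinuous F a b.
  split.
  - move=> t /[!in_itv]/= /andP[at_ _].
    by have [] := dF t (lt_trans a0 at_).
  - exact/cvg_at_right_filter/ccF.
  - exact/cvg_at_left_filter/ccF/(lt_trans a0).
have oG : derivable_oo_LRcontinuous G a b.
  split.
  - by move=> t _; have [] := dG t.
  - exact/cvg_at_right_filter/ccG.
  - exact/cvg_at_left_filter/ccG.
have eF : {in `]a, b[, derive1 F =1 f}.
  move=> t /[!in_itv]/= /andP[at_ _]; rewrite derive1E.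
  by have [_ ->] := dF t (lt_trans a0 at_).
have eG : {in `]a, b[, derive1 G =1 g}.
  by move=> t _; rewrite derive1E; have [_ ->] := dG t.
have := integration_by_parts ab cf oF eF cg oG eG.
have -> : (\int[leb]_(t in `[a, b]) (F t * g t)%:E =
    \int[leb]_(t in `[a, b]) (gamma_fun (x + 1) t)%:E)%E.
  by apply: eq_integral => t _; rewrite /gamma_fun addrK.
move=> ->.
have -> : (\int[leb]_(t in `[a, b]) (f t * G t)%:E =
    \int[leb]_(t in `[a, b]) ((- x)%:E * (gamma_fun x t)%:E))%E.
  by apply: eq_integral => t _; rewrite -EFinM /f /G /gamma_fun; congr EFin; ring.
rewrite integralZl//; last first.
  apply: continuous_compact_integrable; first exact: segment_compact.
  by move=> t; apply: cvgM; [exact: cp|exact: cg].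
rewrite EFinN mulNe oppeK; congr (_%:E + _)%E.
by rewrite /F /G /gamma_fun !addrK; ring.
Qed.

Lemma gamma_parts_exhaust x n :
  (\int[leb]_(t in exhaust n) (gamma_fun (x + 1) t)%:E =
   (gamma_fun (x + 1) n.+2%:R^-1 - gamma_fun (x + 1) n.+2%:R)%:E +
   x%:E * \int[leb]_(t in exhaust n) (gamma_fun x t)%:E)%E.
Proof.
have := exhaust_lt n; have : 0 < n.+2%:R^-1 :> R by rewrite invr_gt0 ltr0Sn.
rewrite /exhaust; move: (n.+2%:R^-1 : R) (n.+2%:R : R) => a b; exact: gamma_parts.
Qed.

Let cvg_n2y : (n.+2%:R : R) @[n --> \oo] --> +oo.
Proof. by have := @cvgr_idn R; rewrite -(cvg_shiftn 2) /=; under eq_cvg do rewrite addn2. Qed.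

Let cvg_inv_n2 : (n.+2%:R^-1 : R) @[n --> \oo] --> 0.
Proof. by apply/gtr0_cvgV0; [near=> n|exact: cvg_n2y]. Unshelve. all: by end_near. Qed.

Lemma gamma_fun_cvg0 x : 0 < x -> gamma_fun (x + 1) (n.+2%:R^-1) @[n --> \oo] --> 0.
Proof.
move=> x0; rewrite /gamma_fun addrK.
rewrite -[X in _ --> X](mul0r (expR (- 0))); apply: cvgM.
  have /cvg_at_rightP := powR_cvg0 x0; apply; split; first by move=> n; rewrite invr_gt0.
  exact: cvg_inv_n2.
have := @continuous_expR R (- 0); apply: cvg_comp; apply: cvgN.
exact: cvg_inv_n2.
Qed.

(** The exponential absorbs the power: t <= 2 x e^(t / 2 x) gives t^x e^(-t) <=
    (2 x)^x e^(-t / 2). *)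
Lemma gamma_fun_cvgy x : 0 < x -> gamma_fun (x + 1) n.+2%:R @[n --> \oo] --> 0.
Proof.
move=> x0; rewrite /gamma_fun addrK.
have bnd (t : R) : 0 < t -> t `^ x * expR (- t) <= (2 * x) `^ x * expR (- (t / 2)).
  move=> t0.
  have h : t <= (2 * x) * expR (t / (2 * x)).
    rewrite -ler_pdivrMl ?mulr_gt0// mulrC (le_trans _ (expR_ge1Dx _))//.
    by rewrite lerDr.
  have : t `^ x <= (2 * x) `^ x * expR (t / 2).
    apply: le_trans (_ : (2 * x * expR (t / (2 * x))) `^ x <= _).
      by apply: ge0_ler_powR => //; rewrite ?nnegrE ?mulr_ge0 ?expR_ge0 ?ltW.
    rewrite powRM ?expR_ge0//; last by rewrite mulr_ge0// ltW.
    rewrite -expRM.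
    rewrite le_eqVlt; apply/orP; left; apply/eqP; congr (_ * expR _).
    by field; rewrite gt_eqF.
  move=> /(ler_wpM2r (expR_ge0 (- t))) /le_trans; apply.
  rewrite -mulrA -expRD.
  by rewrite le_eqVlt; apply/orP; left; apply/eqP; congr (_ * expR _); field.
apply: (@squeeze_cvgr _ _ _ _ (fun=> 0) (fun n => (2 * x) `^ x * expR (- (n.+2%:R / 2)))).
- by near=> n; rewrite mulr_ge0 ?powR_ge0 ?expR_ge0//= bnd.
- exact: cvg_cst.
rewrite -[X in _ --> X](mulr0 ((2 * x) `^ x)); apply: cvgM; first exact: cvg_cst.
have hy : (n.+2%:R / 2 : R) @[n --> \oo] --> +oo.
  have /cvgryPge h := cvg_n2y; apply/cvgryPge => A.
  by apply: filterS (h (A * 2)) => n; rewrite ler_pdivlMr.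
by have := @cvgr_expR R; apply: cvg_comp.
Unshelve. all: by end_near.
Qed.

(** Integration by parts on the exhausting intervals; both boundary terms
    vanish in the limit. *)
Lemma Gammae_step x : 0 < x -> Gammae (x + 1) = (x%:E * Gammae x)%E.
Proof.
move=> x0.
have h1 := @Gammae_cvg (x + 1).
apply: (cvg_unique _ h1) => //.
have h2 : ((gamma_fun (x + 1) n.+2%:R^-1 - gamma_fun (x + 1) n.+2%:R)%:E +
  x%:E * \int[leb]_(t in exhaust n) (gamma_fun x t)%:E)%E @[n --> \oo] --> (0%:E + x%:E * Gammae x)%E.
  apply: cvgeD.
  - by [].
  - apply: cvg_EFin; first by near=> n.
    rewrite -[X in _ --> X](subr0 0); apply: cvgB.
      exact: gamma_fun_cvg0.
    exact: gamma_fun_cvgy.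
  - apply: cvgeZl => //; exact: Gammae_cvg.
rewrite add0e in h2.
apply: cvg_trans h2; apply: near_eq_cvg; near=> n.
exact/esym/gamma_parts_exhaust.
Unshelve. all: by end_near.
Qed.

Lemma Gammae1 : Gammae 1 = 1%E.
Proof.
have h0 t : gamma_fun 1 t = expR (- t) by rewrite /gamma_fun subrr powRr0 mul1r.
apply: (cvg_unique _ (@Gammae_cvg 1)) => //.
have h : (expR (- n.+2%:R^-1) - expR (- n.+2%:R))%:E @[n --> \oo] --> (1%:E : \bar R).
  apply: cvg_EFin; first by near=> n.
  rewrite -[X in _ --> X]subr0; apply: cvgB.
    rewrite -[X in _ --> X](_ : expR (- 0) = 1); last by rewrite oppr0 expR0.
    have := @continuous_expR R (- 0); apply: cvg_comp; apply: cvgN.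
    exact: cvg_inv_n2.
  by have := @cvgr_expR R; apply: cvg_comp; exact: cvg_n2y.
apply: cvg_trans h; apply: near_eq_cvg; near=> n.
have := gamma_parts_exhaust 0 n; rewrite add0r => ->.
by rewrite mul0e adde0 !h0.
Unshelve. all: by end_near.
Qed.

Lemma GammaS x : 0 < x -> Gamma (x + 1) = x * Gamma x.
Proof.
move=> x0; rewrite (GammaE (x + 1)) (GammaE x) Gammae_step//.
case: (Gammae x) => [r||] /=; first by [].
  by rewrite mulry gtr0_sg// mul1e mulr0.
by rewrite mulrNy gtr0_sg// mul1e mulr0.
Qed.

Lemma Gamma1 : Gamma (1 : R) = 1.
Proof. by rewrite GammaE Gammae1. Qed.

Lemma Gammae_ge0 x : (0 <= Gammae x)%E.
Proof. by apply: integral_ge0 => t _; rewrite lee_fin gamma_fun_ge0. Qed.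

(** A pointwise comparison of powers is the cheapest source of finiteness and
    positivity at 1/2, where neither is visible from the recursion. *)
Lemma Gammae_le x y z :
  (forall t, 0 < t -> t `^ (x - 1) <= t `^ (y - 1) + t `^ (z - 1)) ->
  (Gammae x <= Gammae y + Gammae z)%E.
Proof.
move=> h; rewrite /Gammae -ge0_integralD//; first last.
- exact: measurable_gamma_fun.
- by move=> t _; rewrite lee_fin gamma_fun_ge0.
- exact: measurable_gamma_fun.
- by move=> t _; rewrite lee_fin gamma_fun_ge0.
apply: ge0_le_integral => //.
- by move=> t _; rewrite lee_fin gamma_fun_ge0.
- exact: measurable_gamma_fun.
- by apply: emeasurable_funD; exact: measurable_gamma_fun.
- move=> t /=; rewrite in_itv/= andbT => t0.
  by rewrite -EFinD lee_fin /gamma_fun -mulrDl ler_wpM2r ?expR_ge0// h.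
Qed.

(** With s = sqrt t, the inequality 1 <= s^-1 + s excludes Gamma (1/2) = 0, and
    s <= 1 + s^2 excludes an infinite value. *)
Lemma Gamma_half_gt0 : 0 < Gamma (2^-1 : R).
Proof.
have e32 := @Gammae_step 2^-1; have e2 := @Gammae_step 1 ltr01.
have {}e32 : Gammae (2^-1 + 1) = ((2^-1)%:E * Gammae 2^-1)%E by apply: e32.
have hs (t : R) : 0 < t -> 
    [/\ 0 < Num.sqrt t, t `^ (2^-1 - 1) = (Num.sqrt t)^-1,
     t `^ (2^-1 + 1 - 1) = Num.sqrt t & t = Num.sqrt t ^+ 2].
  move=> t0; split; [by rewrite sqrtr_gt0| |by rewrite addrK powR12_sqrt// ltW|
    by rewrite sqr_sqrtr// ltW].
  rewrite (_ : 2^-1 - 1 = - 2^-1); last by lra.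
  by rewrite powRN powR12_sqrt// ltW.
have le1 : (Gammae 1 <= Gammae 2^-1 + Gammae (2^-1 + 1))%E.
  apply: Gammae_le => t t0; have [s0 -> -> _] := hs t t0.
  rewrite subrr powRr0; set s := Num.sqrt t.
  have [s1|s1] := leP 1 s; first by rewrite (le_trans s1)// lerDr invr_ge0 ltW.
  by rewrite ler_wpDr ?(ltW s0)// invf_ge1 // ltW.
have le2 : (Gammae (2^-1 + 1) <= Gammae 1 + Gammae (1 + 1))%E.
  apply: Gammae_le => t t0; have [s0 _ -> e] := hs t t0.
  rewrite subrr powRr0 addrK powRr1 ?(ltW t0)// [in leRHS]e.
  by have := sqr_ge0 (Num.sqrt t - 2^-1); nra.
rewrite GammaE; move: le1 le2; rewrite e32 e2 Gammae1.
have := Gammae_ge0 2^-1; case: (Gammae 2^-1) => [r||] //=.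
  by rewrite -!EFinM -!EFinD !lee_fin => _ h1 _; lra.
by move=> _ _; rewrite gt0_muley ?lte_fin ?invr_gt0 // -EFinM -EFinD.
Qed.

Lemma Gamma_halfn_gt0 n : 0 < Gamma (n.+1%:R / 2 : R).
Proof.
elim/ltn_ind: n => -[|[|n]] IH; first by rewrite mul1r Gamma_half_gt0.
  by rewrite divff// Gamma1.
rewrite (_ : n.+3%:R / 2 = n.+1%:R / 2 + 1); last by rewrite -[n.+3]addn2 natrD; field.
by rewrite GammaS ?mulr_gt0 ?invr_gt0// IH.
Qed.

Lemma Gamma_natr n : Gamma (n.+1%:R : R) = n`!%:R.
Proof.
elim: n => [|n IH]; first by rewrite Gamma1.
by rewrite -[n.+2]addn1 natrD GammaS// IH -natrM factS.
Qed.

(** The Pochhammer symbol, which carries all ratios of Gamma values that occur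
    below. *)
Definition rising (a : R) n := \prod_(i < n) (a + i%:R).

Lemma Gamma_rising (k n : nat) :
  Gamma (n%:R + k.+1%:R / 2 : R) = Gamma (k.+1%:R / 2) * rising (k.+1%:R / 2) n.
Proof.
rewrite /rising; elim: n => [|n IH]; first by rewrite add0r big_ord0 mulr1.
rewrite -[n.+1]addn1 natrD addrAC GammaS ?IH; last by rewrite ltr_wpDl ?mulr_gt0.
by rewrite addn1 big_ord_recr/=; ring.
Qed.

(** The square of each factor of the product simplifies by the functional
    equation, since 2 n + k + 1 is twice the argument of the Gamma value next
    to it, and the product then telescopes. *)
Lemma A_const_sq d n : (2 <= d)%N ->
  @A_const R d n ^+ 2 = rising (d%:R / 2) n / n`!%:R.
Proof.
move=> d2; have [e de] : exists e, d = e.+2 by exists d.-2; case: d d2 => [|[]].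
have gp k m : 0 < Gamma (m%:R + k.+1%:R / 2 : R).
  rewrite (_ : _ + _ = (m.*2 + k).+1%:R / 2); first exact: Gamma_halfn_gt0.
  by rewrite -addnS natrD -mul2n natrM; field.
have -> : @A_const R d n ^+ 2 = (2 ^- e / Gamma (e.+2%:R / 2)) *
    \prod_(k < e) ((2 * n%:R + k.+1%:R) * Gamma (n%:R + k.+1%:R / 2) /
       Gamma (n%:R + k.+2%:R / 2)).
  rewrite /A_const !exprMn exprVn sqr_sqrtr; last by rewrite de ltW// Gamma_halfn_gt0.
  rewrite {2}de; congr (_ / _ * _).
    rewrite -powR_mulrn ?powR_ge0// -powRrM de.
    rewrite (_ : (2 - e.+2%:R) / 2 * 2%:R = - e%:R); last first.
      by rewrite -[e.+2]addn2 natrD; field.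
    by rewrite powR_invn.
  rewrite big_nat_rev/= -prodrXl /= add0n big_mkord.
  have -> : (d - 2 = e)%N by rewrite de subn2.
  apply: eq_bigr => i _.
  have ei : (e - i.+1)%:R = e%:R - i.+1%:R :> R by rewrite natrB.
  have -> : 2 * n%:R + d%:R - (e - i.+1)%:R - 2 = 2 * n%:R + i.+1%:R :> R.
    by rewrite ei de -[e.+2]addn2 natrD; ring.
  have -> : (d%:R - (e - i.+1)%:R - 2) / 2 = i.+1%:R / 2 :> R.
    by rewrite ei de -[e.+2]addn2 natrD; field.
  have -> : (d%:R - (e - i.+1)%:R - 1) / 2 = i.+2%:R / 2 :> R.
    by rewrite ei de -[e.+2]addn2 natrD -[i.+2]addn1 natrD; field.
  rewrite sqr_sqrtr// divr_ge0 ?mulr_ge0 ?ltW//.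
have -> : rising (d%:R / 2) n = Gamma (n%:R + d%:R / 2) / Gamma (d%:R / 2).
  by rewrite de Gamma_rising mulrAC divff ?mul1r// gt_eqF// Gamma_halfn_gt0.
rewrite de {d d2 de}; elim: e => [|e IH].
  rewrite big_ord0 expr0 invr1 divff// Gamma1 natr1 Gamma_natr; field.
  by rewrite pnatr_eq0 -lt0n fact_gt0.
rewrite big_ord_recr/= exprSr invfM.
have nz k m : Gamma (m%:R + k.+1%:R / 2 : R) != 0 by rewrite gt_eqF.
have nz0 k : Gamma (k.+1%:R / 2 : R) != 0 by rewrite gt_eqF// Gamma_halfn_gt0.
have e3 : Gamma (n%:R + e.+3%:R / 2) = (n%:R + e.+1%:R / 2) * Gamma (n%:R + e.+1%:R / 2) :> R.
  rewrite -GammaS; last by rewrite ltr_wpDl ?mulr_gt0.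
  by congr Gamma; rewrite -[e.+3]addn2 natrD; field.
have nf : n`!%:R != 0 :> R by rewrite pnatr_eq0 -lt0n fact_gt0.
rewrite e3; move: IH; set P := \prod_(k < e) _ => IH.
have {}IH : 2 ^- e * P = Gamma (n%:R + e.+2%:R / 2) / n`!%:R.
  rewrite (_ : 2 ^- e * P = 2 ^- e / Gamma (e.+2%:R / 2) * P * Gamma (e.+2%:R / 2)).
    by rewrite IH; field; rewrite nf nz0.
  by field; rewrite nz0 expf_neq0.
move: (nz e.+1 n) (nz0 e.+2) IH.
move: (Gamma (n%:R + e.+2%:R / 2)) (Gamma (e.+3%:R / 2)) (Gamma (n%:R + e.+1%:R / 2)).
move: (2 ^- e) => q x y z x0 y0 IH.
have -> : q / 2 / y * (P * ((2 * n%:R + e.+1%:R) * z / x)) =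
  (q * P) / y * ((n%:R + e.+1%:R / 2) * z / x) by field; rewrite x0 y0.
by rewrite IH; field; rewrite x0 y0 nf.
Qed.

End GammaFunction.

(** * Euclidean dot product and the mean over the sphere *)

Section Dot.
Variables (R : realType) (m : nat).
Implicit Types (x y z : 'cV[R]_m) (a b : R).

Definition dot x y : R := \sum_(i < m) x i 0 * y i 0.

Lemma dotC x y : dot x y = dot y x.
Proof. by apply: eq_bigr => i _; rewrite mulrC. Qed.

Lemma dotDl x y z : dot (x + y) z = dot x z + dot y z.
Proof. by rewrite -big_split; apply: eq_bigr => i _; rewrite mxE mulrDl. Qed.

Lemma dotZl a x z : dot (a *: x) z = a * dot x z.
Proof. by rewrite mulr_sumr; apply: eq_bigr => i _; rewrite mxE mulrA. Qed.

Lemma dotDr x y z : dot x (y + z) = dot x y + dot x z.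
Proof. by rewrite dotC dotDl !(dotC x). Qed.

Lemma dotZr a x z : dot x (a *: z) = a * dot x z.
Proof. by rewrite dotC dotZl dotC. Qed.

Lemma dotNl x z : dot (- x) z = - dot x z.
Proof. by rewrite -scaleN1r dotZl mulN1r. Qed.

Lemma dotNr x z : dot x (- z) = - dot x z.
Proof. by rewrite dotC dotNl dotC. Qed.

Lemma dot_ge0 x : 0 <= dot x x.
Proof. by apply: sumr_ge0 => i _; rewrite -expr2 sqr_ge0. Qed.

Lemma dot_eq0 x : dot x x = 0 -> x = 0.
Proof.
move=> /psumr_eq0P h; apply/matrixP => i j; rewrite ord1 mxE.
by apply/eqP; rewrite -sqrf_eq0 expr2 h// => k _; rewrite -expr2 sqr_ge0.
Qed.

(** Almost every computation on the sphere goes through the inner product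
    rather than through coordinates. *)
Lemma sphereE x : sphere R m x <-> dot x x = 1.
Proof.
have -> : dot x x = \sum_(i < m) x i 0 ^+ 2 by apply: eq_bigr => i _; rewrite expr2.
by [].
Qed.

Lemma dot_unit_vec x (i : 'I_m) : dot x (unit_vec R m i) = x i 0.
Proof.
rewrite /dot (bigD1 i)//= mxE eqxx mulr1 big1 ?addr0// => j ji.
by rewrite mxE val_eqE (negPf ji) mulr0.
Qed.

Lemma unit_vec_dot (i : 'I_m) : dot (unit_vec R m i) (unit_vec R m i) = 1.
Proof. by rewrite dot_unit_vec mxE eqxx. Qed.

Lemma dot_mulmx (g : 'M[R]_m) x y : dot (g *m x) y = dot x (g^T *m y).
Proof.
transitivity (((g *m x)^T *m y) 0 0).
  by rewrite mxE; apply: eq_bigr => i _; rewrite !mxE.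
rewrite trmx_mul -mulmxA mxE; apply: eq_bigr => i _.
by rewrite !mxE.
Qed.

Lemma orthogonal_dot (g : 'M[R]_m) x y : g *m g^T = 1%:M ->
  dot (g *m x) (g *m y) = dot x y.
Proof. by move=> /mulmx1C h; rewrite dot_mulmx mulmxA h mul1mx. Qed.

Lemma SO_trmx (g : 'M[R]_m) : SOgroup R m g -> SOgroup R m g^T.
Proof. by move=> [h1 h2]; split; [rewrite trmxK; exact: mulmx1C|rewrite det_tr]. Qed.

Lemma dot_le1 x y : dot x x = 1 -> dot y y = 1 -> `|dot x y| <= 1.
Proof.
move=> x1 y1; rewrite ler_norml.
have := dot_ge0 (x - y); have := dot_ge0 (x + y).
rewrite !dotDl !dotDr !dotNl !dotNr x1 y1 (dotC y x) => h1 h2.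
by apply/andP; split; lra.
Qed.

Lemma coord_le1 x i : dot x x = 1 -> `|x i 0| <= 1.
Proof. by move=> x1; rewrite -dot_unit_vec dot_le1// unit_vec_dot. Qed.

End Dot.

Section SphereMean.
Variables (R : realType) (m : nat) (mu : probability (borel_vec R m) R).
Hypothesis mu1 : mu (sphere R m) = 1%E.
Implicit Types (f g : 'cV[R]_m -> R) (a : R) (v : 'cV[R]_m).

Let S : set (borel_vec R m) := sphere R m.

Lemma measurable_coord (i : 'I_m) (D : set (borel_vec R m)) :
  measurable_fun D (fun x : borel_vec R m => (x : 'cV[R]_m) i 0).
Proof.
apply: measurable_funTS.
apply: (measurability _ (RGenOpens.measurableE R)).
move=> _ [_ [a [b ->]] <-]; rewrite setTI; apply: sub_sigma_algebra.
have /continuousP := @coord_continuous R m 1 i 0; apply.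
exact: interval_open.
Qed.

Lemma measurable_dot v (D : set (borel_vec R m)) :
  measurable_fun D (dot v : borel_vec R m -> R).
Proof.
apply: measurable_sum => i; apply: measurable_funM; first exact: measurable_cst.
exact: measurable_coord.
Qed.

Lemma measurable_sphere : measurable S.
Proof.
rewrite /S; have -> : sphere R m =
    (fun x : borel_vec R m => \sum_(i < m) (x : 'cV[R]_m) i 0 ^+ 2) @^-1` [set 1].
  by [].
rewrite -[X in measurable X]setTI.
have h : measurable_fun setT
    (fun x : borel_vec R m => \sum_(i < m) (x : 'cV[R]_m) i 0 ^+ 2).
  by apply: measurable_sum => i; apply: measurable_funX; exact: measurable_coord.
exact: h.
Qed.
Hint Resolve measurable_sphere : core.

(** Bounded measurable functions form an algebra stable under polynomials,
    which discharges every integrability condition on explicit functions. *)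
Definition bmf f := measurable_fun S (f : borel_vec R m -> R) /\
  exists M : R, forall x, sphere R m x -> `|f x| <= M.

Definition L1s f := mu.-integrable S (EFin \o (f : borel_vec R m -> R)).

Definition L2s f := measurable_fun S (f : borel_vec R m -> R) /\
  L1s (fun x => f x ^+ 2).

Definition mean f : R := \int[mu]_(x in sphere R m) f x.

Lemma bmf_cst a : bmf (fun=> a).
Proof. by split; [exact: measurable_cst|exists `|a|]. Qed.

Lemma bmf_coord i : bmf (fun x => x i 0).
Proof.
split; first exact: measurable_coord.
by exists 1 => x /sphereE; exact: coord_le1.
Qed.

Lemma bmfD f g : bmf f -> bmf g -> bmf (fun x => f x + g x).
Proof.
move=> [mf [M hM]] [mg [N hN]]; split; first exact: measurable_funD.
by exists (M + N) => x Sx; rewrite (le_trans (ler_normD _ _))// lerD ?hM ?hN.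
Qed.

Lemma bmfM f g : bmf f -> bmf g -> bmf (fun x => f x * g x).
Proof.
move=> [mf [M hM]] [mg [N hN]]; split; first exact: measurable_funM.
by exists (M * N) => x Sx; rewrite normrM ler_pM ?hM ?hN.
Qed.

Lemma bmfZ a f : bmf f -> bmf (fun x => a * f x).
Proof. by move=> ?; apply: bmfM => //; exact: bmf_cst. Qed.

Lemma bmfX f n : bmf f -> bmf (fun x => f x ^+ n).
Proof.
move=> bf; elim: n => [|n IH]; first exact: bmf_cst.
by under eq_fun do rewrite exprS; exact: bmfM.
Qed.

Lemma bmf_sum (I : Type) (r : seq I) (P : pred I) (F : I -> 'cV[R]_m -> R) :
  (forall i, bmf (F i)) -> bmf (fun x => \sum_(i <- r | P i) F i x).
Proof.
move=> bF; elim: r => [|i r IH].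
  by under eq_fun do rewrite big_nil; exact: bmf_cst.
under eq_fun do rewrite big_cons.
by case: (P i) => //; exact: bmfD.
Qed.

Lemma bmf_dot v : bmf (dot v).
Proof. by apply: bmf_sum => i; apply: bmfZ; exact: bmf_coord. Qed.

Lemma bmf_horner (p : {poly R}) f : bmf f -> bmf (fun x => p.[f x]).
Proof.
move=> bf; under eq_fun do rewrite horner_coef.
by apply: bmf_sum => i; apply: bmfZ; exact: bmfX.
Qed.

Lemma bmf_L1 f : bmf f -> L1s f.
Proof.
move=> [mf [M hM]]; apply: measurable_bounded_integrable => //.
  exact: (eq_ind_r (fun z => (z < +oo)%E) (ltey 1) mu1).
exists M; split; first exact: num_real.
by move=> N MN x Sx /=; exact: le_trans (hM x Sx) (ltW MN).
Qed.

Lemma bmf_L2 f : bmf f -> L2s f.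
Proof. by move=> bf; split; [case: bf|apply: bmf_L1; exact: bmfX]. Qed.

(** From 2 |f g| <= f^2 + g^2. *)
Lemma L2_L1M f g : L2s f -> L2s g -> L1s (fun x => f x * g x).
Proof.
move=> [mf if2] [mg ig2].
have h : L1s (fun x => f x ^+ 2 + g x ^+ 2).
  by have := integrableD measurable_sphere if2 ig2; apply: eq_integrable.
apply: le_integrable h => //.
  by apply/measurable_EFinP; exact: measurable_funM.
move=> x _ /=; rewrite lee_fin normrM.
rewrite [leRHS]ger0_norm ?addr_ge0 ?sqr_ge0//.
rewrite -(real_normK (num_real (f x))) -(real_normK (num_real (g x))).
have := sqr_ge0 (`|f x| - `|g x|); have := normr_ge0 (f x); have := normr_ge0 (g x).
nra.
Qed.

Lemma L1D f g : L1s f -> L1s g -> L1s (fun x => f x + g x).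
Proof.
by move=> hf hg; have := integrableD measurable_sphere hf hg; apply: eq_integrable.
Qed.

Lemma L1Z a f : L1s f -> L1s (fun x => a * f x).
Proof.
by move=> hf; have := integrableZl measurable_sphere a hf; apply: eq_integrable.
Qed.

Lemma L2D f g : L2s f -> L2s g -> L2s (fun x => f x + g x).
Proof.
move=> hf hg; split; first by case: hf => ? _; case: hg => ? _; exact: measurable_funD.
have := L1D (L1D hf.2 (L1Z 2 (L2_L1M hf hg))) hg.2.
by congr L1s; apply/funext => x; ring.
Qed.

Lemma L2Z a f : L2s f -> L2s (fun x => a * f x).
Proof.
move=> [mf hf]; split; first by apply: measurable_funM => //; exact: measurable_cst.
by under eq_fun do rewrite exprMn; exact: L1Z.
Qed.

Lemma L2N f : L2s f -> L2s (fun x => - f x).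
Proof. by move=> h; under eq_fun do rewrite -mulN1r; exact: L2Z. Qed.

Lemma L2B f g : L2s f -> L2s g -> L2s (fun x => f x - g x).
Proof. by move=> hf hg; apply: L2D => //; exact: L2N. Qed.

Lemma L2_sum (I : Type) (r : seq I) (F : I -> 'cV[R]_m -> R) :
  (forall i, L2s (F i)) -> L2s (fun x => \sum_(i <- r) F i x).
Proof.
move=> bF; elim: r => [|i r IH].
  by under eq_fun do rewrite big_nil; apply/bmf_L2/bmf_cst.
by under eq_fun do rewrite big_cons; exact: L2D.
Qed.

Lemma eq_mean f g : (forall x, sphere R m x -> f x = g x) -> mean f = mean g.
Proof. by move=> h; apply: eq_Rintegral => x; rewrite inE => /h. Qed.

Lemma meanD f g : L1s f -> L1s g -> mean (fun x => f x + g x) = mean f + mean g.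
Proof. by move=> hf hg; rewrite /mean RintegralD. Qed.

Lemma meanZ a f : L1s f -> mean (fun x => a * f x) = a * mean f.
Proof. by move=> hf; rewrite /mean RintegralZl. Qed.

Lemma mean_cst a : mean (fun=> a) = a.
Proof.
rewrite /mean Rintegral_cst// -[RHS]mulr1; congr (_ * _).
exact: (congr1 fine mu1).
Qed.

Lemma mean_sum (I : Type) (r : seq I) (F : I -> 'cV[R]_m -> R) :
  (forall i, L1s (F i)) ->
  mean (fun x => \sum_(i <- r) F i x) = \sum_(i <- r) mean (F i).
Proof.
move=> bF; elim: r => [|i r IH].
  by under eq_fun do rewrite big_nil; rewrite mean_cst big_nil.
under eq_fun do rewrite big_cons; rewrite big_cons meanD// ?IH//.
elim: r {IH} => [|j r IH]; first by under eq_fun do rewrite big_nil; apply/bmf_L1/bmf_cst.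
by under eq_fun do rewrite big_cons; exact: L1D.
Qed.

Lemma mean_ge0 f : (forall x, sphere R m x -> 0 <= f x) -> 0 <= mean f.
Proof. by move=> h; apply: (@Rintegral_ge0 _ _ _ mu S f h). Qed.

Lemma le_mean f g : L1s f -> L1s g -> (forall x, sphere R m x -> f x <= g x) ->
  mean f <= mean g.
Proof. by move=> hf hg h; apply: le_Rintegral. Qed.

End SphereMean.

(** * Invariance under rotations *)

Section PolyExt.
Variable R : realType.

(** Identities between generating polynomials are obtained by evaluation, since
    the field is infinite. *)
Lemma horner_inj (p q : {poly R}) : (forall t, p.[t] = q.[t]) -> p = q.
Proof.
move=> h; apply/eqP; rewrite -subr_eq0; apply/negPn/negP => nz.
have /max_poly_roots := nz => /(_ [seq i%:R | i <- iota 0 (size (p - q))]).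
rewrite size_map size_iota ltnn => H; suff : false by []; apply: H.
  by apply/allP => x _; rewrite /root hornerD hornerN h subrr.
by rewrite map_inj_uniq ?iota_uniq// => i j /eqP; rewrite eqr_nat => /eqP.
Qed.

Lemma coef2_1X2 (n : nat) : ((1 + 'X^2 : {poly R}) ^+ n)`_2 = n%:R.
Proof.
have c0 k : ((1 + 'X^2 : {poly R}) ^+ k)`_0 = 1.
  by rewrite -horner_coef0 !hornerE expr0n addr0 expr1n.
elim: n => [|n IH]; first by rewrite expr0 coef1.
by rewrite exprSr mulrDr mulr1 coefD coefMXn/= IH subnn c0 natr1.
Qed.

End PolyExt.

Section Invariance.
Variables (R : realType) (m : nat) (mu : probability (borel_vec R m) R).
Hypothesis hmu : rotation_invariant mu.
Let mu1 : mu (sphere R m) = 1%E := hmu.1.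

Lemma lincomb_continuous (r : seq 'I_m) (c : 'I_m -> R) (j : 'I_1) :
  continuous (fun y : 'cV[R]_m => \sum_(k <- r) c k * y k j).
Proof.
elim: r => [|k r IH] x; have Fx : Filter (nbhs (x : 'cV[R]_m)) by exact: nbhs_filter.
  rewrite (_ : (fun y : 'cV[R]_m => _) = fun=> 0); first exact: cvg_cst.
  by apply/funext => y; rewrite big_nil.
rewrite (_ : (fun y : 'cV[R]_m => _) = fun y => c k * y k j + \sum_(k <- r) c k * y k j).
  by apply: cvgD; [apply: cvgM; [exact: cvg_cst|exact: coord_continuous]|exact: IH].
by apply/funext => y; rewrite big_cons.
Qed.

Lemma mulmx_continuous (g : 'M[R]_m) : continuous (fun x : 'cV[R]_m => g *m x).
Proof.
move=> x A /= /nbhs_ballP[e /= e0 sA].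
have Fx : Filter (nbhs (x : 'cV[R]_m)) by exact: nbhs_filter.
have : \forall y \near x, forall ij : 'I_m * 'I_1,
    ball ((g *m x) ij.1 ij.2) e ((g *m y) ij.1 ij.2).
  apply: (@filter_forall _ _ _ _ Fx) => -[i j].
  have : (fun y : 'cV[R]_m => (g *m y) i j) y @[y --> x] --> (g *m x) i j.
    rewrite (_ : (fun y : 'cV[R]_m => _) = fun y => \sum_k g i k * y k j).
      by rewrite mxE; exact: (@lincomb_continuous _ (fun k => g i k)).
    by apply/funext => y; rewrite mxE.
  by move/cvg_ballP => /(_ e e0).
apply: (@filterS _ _ Fx) => y hy; apply: sA; split => // i j; exact: (hy (i, j)).
Qed.

Lemma measurable_mulmx (g : 'M[R]_m) :
  measurable_fun setT ((fun x : 'cV[R]_m => g *m x) : borel_vec R m -> borel_vec R m).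
Proof.
apply: (@measurability _ _ (borel_vec R m) (borel_vec R m) setT _ (@open 'cV[R]_m) erefl).
move=> _ [A oA <-]; rewrite setTI; apply: sub_sigma_algebra.
by have /continuousP := mulmx_continuous (g := g); apply.
Qed.

(** The change of variables behind every use of invariance. *)
Lemma mean_rotate (g : 'M[R]_m) (F : 'cV[R]_m -> R) : SOgroup R m g ->
  measurable_fun setT (F : borel_vec R m -> R) -> bmf F ->
  mean mu (fun y => F (g *m y)) = mean mu F.
Proof.
move=> hg mF bF.
have pre : (fun x : 'cV[R]_m => g *m x) @^-1` sphere R m = sphere R m.
  apply/seteqP; split => x /=; rewrite !sphereE orthogonal_dot//; by case: hg.
have mg := @measurable_mulmx g.
rewrite /mean /Rintegral; congr fine; apply/esym.
transitivity (\int[pushforward mu ((fun x : 'cV[R]_m => g *m x) : borel_vec R m -> borel_vec R m)]_(x in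
   (sphere R m : set (borel_vec R m))) (F x)%:E)%E.
  apply: eq_measure_integral => A mA _.
  by rewrite /pushforward; have := hmu.2 g hg A mA.
rewrite (integral_pushforward mg)//=.
- by rewrite pre.
- exact/measurable_EFinP.
- rewrite pre; apply: (bmf_L1 mu1); case: bF => _ [M hM]; split.
    by apply: measurable_funTS; exact: (measurableT_comp mF mg).
  by exists M => x; rewrite -[X in X x]pre => /hM.
- exact: measurable_sphere.
Qed.

End Invariance.

(** * Moments of an invariant measure *)

Section Moments.
Variables (R : realType) (m : nat) (mu : probability (borel_vec R m) R).
Hypothesis hmu : rotation_invariant mu.
Let mu1 : mu (sphere R m) = 1%E := hmu.1.
Variable i0 : 'I_m.
Let e := unit_vec R m i0.
Hypothesis transitive_SO : forall v : 'cV[R]_m, dot v v = 1 ->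
  exists2 g, SOgroup R m g & g *m e = v.
Implicit Types (v a b x y : 'cV[R]_m).
Let bd v := bmf_dot v.

Definition mom (k : nat) : R := mean mu (fun y => dot e y ^+ k).

(** Invariance makes the moments of a linear form independent of its direction.
    *)
Lemma mom_unit v k : dot v v = 1 -> mean mu (fun y => dot v y ^+ k) = mom k.
Proof.
move=> /transitive_SO[g hg <-]; rewrite /mom.
rewrite -(mean_rotate hmu hg).
- by apply: eq_mean => y _; rewrite orthogonal_dot//; case: hg.
- by apply: measurable_funX; exact: measurable_dot.
- exact/bmfX/bd.
Qed.

Lemma mom_odd k : odd k -> mom k = 0.
Proof.
move=> ok; have h : mom k = - mom k.
  rewrite -[LHS](@mom_unit (- e)); last by rewrite dotNl dotNr opprK unit_vec_dot.
  rewrite -mulN1r /mom -meanZ//; last exact/(bmf_L1 mu1)/bmfX/bd.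
  by apply: eq_mean => y _; rewrite dotNl exprNn -signr_odd ok expr1.
lra.
Qed.

Lemma mom0 : mom 0 = 1.
Proof. by rewrite /mom; under eq_mean do rewrite expr0; rewrite mean_cst. Qed.

(** Homogeneity extends the previous identity to all vectors; odd moments
    vanish, so that the rounding in k./2 is harmless. *)
Lemma moment1 v k :
  mean mu (fun y => dot v y ^+ k) = mom k * dot v v ^+ k./2.
Proof.
have [v0|v0] := eqVneq (dot v v) 0.
  rewrite (dot_eq0 v0); have d0 y : dot 0 y = 0 by rewrite /dot big1// => i _; rewrite mxE mul0r.
  under eq_mean do rewrite d0; rewrite mean_cst// d0.
  case: k => [|k]; first by rewrite !expr0 mom0 mulr1.
  have [ok|ek] := boolP (odd k.+1); first by rewrite mom_odd// mul0r expr0n.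
  by case: k ek => // k _; rewrite !expr0n/= mulr0.
have v_gt0 : 0 < dot v v by rewrite lt_neqAle eq_sym v0 dot_ge0.
set r := Num.sqrt (dot v v).
have r0 : 0 < r by rewrite sqrtr_gt0.
have r2 : r ^+ 2 = dot v v by rewrite sqr_sqrtr// ltW.
have u1 : dot (r^-1 *: v) (r^-1 *: v) = 1.
  by rewrite dotZl dotZr -r2; field; rewrite gt_eqF.
have -> : mean mu (fun y => dot v y ^+ k) = r ^+ k * mom k.
  rewrite -(mom_unit k u1) -meanZ//; last exact/(bmf_L1 mu1)/bmfX/bd.
  apply: eq_mean => y _; rewrite dotZl exprMn mulrA -exprMn divff ?expr1n ?mul1r//.
  by rewrite gt_eqF.
have [ok|ek] := boolP (odd k); first by rewrite mom_odd// mul0r mulr0.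
rewrite mulrC -r2 -exprM; congr (_ * _ ^+ _).
by rewrite mul2n even_halfK.
Qed.

(** Polarisation: apply the identity for one linear form to a + t b and compare
    the coefficients of t^q. The quadratic polynomial in the statement is the
    square of the length of a + X b. *)
Lemma moment2 a b p q :
  'C(p + q, q)%:R * mean mu (fun y => dot a y ^+ p * dot b y ^+ q) =
  mom (p + q) * (((dot a a)%:P + (2 * dot a b)%:P * 'X + (dot b b)%:P * 'X^2)
                   ^+ (p + q)./2)`_q.
Proof.
set N := (p + q)%N.
pose P := \poly_(k < N.+1) ('C(N, k)%:R * mean mu (fun y => dot a y ^+ (N - k) * dot b y ^+ k)).
have bk k : L1s mu (fun y => dot a y ^+ (N - k) * dot b y ^+ k).
  by apply/(bmf_L1 mu1)/bmfM; apply/bmfX/bd.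
set Q := (X in X ^+ _).
have PQ : P = mom N *: Q ^+ N./2.
  apply: horner_inj => t; rewrite hornerZ horner_exp.
  have -> : Q.[t] = dot (a + t *: b) (a + t *: b).
    by rewrite /Q !hornerE/= !dotDl !dotDr !dotZl !dotZr (dotC b a)/=; ring.
  rewrite -moment1 horner_poly.
  transitivity (mean mu (fun y => \sum_(k < N.+1) ('C(N, k)%:R * t ^+ k) *
      (dot a y ^+ (N - k) * dot b y ^+ k))).
    rewrite mean_sum//; last by move=> k; exact: L1Z.
    by apply: eq_bigr => k _; rewrite meanZ//; ring.
  apply: eq_mean => y _; rewrite dotDl dotZl exprDn; apply: eq_bigr => k _.
  by rewrite exprMn -mulr_natl; ring.
have := congr1 (fun r : {poly R} => r`_q) PQ.
by rewrite coefZ coef_poly ltnS leq_addl addnK.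
Qed.

(** On the sphere the squares of the coordinates add up to 1. Multiply this by
    the 2n-th power of one coordinate and average: the mixed moments with the m
    - 1 other coordinates are known by polarisation. *)
Lemma mom_rec n : (2 * n + m)%:R * mom n.*2.+2 = n.*2.+1%:R * mom n.*2.
Proof.
have J (i : 'I_m) : i != i0 ->
    n.*2.+1%:R * mean mu (fun y => dot e y ^+ n.*2 * y i 0 ^+ 2) = mom n.*2.+2.
  move=> ii0; have := moment2 e (unit_vec R m i) n.*2 2.
  rewrite /e !unit_vec_dot dot_unit_vec mxE val_eqE (negPf ii0) mulr0 mul0r addr0.
  rewrite !mul1r polyC1 addn2 /= doubleK coef2_1X2 bin2.
  have -> : (n.*2.+2 * n.*2.+1)./2 = (n.+1 * n.*2.+1)%N.
    by rewrite -doubleS -doubleMl doubleK.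
  rewrite natrM -mulrA (mulrC (mom _)) => /(mulfI _) <- //.
    congr (_ * _); apply: eq_mean => y _; by rewrite (dotC (unit_vec R m i)) dot_unit_vec.
have h : mom n.*2 = mom n.*2.+2 + \sum_(i | i != i0) mean mu (fun y => dot e y ^+ n.*2 * y i 0 ^+ 2).
  transitivity (mean mu (fun y => \sum_i dot e y ^+ n.*2 * y i 0 ^+ 2)).
    by apply: eq_mean => y ys; rewrite -mulr_sumr ys mulr1.
  rewrite mean_sum//; last first.
    by move=> i; apply/(bmf_L1 mu1)/bmfM; apply/bmfX; [exact: bd|exact: bmf_coord].
  rewrite (bigD1 i0)//=; congr (_ + _); apply: eq_mean => y _.
  by rewrite (dotC e y) dot_unit_vec -exprD addn2.
have : n.*2.+1%:R * mom n.*2 = n.*2.+1%:R * mom n.*2.+2 + (m.-1)%:R * mom n.*2.+2.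
  rewrite {1}h mulrDr mulr_sumr (eq_bigr (fun=> mom n.*2.+2)); last by move=> i; exact: J.
  by rewrite sumr_const cardC1 card_ord [in RHS](mulr_natl _ m.-1).
move=> ->; rewrite -mulrDl -natrD; congr (_%:R * _).
by rewrite mul2n addSnnS prednK// (leq_ltn_trans _ (ltn_ord i0)).
Qed.

(** The law of one coordinate, as a functional on polynomials. *)
Definition Lp (p : {poly R}) : R := mean mu (fun y => p.[dot e y]).

Lemma bmf_hdot v (p : {poly R}) : bmf (fun y => p.[dot v y]).
Proof. exact/bmf_horner/bd. Qed.

Lemma LpD p q : Lp (p + q) = Lp p + Lp q.
Proof.
rewrite -meanD//; do ?exact/(bmf_L1 mu1)/bmf_hdot.
by apply: eq_mean => y _; rewrite hornerD.
Qed.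

Lemma LpZ c p : Lp (c *: p) = c * Lp p.
Proof.
rewrite -meanZ//; do ?exact/(bmf_L1 mu1)/bmf_hdot.
by apply: eq_mean => y _; rewrite hornerZ.
Qed.

Lemma LpXn n : Lp 'X^n = mom n.
Proof. by apply: eq_mean => y _; rewrite hornerXn. Qed.

Lemma Lp0 : Lp 0 = 0.
Proof. by rewrite -(scale0r 0) LpZ mul0r. Qed.

Lemma Lp_unit v p : dot v v = 1 -> mean mu (fun y => p.[dot v y]) = Lp p.
Proof.
move=> v1; rewrite /Lp; under eq_mean do rewrite horner_coef.
under [RHS]eq_mean do rewrite horner_coef.
rewrite !mean_sum//; try by move=> k; apply/(bmf_L1 mu1)/bmfZ/bmfX/bd.
apply: eq_bigr => k _; rewrite !meanZ; [by rewrite mom_unit|exact/(bmf_L1 mu1)/bmfX/bd..].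
Qed.

(** The Pearson equation of the density (1 - t^2)^((m - 3) / 2) of a
    coordinate, in the weak form that moments provide. *)
Lemma Lp_pearson p : Lp ((1 - 'X^2) * p^`()) = (m.-1)%:R * Lp ('X * p).
Proof.
have m0 : (0 < m)%N by rewrite (leq_ltn_trans _ (ltn_ord i0)).
have mono k : Lp ((1 - 'X^2) * 'X^k^`()) = (m.-1)%:R * Lp ('X * 'X^k).
  rewrite derivXn -exprS LpXn; case: k => [|k].
    by rewrite mulr0n mulr0 Lp0 mom_odd ?mulr0.
  rewrite -scaler_nat -scalerAr LpZ mulrBl mul1r -exprD/= LpD -scaleN1r LpZ !LpXn mulN1r.
  rewrite add2n.
  have [ok|ek] := boolP (odd k); first by rewrite !mom_odd//= ?ok// subrr !mulr0.
  rewrite -(even_halfK ek); have := mom_rec k./2.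
  rewrite (_ : (2 * k./2 + m)%N = (k./2.*2.+1 + m.-1)%N); last first.
    by rewrite addSnnS prednK// mul2n.
  by rewrite natrD mulrDl => h; rewrite mulrBr -h; ring.
rewrite -[p]coefK poly_def; elim/big_rec: _ => [|i q _ IH].
  by rewrite deriv0 !mulr0 Lp0 mulr0.
rewrite derivD derivZ !mulrDr !LpD IH -!scalerAr !LpZ mono; ring.
Qed.

(** The moments of 1 + t have a first-order recursion. They are the leading
    coefficients of the Gegenbauer polynomials one dimension higher, and the
    normalising constants of the approximate identity (1 + t)^n. *)
Definition binmom n : R := Lp ((1 + 'X) ^+ n).

(** The Pearson equation for p = (1 + t)^n, with 1 - t = 2 - (1 + t). *)
Lemma binmom_rec n : (n + m.-1)%:R * binmom n.+1 = (2 * n + m.-1)%:R * binmom n.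
Proof.
rewrite /binmom; case: n => [|n].
  rewrite muln0 !add0n expr1 expr0 LpD (_ : Lp 'X = 0) ?addr0 //.
  by rewrite -['X]expr1 LpXn mom_odd.
have := Lp_pearson ((1 + 'X) ^+ n.+1).
have -> : ((1 + 'X) ^+ n.+1)^`() = n.+1%:R *: (1 + 'X) ^+ n :> {poly R}.
  by rewrite deriv_exp/= derivD derivX -polyC1 derivC add0r mul1r scaler_nat.
rewrite -scalerAr LpZ.
have -> : (1 - 'X^2) * (1 + 'X) ^+ n =
    2 *: (1 + 'X) ^+ n.+1 + (-1) *: (1 + 'X) ^+ n.+2 :> {poly R}.
  rewrite !exprS -!mul_polyC rmorphN/= polyC1; ring.
have -> : 'X * (1 + 'X) ^+ n.+1 = (1 + 'X) ^+ n.+2 + (-1) *: (1 + 'X) ^+ n.+1 :> {poly R}.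
  rewrite !exprS -!mul_polyC rmorphN/= polyC1; ring.
rewrite !LpD !LpZ => h; rewrite !natrD natrM.
have e1 (u v A B : R) : u * (2 * A + - 1 * B) = v * (B + - 1 * A) ->
   (u + v) * B = (2 * u + v) * A by move=> h'; nra.
exact: e1.
Qed.

Lemma binmomE n : binmom n = \sum_(k < n.+1) 'C(n, k)%:R * mom k.
Proof.
rewrite /binmom exprDn; under eq_bigr do rewrite expr1n mul1r -scaler_nat.
rewrite /=; elim/big_rec2: _ => [|k y x _ IH]; first by rewrite Lp0.
by rewrite LpD IH LpZ LpXn.
Qed.

End Moments.

(** * Real parts of powers, and a Funk-Hecke formula *)

Section RePow.
Variable R : realType.
Implicit Types a b : R.

(** For orthonormal u and z, the function Re (<u, x> + i <z, x>)^n is a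
    harmonic polynomial of degree n. Every harmonic that occurs is a
    combination of such waves. *)
Definition RePow (n : nat) a b : R := complex.Re ((a +i* b) ^+ n).

Definition Reik (k : nat) : R := complex.Re ('i ^+ k : R[i]).

Lemma Re_sum (I : Type) (r : seq I) (F : I -> R[i]) :
  complex.Re (\sum_(i <- r) F i) = \sum_(i <- r) complex.Re (F i).
Proof. exact: (raddf_sum (@complex.Re R)). Qed.

Lemma Re_realM (x : R) (z : R[i]) : complex.Re (x%:C * z) = x * complex.Re z.
Proof. by case: z => u v /=; rewrite mul0r subr0. Qed.

Lemma RePowE n a b :
  RePow n a b = \sum_(k < n.+1) ('C(n, k)%:R * Reik k) * (a ^+ (n - k) * b ^+ k).
Proof.
rewrite /RePow.
have -> : a +i* b = a%:C + 'i * b%:C by simpc.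
rewrite exprDn Re_sum; apply: eq_bigr => k _.
rewrite exprMn -mulr_natl.
have -> : 'C(n, k)%:R = ('C(n, k)%:R : R)%:C :> R[i] by rewrite rmorph_nat.
rewrite -!rmorphXn/= (mulrCA _ ('i ^+ k)) (mulrC ('i ^+ k)).
rewrite mulrA -rmorphM mulrA -rmorphM Re_realM; rewrite /Reik; ring.
Qed.

Lemma Reik_odd k : odd k -> Reik k = 0.
Proof.
move=> ok; rewrite /Reik -(odd_double_half k) ok add1n exprS -mul2n exprM sqr_i.
have -> : (- 1) ^+ k./2 = ((- 1) ^+ k./2 : R)%:C :> R[i] by rewrite rmorphXn rmorphN1.
by rewrite mulrC Re_realM mulr0.
Qed.

Lemma Reik_even k : Reik k.*2 = (- 1) ^+ k.
Proof.
rewrite /Reik -mul2n exprM sqr_i.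
by have -> : (- 1) ^+ k = ((- 1) ^+ k : R)%:C :> R[i] by rewrite rmorphXn rmorphN1.
Qed.

End RePow.

Section FunkHecke.
Variables (R : realType) (m : nat) (mu : probability (borel_vec R m) R).
Hypothesis hmu : rotation_invariant mu.
Let mu1 : mu (sphere R m) = 1%E := hmu.1.
Variable i0 : 'I_m.
Hypothesis transitive_SO : forall v : 'cV[R]_m, dot v v = 1 ->
  exists2 g, SOgroup R m g & g *m unit_vec R m i0 = v.
Implicit Types (v a b x y : 'cV[R]_m).
Let bd v := bmf_dot v.
Notation mom := (mom mu i0).

Lemma bmf_RePow n a b : bmf (fun y => RePow n (dot a y) (dot b y)).
Proof.
under eq_fun do rewrite RePowE.
by apply: bmf_sum => k; apply/bmfZ/bmfM; apply/bmfX/bd.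
Qed.

Definition fh_coef (n k : nat) : R :=
  mom (n + k) / 'C(n + k, k)%:R *
    (if (k < n)%N then 0 else 'C((n + k)./2, k - (n + k)./2)%:R * 2 ^+ n).

(** The quadratic polynomial attached to an isotropic vector has no constant
    term; for k below M the coefficient therefore vanishes, which is the
    orthogonality of a wave to polynomials of lower degree. *)
Lemma coef_qX2zX (z q : R[i]) (M k : nat) :
  (((2 * z)%:P * 'X + q%:P * 'X^2) ^+ M)`_k =
  if (k < M)%N then 0 else 'C(M, k - M)%:R * (q ^+ (k - M) * (2 * z) ^+ (M - (k - M))).
Proof.
have -> : (2 * z)%:P * 'X + q%:P * 'X^2 = ((2 * z)%:P + q%:P * 'X) * 'X :> {poly R[i]} by ring.
rewrite exprMn coefMXn; case: ltnP => // Mk.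
rewrite exprDn coef_sum.
have E (i : 'I_M.+1) : ((2 * z)%:P ^+ (M - i) * (q%:P * 'X) ^+ i *+ 'C(M, i))`_(k - M) =
    ((2 * z) ^+ (M - i) * q ^+ i * (k - M == i)%N%:R) *+ 'C(M, i).
  by rewrite exprMn -!polyC_exp coefMn mulrA -rmorphM coefCM coefXn.
under eq_bigr do rewrite E.
have [kM|kM] := leqP (k - M) M.
  rewrite (bigD1 (Ordinal (kM : (k - M < M.+1)%N)))//= eqxx mulr1.
  rewrite big1 ?addr0 => [|i ine]; first by rewrite -mulr_natl (mulrC (q ^+ _)).
  case: eqP => [e|_]; last by rewrite mulr0 mul0rn.
  by case/eqP: ine; apply: val_inj.
rewrite bin_small// mul0r big1// => i _.
case: eqP => [e|_]; last by rewrite mulr0 mul0rn.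
by move: (ltn_ord i); rewrite -e ltnS leqNgt kM.
Qed.

Lemma map_quadratic (A B : nzRingType) (f : {rmorphism A -> B}) c0 c1 c2 :
  map_poly f (c0%:P + c1%:P * 'X + c2%:P * 'X^2) =
    (f c0)%:P + (f c1)%:P * 'X + (f c2)%:P * 'X^2.
Proof.
apply/polyP => i; rewrite coef_map !coefD !coefC !coefCM !coefX !coefXn /=.
by rewrite !rmorphD !rmorphM /= !rmorph_nat; case: (i == 0)%N; rewrite ?rmorph0.
Qed.

(** The Funk-Hecke formula on waves: on the sphere, averaging against <x, y>^k
    multiplies the wave by a scalar that depends on n and k only. The
    second-moment identity for a + s b and x is polynomial in s; its value at s
    = i makes the form isotropic, because <a + i b, a + i b> = 0, and only the
    cross term 2 <a + i b, x> survives. The average is therefore a multiple of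
    the real part of a power of <a + i b, x>. *)
Lemma funk_hecke_monomial n k a b x :
  dot a a = 1 -> dot b b = 1 -> dot a b = 0 ->
  mean mu (fun y => RePow n (dot a y) (dot b y) * dot x y ^+ k) =
  fh_coef n k * dot x x ^+ (k - n)./2 * RePow n (dot a x) (dot b x).
Proof.
move=> a1 b1 ab; set N := (n + k)%N.
pose J l := mean mu (fun y => (dot a y ^+ (n - l) * dot b y ^+ l) * dot x y ^+ k).
have bJ l : L1s mu (fun y => (dot a y ^+ (n - l) * dot b y ^+ l) * dot x y ^+ k).
  by apply/(bmf_L1 mu1)/bmfM/bmfX/bd/bmfM; apply/bmfX/bd.
pose P : {poly R} := \poly_(l < n.+1) ('C(n, l)%:R * ('C(N, k)%:R * J l)).
pose W : {poly {poly R}} := (1 + 'X^2)%:P + (2 *: ((dot a x)%:P + (dot b x) *: 'X))%:P * 'X + (dot x x)%:P%:P * 'X^2.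
have PW : P = mom N *: (W ^+ N./2)`_k.
  apply: horner_inj => s; rewrite hornerZ.
  have -> : ((W ^+ N./2)`_k).[s] = ((map_poly (horner_eval s) W) ^+ N./2)`_k.
    by rewrite -rmorphXn/= coef_map.
  have -> : map_poly (horner_eval s) W = (dot (a + s *: b) (a + s *: b))%:P +
      (2 * dot (a + s *: b) x)%:P * 'X + (dot x x)%:P * 'X^2.
    rewrite map_quadratic; congr (_%:P + _%:P * _ + _%:P * _); last exact: hornerC.
      rewrite -[LHS]/((1 + 'X^2).[s]) !hornerE/=.
      by rewrite !dotDl !dotDr !dotZl !dotZr (dotC b a) a1 b1 ab/=; ring.
    rewrite -[LHS]/((2 *: ((dot a x)%:P + dot b x *: 'X)).[s]) !hornerE/=.
    by rewrite dotDl dotZl; ring.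
  rewrite -(moment2 hmu transitive_SO) horner_poly.
  under eq_bigr do rewrite mulrAC (mulrCA _ 'C(N, k)%:R).
  under eq_bigr do rewrite -!mulrA.
  rewrite -mulr_sumr; congr (_ * _).
  transitivity (mean mu (fun y => \sum_(l < n.+1) ('C(n, l)%:R * s ^+ l) *
      (dot a y ^+ (n - l) * dot b y ^+ l * dot x y ^+ k))).
    rewrite mean_sum//; last by move=> l; exact: L1Z.
    by apply: eq_bigr => l _; rewrite meanZ// /J; ring.
  apply: eq_mean => y _; rewrite dotDl dotZl exprDn mulr_suml; apply: eq_bigr => l _.
  by rewrite exprMn -mulr_natl; ring.
(* From here on the formal variable s is specialised to i. *)
pose z : R[i] := dot a x +i* dot b x.
pose ev : {rmorphism {poly R} -> R[i]} :=
  horner_eval ('i : R[i]) \o map_poly (real_complex R).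
have evE p : ev p = (map_poly (real_complex R) p).['i] by [].
have evZX c l : ev (c *: 'X^l) = c%:C * 'i ^+ l.
  by rewrite evE map_polyZ map_polyXn hornerZ hornerXn.
have evC c : ev c%:P = c%:C by rewrite evE map_polyC hornerC.
have evZ c p : ev (c *: p) = c%:C * ev p.
  by rewrite !evE map_polyZ hornerZ.
have := congr1 (fun p => complex.Re (ev p)) PW.
have -> : complex.Re (ev P) = 'C(N, k)%:R * mean mu (fun y => RePow n (dot a y) (dot b y) * dot x y ^+ k).
  transitivity (\sum_(l < n.+1) ('C(N, k)%:R * ('C(n, l)%:R * Reik R l)) * J l).
    rewrite /P poly_def rmorph_sum Re_sum; apply: eq_bigr => l _.
    by rewrite evZX Re_realM -/(Reik R l); ring.
  under eq_bigr do rewrite -mulrA; rewrite -mulr_sumr; congr (_ * _).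
  under eq_bigr do rewrite /J -meanZ//; rewrite -mean_sum//; last by move=> l; exact: L1Z.
  apply: eq_mean => y _; rewrite RePowE mulr_suml; apply: eq_bigr => l _.
  by rewrite !mulrA.
have -> : complex.Re (ev (mom N *: (W ^+ N./2)`_k)) =
   'C(N, k)%:R * (fh_coef n k * dot x x ^+ (k - n)./2 * RePow n (dot a x) (dot b x)).
  rewrite evZ Re_realM.
  have -> : ev (W ^+ N./2)`_k = (map_poly ev W ^+ N./2)`_k by rewrite -rmorphXn/= coef_map.
  have -> : map_poly ev W = (2 * z)%:P * 'X + ((dot x x)%:C)%:P * 'X^2.
    rewrite map_quadratic evC -[RHS]add0r addrA; congr (_%:P + _%:P * _ + _).
      by rewrite rmorphD rmorph1 rmorphXn/= /horner_eval map_polyX hornerX sqr_i subrr.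
    transitivity ((2 : R)%:C * ((dot a x)%:C + (dot b x)%:C * 'i)).
      apply: (eq_trans (evZ _ _)); congr (_ * _).
      apply: (eq_trans (rmorphD ev _ _)); congr (_ + _); first exact: evC.
      exact: (evZX _ 1%N).
    by rewrite rmorph_nat; congr (_ * _); rewrite /z; simpc.
  have Cnz : 'C(N, k)%:R != 0 :> R by rewrite pnatr_eq0 -lt0n bin_gt0 leq_addl.
  rewrite coef_qX2zX /fh_coef -/N.
  have [oN|eN] := boolP (odd N); first by rewrite mom_odd// !mul0r mulr0.
  have NE : N = (N./2 + N./2)%N by rewrite addnn even_halfK.
  have -> : (k < n)%N = (k < N./2)%N.
    by apply/idP/idP => h; [|]; move: NE h; rewrite {1}/N; move: (N./2) => M; lia.
  case: ltnP => kM; first by rewrite /= !(mulr0, mul0r).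
  have -> : (N./2 - (k - N./2) = n)%N by move: NE kM; rewrite {1}/N; move: (N./2) => M; lia.
  have -> : (k - n)./2 = (k - N./2)%N by move: NE kM; rewrite {1}/N; move: (N./2) => M; lia.
  rewrite exprMn -!(rmorph_nat (real_complex R)) -!rmorphXn/= !Re_realM /RePow -/z.
  by field.
by apply: mulfI; rewrite pnatr_eq0 -lt0n bin_gt0; exact: leq_addl.
Qed.

End FunkHecke.

(** * Polynomials on the sphere and quadrature *)

Section SpherePoly.
Variables (R : realType) (m : nat).
Implicit Types (F G : 'cV[R]_m -> R).

(** Real-valued spherical polynomials; the degree is tracked because the
    quadratures are exact up to a given degree only. *)
Definition rsp (N : nat) F : Prop := spherical_poly N (fun x => (F x)%:C).

Lemma rsp_le N N' F : (N <= N')%N -> rsp N F -> rsp N' F.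
Proof.
by move=> NN' [p [sp ep]]; exists p; split => //; rewrite (leq_trans sp).
Qed.

Lemma rsp_cst N c : rsp N (fun=> c).
Proof.
exists (mpolyC m c%:C); split; last by move=> x _; rewrite mevalC.
by rewrite mpoly.msizeC; case: (_ != _).
Qed.

Lemma rsp_coord i : rsp 1 (fun x => x i 0).
Proof.
exists (mpolyX _ (mnm1 i)); split; last by move=> x _; rewrite mevalXU.
by rewrite msizeX mdeg1.
Qed.

Lemma rspD N F G : rsp N F -> rsp N G -> rsp N (fun x => F x + G x).
Proof.
move=> [p [sp ep]] [q [sq eq]]; exists (p + q); split.
  by rewrite (leq_trans (msizeD_le _ _))// geq_max sp sq.
by move=> x Sx; rewrite mevalD -ep// -eq// rmorphD.
Qed.

Lemma rspM N N' F G : rsp N F -> rsp N' G -> rsp (N + N') (fun x => F x * G x).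
Proof.
move=> [p [sp ep]] [q [sq eq]]; exists (p * q); split.
  have [->|p0] := eqVneq p 0; first by rewrite mul0r msize0.
  have [->|q0] := eqVneq q 0; first by rewrite mulr0 msize0.
  rewrite msizeM//; apply: (@leq_trans (N.+1 + N'.+1).-1); last by rewrite addSn addnS.
  by rewrite -!subn1 leq_sub2r// leq_add.
by move=> x Sx; rewrite mevalM -ep// -eq// rmorphM.
Qed.

Lemma rspZ N c F : rsp N F -> rsp N (fun x => c * F x).
Proof. exact: (@rspM 0 N (fun=> c) F (rsp_cst 0 c)). Qed.

Lemma rspX N F k : rsp N F -> rsp (N * k) (fun x => F x ^+ k).
Proof.
move=> hF; elim: k => [|k IH].
  by rewrite muln0; under eq_fun do rewrite expr0; exact: rsp_cst.
by rewrite mulnS; under eq_fun do rewrite exprS; exact: rspM.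
Qed.

Lemma rsp_sum (I : Type) (r : seq I) N (F : I -> 'cV[R]_m -> R) :
  (forall i, rsp N (F i)) -> rsp N (fun x => \sum_(i <- r) F i x).
Proof.
move=> hF; elim: r => [|i r IH].
  by under eq_fun do rewrite big_nil; exact: rsp_cst.
by under eq_fun do rewrite big_cons; exact: rspD.
Qed.

Lemma rsp_dot v : rsp 1 (dot v).
Proof. by apply: rsp_sum => i; apply: rspZ; exact: rsp_coord. Qed.

Lemma rsp_dotXM a b p q : rsp (p + q) (fun y => dot a y ^+ p * dot b y ^+ q).
Proof.
by apply: rspM; rewrite -[X in rsp X]mul1n; apply/rspX/rsp_dot.
Qed.

Lemma rsp_hdot v (p : {poly R}) : rsp (size p).-1 (fun y => p.[dot v y]).
Proof.
under eq_fun do rewrite horner_coef; apply: rsp_sum => i; apply: rspZ.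
apply: (@rsp_le i); first by case: (size p) i => [[]//|n i]; rewrite -ltnS.
by rewrite -[X in rsp X]mul1n; apply/rspX/rsp_dot.
Qed.

Variable mu : probability (borel_vec R m) R.

Lemma cintegral_real F : cintegral mu (fun x => (F x)%:C) = (mean mu F)%:C.
Proof.
rewrite /cintegral /=; congr (_ +i* _).
by rewrite Rintegral_cst ?mul0r//; exact: measurable_sphere.
Qed.

Lemma quadrature_mean N n (pt : 'I_n -> 'cV[R]_m) w F :
  quadrature mu N pt w -> rsp N F -> mean mu F = \sum_(r < n) w r * F (pt r).
Proof.
move=> hq hF; have := hq _ hF; rewrite cintegral_real.
under eq_bigr do rewrite -rmorphM/=; rewrite -rmorph_sum/=.
by case.
Qed.

Lemma quadrature_le N N' n (pt : 'I_n -> 'cV[R]_m) w :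
  (N <= N')%N -> quadrature mu N' pt w -> quadrature mu N pt w.
Proof.
move=> NN' hq f [p [sp ep]]; apply: hq; exists p; split => //.
by rewrite (leq_trans sp).
Qed.

End SpherePoly.

(** * Restriction to the equatorial hyperplane *)

Section Restriction.
Variables (R : realType) (n : nat).
Implicit Types (z : 'cV[R]_n.+1) (v : 'cV[R]_n) (h : 'M[R]_n.+1).
Let e := unit_vec R n.+1 (ord_max : 'I_n.+1).

Local Notation emb v := (@embed0 R n.+1 v).

Definition restr z : 'cV[R]_n := \col_(i < n) z (widen_ord (leqnSn n) i) 0.

Lemma dot_restr z z' : dot (restr z) (restr z') = dot z z' - z ord_max 0 * z' ord_max 0.
Proof.
by rewrite /dot big_ord_recr/= addrK; apply: eq_bigr => i _; rewrite !mxE.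
Qed.

Lemma embed0E v (i : 'I_n) : (emb v) (widen_ord (leqnSn n) i) 0 = v i 0.
Proof. by rewrite mxE /coordn /= valK. Qed.

Lemma embed0_max v : (emb v) ord_max 0 = 0.
Proof. by rewrite mxE /coordn /= insubF// ltnn. Qed.

Lemma dot_embed0 z v : dot z (emb v) = dot (restr z) v.
Proof.
rewrite /dot big_ord_recr/= embed0_max mulr0 addr0.
by apply: eq_bigr => i _; rewrite embed0E mxE.
Qed.

Lemma restr_embed0 v : restr (emb v) = v.
Proof. by apply/matrixP => i j; rewrite ord1 mxE embed0E. Qed.

Lemma dot_embed0_embed0 v v' : dot (emb v) (emb v') = dot v v'.
Proof. by rewrite dot_embed0 restr_embed0. Qed.

(** A rotation fixing the last basis vector is block diagonal; its upper left
    block shows that SO(d - 1) acts transitively on the smaller sphere. *)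
Definition restr_mx h : 'M[R]_n := row' ord_max (col' ord_max h).

Lemma restr_mxE h i j : restr_mx h i j = h (widen_ord (leqnSn n) i) (widen_ord (leqnSn n) j).
Proof. by rewrite !mxE; congr (h _ _); apply: val_inj; rewrite /= /bump leqNgt ltn_ord. Qed.

Lemma SOstab_col h : SOstab R n.+1 h -> forall i, h i ord_max = (i == ord_max)%:R.
Proof.
move=> [_ he] i; have := congr1 (fun v : 'cV[R]_n.+1 => v i 0) he.
rewrite !mxE (bigD1 ord_max)//= mxE eqxx mulr1 big1 ?addr0//.
by move=> j jm; rewrite mxE -(inj_eq val_inj) /= in jm *; rewrite (negPf jm) mulr0.
Qed.

Lemma SOstab_row h : SOstab R n.+1 h -> forall i, h ord_max i = (i == ord_max)%:R.
Proof.
move=> hs; have [[ho _] he] := hs.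
have : SOstab R n.+1 h^T.
  split; first exact: SO_trmx hs.1.
  by rewrite -{1}he mulmxA (mulmx1C ho) mul1mx.
by move/SOstab_col => H i; rewrite -H mxE.
Qed.

Lemma SO_restr_mx h : SOstab R n.+1 h -> SOgroup R n (restr_mx h).
Proof.
move=> hs; have [[ho hd] he] := hs; split.
  apply/matrixP => i j; rewrite mxE.
  have := congr1 (fun M : 'M[R]_n.+1 => M (widen_ord (leqnSn n) i) (widen_ord (leqnSn n) j)) ho.
  rewrite !mxE big_ord_recr/= (SOstab_col hs) -(inj_eq val_inj) /= ltn_eqF// mul0r addr0 => <-.
  by apply: eq_bigr => k _; rewrite [X in _ * X]mxE !restr_mxE mxE.
rewrite -hd (expand_det_row _ ord_max) (bigD1 ord_max)//= (SOstab_row hs) eqxx mul1r.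
rewrite big1 ?addr0 => [|j jm]; last by rewrite (SOstab_row hs) (negPf jm) mul0r.
by rewrite /cofactor -signr_odd addnn odd_double expr0 mul1r.
Qed.

Lemma restr_mx_mul h v w : SOstab R n.+1 h -> h *m emb v = emb w -> restr_mx h *m v = w.
Proof.
move=> hs hv; apply/matrixP => i j; rewrite ord1.
have := congr1 (fun u : 'cV[R]_n.+1 => u (widen_ord (leqnSn n) i) 0) hv.
rewrite embed0E => <-; rewrite !mxE big_ord_recr/= embed0_max mulr0 addr0.
by apply: eq_bigr => k _; rewrite embed0E restr_mxE.
Qed.

End Restriction.

Lemma embed0_unit_vec (R : realType) n :
  @embed0 R n.+2 (unit_vec R n.+1 n) = unit_vec R n.+2 n :> 'cV[R]_n.+2.
Proof.
apply/matrixP => i j; rewrite ord1 !mxE /coordn.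
case: insubP => [k _ ik|]; first by rewrite mxE ik.
by rewrite -leqNgt => ni; rewrite gtn_eqF.
Qed.

(** * Gegenbauer polynomials *)

Section Gegenbauer.
Variables (R : realType) (e : nat).
Variables (mu : probability (borel_vec R e.+3) R) (nu : probability (borel_vec R e.+2) R).
Hypotheses (hmu : rotation_invariant mu) (hnu : rotation_invariant nu).
Let i0 : 'I_e.+3 := ord_max.
Let i1 : 'I_e.+2 := ord_max.
Variable g : 'cV[R]_e.+3 -> 'M[R]_e.+3.
Hypothesis hg : forall u, dot u u = 1 ->
  SOgroup R e.+3 (g u) /\ g u *m unit_vec R e.+3 i0 = u.
Hypothesis Tnu : forall v : 'cV[R]_e.+2, dot v v = 1 ->
  exists2 h, SOgroup R e.+2 h & h *m unit_vec R e.+2 i1 = v.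
Hypothesis Hnu : forall N, exists s (pt : 'I_s -> 'cV[R]_e.+2) w,
  (forall r, dot (pt r) (pt r) = 1) /\ quadrature nu N pt w.
Let mu1 : mu (sphere R e.+3) = 1%E := hmu.1.
Implicit Types (x y u : 'cV[R]_e.+3) (v : 'cV[R]_e.+2).
Local Notation emb v := (@embed0 R e.+3 v).
Let Tmu u : dot u u = 1 -> exists2 h, SOgroup R e.+3 h & h *m unit_vec R e.+3 i0 = u.
Proof. by move=> /hg[]; exists (g u). Qed.

Notation mom' := (mom nu i1).
Notation fh := (fh_coef mu i0).

Definition geg_coef n k : R := 'C(n, k)%:R * Reik R k * mom' k.

(** The Gegenbauer polynomial of degree n and parameter (d - 2) / 2, normalised
    by the value 1 at 1. It is Laplace's integral, the average of (t + i sqrt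
    (1 - t^2) v)^n over the equatorial sphere, where v is a coordinate,
    expanded by the moments of the measure nu. *)
Definition geg n : {poly R} :=
  \sum_(k < n.+1) geg_coef n k *: ('X^(n - k) * (1 - 'X^2) ^+ k./2).

(** The image of the equatorial direction v under the rotation that moves the
    pole to u; together with u it spans the plane of a wave. *)
Definition zeta u v : 'cV[R]_e.+3 := g u *m emb v.

(** The coordinates of x in the hyperplane orthogonal to u. *)
Definition tang u x : 'cV[R]_e.+2 := restr ((g u)^T *m x).

Lemma dot_zeta u v x : dot (zeta u v) x = dot (tang u x) v.
Proof. by rewrite /zeta dot_mulmx dotC dot_embed0. Qed.

Lemma dot_tang u x y : dot u u = 1 ->
  dot (tang u x) (tang u y) = dot x y - dot u x * dot u y.
Proof.
move=> /hg[hgu gue]; have [ho _] := hgu.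
have c z : ((g u)^T *m z) ord_max 0 = dot u z.
  by rewrite -dot_unit_vec dotC -[in RHS]gue dot_mulmx.
rewrite dot_restr !c orthogonal_dot// trmxK; exact: mulmx1C.
Qed.

Lemma zeta_unit u v : dot u u = 1 -> dot (zeta u v) (zeta u v) = dot v v.
Proof. by move=> /hg[[ho _] _]; rewrite /zeta orthogonal_dot// dot_embed0_embed0. Qed.

Lemma zeta_orth u v : dot u u = 1 -> dot u (zeta u v) = 0.
Proof.
move=> /hg[[ho _] gue]; rewrite -{1}gue /zeta orthogonal_dot// dotC dot_unit_vec.
by rewrite embed0_max.
Qed.

Lemma quadrature_mom N s (pt : 'I_s -> 'cV[R]_e.+2) w v k :
  quadrature nu N pt w -> (k <= N)%N ->
  \sum_(r < s) w r * dot v (pt r) ^+ k = mom' k * dot v v ^+ k./2.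
Proof.
move=> hq kN; rewrite -(moment1 hnu Tnu); apply/esym.
apply: (quadrature_mean (quadrature_le kN hq)).
by rewrite -[X in rsp X]mul1n; apply/rspX/rsp_dot.
Qed.

(** Laplace's formula with the integral over the equator replaced by a
    quadrature: Gegenbauer kernels are finite averages of waves, from which
    they inherit the Funk-Hecke formula. *)
Lemma geg_laplace N s (pt : 'I_s -> 'cV[R]_e.+2) w n u x :
  quadrature nu N pt w -> (n <= N)%N -> dot u u = 1 -> dot x x = 1 ->
  \sum_(r < s) w r * RePow n (dot u x) (dot (zeta u (pt r)) x) = (geg n).[dot u x].
Proof.
move=> hq nN u1 x1.
under eq_bigr do rewrite RePowE mulr_sumr.
rewrite exchange_big/= /geg horner_sum; apply: eq_bigr => k _.
rewrite hornerZ !hornerE/= -[1 - _ ](_ : dot (tang u x) (tang u x) = _); last first.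
  by rewrite dot_tang// x1.
rewrite /geg_coef -!mulrA (mulrCA _ (_ ^+ (n - k))).
rewrite -(quadrature_mom _ hq); last by rewrite (leq_trans _ nN)// -ltnS.
rewrite !mulr_sumr; apply: eq_bigr => r _.
by rewrite dot_zeta; ring.
Qed.

Lemma mean_geg_monomial n k u x : dot u u = 1 -> dot x x = 1 ->
  mean mu (fun y => (geg n).[dot u y] * dot x y ^+ k) = fh n k * (geg n).[dot u x].
Proof.
move=> u1 x1; have [s [pt [w [p1 hq]]]] := Hnu n.
have bd r : L1s mu (fun y => RePow n (dot u y) (dot (zeta u (pt r)) y) * dot x y ^+ k).
  by apply/(bmf_L1 mu1)/bmfM; [exact: bmf_RePow|exact/bmfX/bmf_dot].
transitivity (mean mu (fun y => \sum_(r < s) w r *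
    (RePow n (dot u y) (dot (zeta u (pt r)) y) * dot x y ^+ k))).
  apply: eq_mean => y /sphereE y1; rewrite -(geg_laplace hq (leqnn n) u1 y1) mulr_suml.
  by apply: eq_bigr => r _; rewrite mulrA.
rewrite mean_sum//; last by move=> r; exact: L1Z.
rewrite -(geg_laplace hq (leqnn n) u1 x1) mulr_sumr; apply: eq_bigr => r _.
rewrite meanZ// (funk_hecke_monomial hmu Tmu)//.
- by rewrite x1 expr1n mulr1 mulrCA.
- by rewrite zeta_unit.
- exact: zeta_orth.
Qed.

(** The scalar by which averaging against p(<x, y>) acts on degree n. *)
Definition geg_eigen n (p : {poly R}) : R := \sum_(k < size p) p`_k * fh n k.

Lemma mean_geg n p u x : dot u u = 1 -> dot x x = 1 ->
  mean mu (fun y => (geg n).[dot u y] * p.[dot x y]) =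
  geg_eigen n p * (geg n).[dot u x].
Proof.
move=> u1 x1; rewrite /geg_eigen mulr_suml.
under eq_bigr do rewrite -mulrA -(mean_geg_monomial _ _ u1 x1).
have bd k : L1s mu (fun y => (geg n).[dot u y] * dot x y ^+ k).
  by apply/(bmf_L1 mu1)/bmfM; [exact: bmf_hdot|exact/bmfX/bmf_dot].
under eq_bigr do rewrite -meanZ//.
rewrite -mean_sum//; last by move=> k; exact: L1Z.
apply: eq_mean => y _; rewrite (horner_coef p) mulr_sumr.
by apply: eq_bigr => k _; rewrite mulrCA.
Qed.

Lemma size_1X2_exp j : (size ((1 - 'X^2 : {poly R}) ^+ j)%R <= j.*2.+1)%N.
Proof.
apply: (leq_trans (size_poly_exp_leq _ _)); rewrite ltnS -mul2n leq_mul2r.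
apply/orP; right; rewrite -subn1 leq_subLR.
by rewrite (leq_trans (size_polyD _ _))// geq_max size_polyN size_polyXn size_poly1.
Qed.

Lemma size_geg n : (size (geg n) <= n.+1)%N.
Proof.
apply: (leq_trans (size_sum _ _ _)); apply/bigmax_leqP => k _.
apply: (leq_trans (size_scale_leq _ _)); apply: (leq_trans (size_polyMleq _ _)).
rewrite size_polyXn addSn /=.
apply: (leq_trans (leq_add (leqnn _) (size_1X2_exp k./2))); rewrite addnS ltnS.
have hk : (k./2.*2 <= k)%N by rewrite -[leqRHS]odd_double_half leq_addl.
by rewrite (leq_trans (leq_add (leqnn _) hk))// subnK// -ltnS.
Qed.

Lemma geg1 n : (geg n).[1] = 1.
Proof.
rewrite /geg horner_sum big_ord_recl big1 ?addr0 => [|k _].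
  rewrite hornerZ /geg_coef bin0 /= /Reik expr0/= (mom0 hnu) !mul1r subn0.
  by rewrite !hornerE/= expr1n.
rewrite hornerZ hornerM !horner_exp hornerD hornerN -polyC1 hornerC hornerXn !expr1n subrr.
rewrite expr0n lift0.
have [ok|ek] := boolP (odd k.+1); first by rewrite /geg_coef Reik_odd// mulr0 !mul0r.
by case: (nat_of_ord k) ek => [//|k' _]; rewrite /= mulr0n !mulr0.
Qed.

(** The signs of Re (i^k) and of the top coefficient of (1 - X^2)^(k/2) cancel,
    and the binomial sum of the moments remains. *)
Lemma coef_geg n : (geg n)`_n = binmom nu i1 n.
Proof.
rewrite (binmomE hnu) /geg coef_sum; apply: eq_bigr => k _.
rewrite coefZ /geg_coef; have [ok|ek] := boolP (odd k).
  by rewrite Reik_odd// (mom_odd hnu Tnu)// !mulr0 mul0r.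
have kn : (k <= n)%N by rewrite -ltnS.
rewrite mulrC -['X^ _ * _]mulrC coefMXn.
rewrite ltnNge leq_subr/= subKn//.
have hc : ((1 - 'X^2 : {poly R}) ^+ k./2)`_k = (-1) ^+ k./2.
  rewrite -{2}(even_halfK ek); elim: (k./2) => [|j IH]; first by rewrite !expr0 coef1.
  rewrite exprSr mulrBr mulr1 coefB coefMXn (_ : (j.+1.*2 < 2)%N = false); last by lia.
  rewrite (_ : (j.+1.*2 - 2)%N = j.*2) ?IH; last by lia.
  rewrite nth_default; first by rewrite sub0r exprS mulN1r.
  by apply: (leq_trans (size_1X2_exp j)); rewrite doubleS.
have hr : Reik R k = (-1) ^+ k./2 by rewrite -{1}(even_halfK ek) Reik_even.
have s2 : (-1) ^+ k./2 * (-1) ^+ k./2 = 1 :> R by rewrite -exprMn mulrNN mulr1 expr1n.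
by rewrite hc hr mulrA (mulrCA _ 'C(n, k)%:R) s2 mulr1.
Qed.

Lemma fh_lt n k : (k < n)%N -> fh n k = 0.
Proof. by move=> kn; rewrite /fh_coef kn mulr0. Qed.

Lemma geg_eigen_lt n (p : {poly R}) : (size p <= n)%N -> geg_eigen n p = 0.
Proof.
by move=> sp; apply: big1 => k _; rewrite fh_lt ?mulr0// (leq_trans (ltn_ord k)).
Qed.

Lemma geg_eigen_geg n : geg_eigen n (geg n) = binmom nu i1 n * fh n n.
Proof.
have widen N : (size (geg n) <= N)%N ->
    geg_eigen n (geg n) = \sum_(k < N) (geg n)`_k * fh n k.
  move=> sN; rewrite /geg_eigen (big_ord_widen N (fun k => (geg n)`_k * fh n k))//.
  rewrite big_mkcond; apply: eq_bigr => k _; case: ltnP => // h.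
  by rewrite nth_default// mul0r.
rewrite (widen _ (size_geg n)) big_ord_recr/= big1 ?add0r ?coef_geg// => k _.
by rewrite fh_lt ?mulr0.
Qed.

(** By symmetry the two polynomials may be exchanged, so that the one of larger
    degree is always the one that annihilates the other. *)
Lemma geg_eigenE n m u x : dot u u = 1 -> dot x x = 1 ->
  mean mu (fun y => (geg n).[dot u y] * (geg m).[dot x y]) =
  (if n == m then geg_eigen n (geg n) else 0) * (geg n).[dot u x].
Proof.
move=> u1 x1; case: (ltngtP n m) => [nm|mn|->]; last by rewrite mean_geg.
  under eq_mean do rewrite mulrC.
  by rewrite mean_geg// geg_eigen_lt ?mul0r// (leq_trans (size_geg _)).
by rewrite mean_geg// geg_eigen_lt// (leq_trans (size_geg _)).
Qed.

Lemma central_bin_rec n : (n.+1 * 'C(n.+1.*2, n.+1) = 2 * n.*2.+1 * 'C(n.*2, n))%N.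
Proof.
have h1 := mul_bin_diag n.+1.*2 n; have h2 := mul_bin_diag n.*2.+1 n.
rewrite /= in h1 h2.
have h3 : 'C(n.*2.+1, n.+1) = 'C(n.*2.+1, n).
  by rewrite -bin_sub; [congr 'C(_, _); lia|lia].
apply/eqP; rewrite -(eqn_pmul2l (ltn0Sn n)); apply/eqP.
rewrite doubleS /= in h1 *; rewrite -h1 -h3.
transitivity (2 * n.+1 * (n.+1 * 'C(n.*2.+1, n.+1)))%N; last by rewrite -h2; lia.
rewrite -doubleS -mul2n; lia.
Qed.

Lemma dimHE n : @dimH R e.+3 n =
  ((2 * n + e.+1) * (n + e)`!)%:R / ((e.+1)`! * n`!)%:R.
Proof. by rewrite /dimH !addnS !subSS !subn0. Qed.

Lemma dimH_gt0 n : 0 < @dimH R e.+3 n.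
Proof. by rewrite dimHE divr_gt0// ltr0n muln_gt0 ?fact_gt0//= addnS. Qed.

(** Both sides satisfy the same first-order recursion in n: the left side is a
    product of a binomial moment, a moment of a coordinate, an inverse central
    binomial coefficient and a power of 2. *)
Lemma geg_eigen_dimH n : geg_eigen n (geg n) = (@dimH R e.+3 n)^-1.
Proof.
apply/eqP; rewrite -(mulrK (_ : @dimH R e.+3 n \is a GRing.unit) (geg_eigen n (geg n))); last first.
  by rewrite unitfE gt_eqF// dimH_gt0.
rewrite -[eqbRHS]mul1r; apply/eqP; congr (_ / _).
rewrite geg_eigen_geg dimHE /fh_coef ltnn addnn half_double subnn bin0 mul1r.
elim: n => [|n IH].
  rewrite /binmom expr0 -(expr0 'X) (LpXn _ _ 0) (mom0 hnu) (mom0 hmu) bin0 muln0 !add0n.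
  rewrite -factS fact0 muln1 divff ?pnatr_eq0 -?lt0n ?fact_gt0//.
  by rewrite expr0 !mul1r divff// pnatr_eq0 -lt0n fact_gt0.
have h1 := binmom_rec hnu Tnu n; rewrite /= in h1.
have h2 := mom_rec hmu Tmu n.
have h3 := congr1 (fun k => k%:R : R) (central_bin_rec n).
rewrite /= !natrM in h3.
have nz k : k.+1%:R != 0 :> R by rewrite pnatr_eq0.
have nf k : k`!%:R != 0 :> R by rewrite pnatr_eq0 -lt0n fact_gt0.
have Cn : 'C(n.*2, n)%:R != 0 :> R by rewrite pnatr_eq0 -lt0n bin_gt0 -addnn leq_addr.
have hB : binmom nu i1 n.+1 = (2 * n + e.+1)%:R * binmom nu i1 n / (n + e).+1%:R.
  by rewrite -h1 addnS mulrAC divff ?mul1r.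
have hM : mom mu i0 n.+1.*2 = n.*2.+1%:R * mom mu i0 n.*2 / (2 * n + e).+3%:R.
  by rewrite doubleS -h2 !addnS mulrAC divff ?mul1r.
have hC : 'C(n.+1.*2, n.+1)%:R = 2 * n.*2.+1%:R * 'C(n.*2, n)%:R / n.+1%:R :> R.
  by rewrite -h3 mulrAC divff ?mul1r.
have nE := nf e.+1; move: nE IH; move: ((e.+1)`!) => E nE IH.
rewrite hB hM hC addSn (factS (n + e)) (factS n) !natrM -[RHS]IH exprS !natrM.
have -> : (2 * n.+1 + e.+1)%N = (2 * n + e).+3 by lia.
have alg (x B y z M t C s p F E' N : R) : y != 0 -> z != 0 -> t != 0 -> C != 0 ->
    s != 0 -> E' != 0 -> N != 0 ->
    x * B / y * (z * M / t / (2 * z * C / s) * (2 * p)) * (t * (y * F) / (E' * (s * N))) =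
    B * (M / C * p) * (x * F / (E' * N)).
  by move=> *; field; do ?[apply/andP; split].
exact: alg.
Qed.

Lemma geg_conv n m u x : dot u u = 1 -> dot x x = 1 ->
  mean mu (fun y => (geg n).[dot u y] * (geg m).[dot x y]) =
  (if n == m then (@dimH R e.+3 n)^-1 else 0) * (geg n).[dot u x].
Proof. by move=> u1 x1; rewrite geg_eigenE// geg_eigen_dimH. Qed.

End Gegenbauer.

(** * The kernel of the rotated waves *)

Section ZonalForms.
Variable R : realType.
Implicit Types F G : R -> R -> R -> R.

(** Functions of p = <x, u>, q = <y, u> and t = <x, y> that are polynomial and
    have degree at most D in p and q together. This degree is the degree in u,
    which decides whether the quadrature over u is exact; t is a constant
    there. *)
Definition zon (D : nat) F : Prop := exists s : seq (nat * nat * {poly R}),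
  all (fun u => u.1.1 + u.1.2 <= D)%N s /\
  forall p q t, F p q t = \sum_(u <- s) p ^+ u.1.1 * q ^+ u.1.2 * u.2.[t].

Lemma eq_zon D F G : (forall p q t, F p q t = G p q t) -> zon D F -> zon D G.
Proof. by move=> FG [s [hs eF]]; exists s; split => // p q t; rewrite -FG. Qed.

Lemma zon_le D D' F : (D <= D')%N -> zon D F -> zon D' F.
Proof.
move=> DD' [s [hs eF]]; exists s; split => //.
by apply: sub_all hs => u hu; exact: leq_trans hu DD'.
Qed.

Lemma zon_mono e f (c : {poly R}) : zon (e + f) (fun p q t => p ^+ e * q ^+ f * c.[t]).
Proof. by exists [:: (e, f, c)]; split => [/=|p q t]; rewrite ?leqnn// big_seq1. Qed.

Lemma zon_poly D (c : {poly R}) : zon D (fun _ _ t => c.[t]).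
Proof.
apply: (zon_le (leq0n D)); apply: eq_zon (zon_mono 0 0 c) => p q t.
by rewrite !expr0 !mul1r.
Qed.

Lemma zon_cst D (c : R) : zon D (fun _ _ _ => c).
Proof. by apply: eq_zon (zon_poly D c%:P) => p q t; rewrite hornerC. Qed.

Lemma zonD D F G : zon D F -> zon D G -> zon D (fun p q t => F p q t + G p q t).
Proof.
move=> [s [hs eF]] [s' [hs' eG]]; exists (s ++ s'); split; first by rewrite all_cat hs hs'.
by move=> p q t; rewrite big_cat eF eG.
Qed.

Lemma zonM D D' F G : zon D F -> zon D' G -> zon (D + D') (fun p q t => F p q t * G p q t).
Proof.
move=> [s [hs eF]] [s' [hs' eG]].
exists [seq ((u.1.1 + v.1.1, u.1.2 + v.1.2)%N, u.2 * v.2) | u <- s, v <- s']; split.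
  apply/allP => _ /allpairsP[[u v] /= [us vs ->]] /=.
  by rewrite addnACA leq_add// ?(allP hs)// (allP hs').
move=> p q t; rewrite eF eG big_allpairs_dep/= mulr_suml; apply: eq_bigr => u _.
by rewrite mulr_sumr; apply: eq_bigr => v _; rewrite !exprD hornerM; ring.
Qed.

Lemma zonZ D c F : zon D F -> zon D (fun p q t => c * F p q t).
Proof. by move=> hF; have := zonM (zon_cst 0 c) hF. Qed.

Lemma zon_sum D (I : Type) (r : seq I) (F : I -> R -> R -> R -> R) :
  (forall i, zon D (F i)) -> zon D (fun p q t => \sum_(i <- r) F i p q t).
Proof.
move=> hF; elim: r => [|i r IH].
  by apply: eq_zon (zon_cst D 0) => p q t; rewrite big_nil.
by apply: eq_zon (zonD (hF i) IH) => p q t; rewrite big_cons.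
Qed.

Lemma coef_quadraticM (a b c : R) (P : {poly R}) i :
  ((a%:P + b%:P * 'X + c%:P * 'X^2) * P)`_i =
  a * P`_i + (if (i < 1)%N then 0 else b * P`_(i - 1)) +
  (if (i < 2)%N then 0 else c * P`_(i - 2)).
Proof.
rewrite !mulrDl !coefD -[b%:P * 'X * P]mulrA -[c%:P * 'X^2 * P]mulrA !coefCM coefXM coefXnM.
congr (_ + _ + _).
  by case: i => [|i]; rewrite ?mulr0//= subn1.
by case: ifP; rewrite ?mulr0.
Qed.

(** The coefficients are those of powers of the Gram form of the tangential
    parts of x and y at u. The parameter t counts for nothing in the degree, so
    that M factors contribute 2 M only. *)
Lemma zon_coef M l : zon (M.*2) (fun p q t =>
  (((1 - p ^+ 2)%:P + (2 * (t - p * q))%:P * 'X + (1 - q ^+ 2)%:P * 'X^2) ^+ M)`_l).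
Proof.
elim: M l => [|M IH] l.
  by apply: eq_zon (zon_cst _ (l == 0)%:R) => p q t; rewrite expr0 coef1.
have h0 k : zon M.*2.+2 (fun p q t => (1 - p ^+ 2) *
    (((1 - p ^+ 2)%:P + (2 * (t - p * q))%:P * 'X + (1 - q ^+ 2)%:P * 'X^2) ^+ M)`_k).
  rewrite -add2n; apply: zonM => //.
  apply: eq_zon (zonD (zon_cst 2 1) (zonZ (-1) (zon_mono 2 0 1))) => p q t.
  by rewrite hornerC; ring.
have h1 k : zon M.*2.+2 (fun p q t => (2 * (t - p * q)) *
    (((1 - p ^+ 2)%:P + (2 * (t - p * q))%:P * 'X + (1 - q ^+ 2)%:P * 'X^2) ^+ M)`_k).
  rewrite -add2n; apply: zonM => //; apply: zonZ.
  apply: eq_zon (zonD (zon_poly 2 'X) (zonZ (-1) (zon_mono 1 1 1))) => p q t.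
  by rewrite hornerC hornerX; ring.
have h2 k : zon M.*2.+2 (fun p q t => (1 - q ^+ 2) *
    (((1 - p ^+ 2)%:P + (2 * (t - p * q))%:P * 'X + (1 - q ^+ 2)%:P * 'X^2) ^+ M)`_k).
  rewrite -add2n; apply: zonM => //.
  apply: eq_zon (zonD (zon_cst 2 1) (zonZ (-1) (zon_mono 0 2 1))) => p q t.
  by rewrite hornerC; ring.
have z0 : zon M.*2.+2 (fun _ _ _ => 0) by exact: zon_cst.
pose sh (k j : nat) (F : nat -> R -> R -> R -> R) :=
  if (k < j)%N then (fun _ _ _ => 0) else F (k - j)%N.
have hsh k j (F : nat -> R -> R -> R -> R) : (forall i, zon M.*2.+2 (F i)) -> zon M.*2.+2 (sh k j F).
  by move=> hF; rewrite /sh; case: ifP.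
rewrite doubleS; apply: eq_zon (zonD (zonD (h0 l) (hsh l 1 _ h1)) (hsh l 2 _ h2)) => p q t.
rewrite [_ ^+ M.+1]exprS coef_quadraticM /sh; congr (_ + _ + _); by case: ifP.
Qed.

End ZonalForms.

Section ZonalKernel.
Variables (R : realType) (e : nat).
Variables (mu : probability (borel_vec R e.+3) R) (nu : probability (borel_vec R e.+2) R).
Hypotheses (hmu : rotation_invariant mu) (hnu : rotation_invariant nu).
Let i0 : 'I_e.+3 := ord_max.
Let i1 : 'I_e.+2 := ord_max.
Variable g : 'cV[R]_e.+3 -> 'M[R]_e.+3.
Hypothesis hg : forall u, dot u u = 1 ->
  SOgroup R e.+3 (g u) /\ g u *m unit_vec R e.+3 i0 = u.
Hypothesis Tnu : forall v : 'cV[R]_e.+2, dot v v = 1 ->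
  exists2 h, SOgroup R e.+2 h & h *m unit_vec R e.+2 i1 = v.
Hypothesis Hnu : forall N, exists s (pt : 'I_s -> 'cV[R]_e.+2) w,
  (forall r, dot (pt r) (pt r) = 1) /\ quadrature nu N pt w.
Let mu1 : mu (sphere R e.+3) = 1%E := hmu.1.
Let nu1 : nu (sphere R e.+2) = 1%E := hnu.1.
Implicit Types (x y u : 'cV[R]_e.+3) (v : 'cV[R]_e.+2).
Let Tmu u : dot u u = 1 -> exists2 h, SOgroup R e.+3 h & h *m unit_vec R e.+3 i0 = u.
Proof. by move=> /hg[]; exists (g u). Qed.
Notation geg := (geg nu).
Notation conv := (geg_conv hmu hnu hg Tnu Hnu).

(** The mean over u of such a function depends on <x, y> alone, by polarised
    moments. *)
Lemma zon_mean D F : zon D F -> exists k : {poly R}, forall x y, dot x x = 1 -> dot y y = 1 ->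
  mean mu (fun u => F (dot x u) (dot y u) (dot x y)) = k.[dot x y].
Proof.
move=> [s [_ eF]].
pose W : {poly {poly R}} := 1%:P + (2 *: 'X)%:P * 'X + 1%:P * 'X^2.
pose K (a b : nat) : {poly R} := (mom mu i0 (a + b) / 'C(a + b, b)%:R) *: (W ^+ (a + b)./2)`_b.
have hK a b x y : dot x x = 1 -> dot y y = 1 ->
    mean mu (fun u => dot x u ^+ a * dot y u ^+ b) = (K a b).[dot x y].
  move=> x1 y1; rewrite /K hornerZ.
  have -> : ((W ^+ (a + b)./2)`_b).[dot x y] = ((map_poly (horner_eval (dot x y)) W) ^+ (a + b)./2)`_b.
    by rewrite -rmorphXn/= coef_map.
  have -> : map_poly (horner_eval (dot x y)) W = (dot x x)%:P + (2 * dot x y)%:P * 'X + (dot y y)%:P * 'X^2.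
    rewrite map_quadratic x1 y1; congr (_%:P + _%:P * _ + _%:P * _).
    - by rewrite -[LHS]/((1 : {poly R}).[dot x y]) hornerC.
    - by rewrite -[LHS]/((2 *: 'X).[dot x y]) hornerZ hornerX.
    - by rewrite -[LHS]/((1 : {poly R}).[dot x y]) hornerC.
  rewrite mulrAC -(moment2 hmu Tmu) mulrAC divff ?mul1r//.
  by rewrite pnatr_eq0 -lt0n bin_gt0 leq_addl.
exists (\sum_(u <- s) K u.1.1 u.1.2 * u.2) => x y x1 y1.
under eq_mean do rewrite eF.
have bd a b : L1s mu (fun u => dot x u ^+ a * dot y u ^+ b).
  by apply/(bmf_L1 mu1)/bmfM; apply/bmfX/bmf_dot.
rewrite mean_sum//; last first.
  by move=> v; apply/(bmf_L1 mu1)/bmfM; [apply/bmfM; apply/bmfX/bmf_dot|exact: bmf_cst].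
rewrite horner_sum; apply: eq_bigr => v _; rewrite hornerM -hK// mulrC -meanZ//.
by apply: eq_mean => u _; rewrite mulrC.
Qed.

Lemma zon_rsp D F x y : zon D F -> rsp D (fun u => F (dot x u) (dot y u) (dot x y)).
Proof.
move=> [s [hs eF]].
have -> : (fun u => F (dot x u) (dot y u) (dot x y)) =
    (fun u => \sum_(v <- s) v.2.[dot x y] * (dot x u ^+ v.1.1 * dot y u ^+ v.1.2)).
  by apply/funext => u; rewrite eF; apply: eq_bigr => v _; rewrite mulrC.
elim: s hs {eF} => [|v s IH] /=.
  by move=> _; under eq_fun do rewrite big_nil; exact: rsp_cst.
move=> /andP[hv /IH{}IH]; under eq_fun do rewrite big_cons; apply: rspD => //.
by apply: rspZ; apply: rsp_le hv _; exact: rsp_dotXM.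
Qed.

Variables (D rn sn : nat) (eta : 'I_rn -> 'cV[R]_e.+3) (w : 'I_rn -> R).
Variables (eta' : 'I_sn -> 'cV[R]_e.+2) (w' : 'I_sn -> R).
Hypothesis eta1 : forall r, dot (eta r) (eta r) = 1.
Hypothesis eta'1 : forall s, dot (eta' s) (eta' s) = 1.
Hypothesis hq : quadrature mu D eta w.
Hypothesis hq' : quadrature nu D eta' w'.

Definition frame_wave n r s x : R := RePow n (dot (eta r) x) (dot (zeta g (eta r) (eta' s)) x).
Local Notation U := frame_wave.

(** The part of the kernel of the frame operator that couples the degrees n and
    m. *)
Definition wave_kernel n m x y : R :=
  \sum_(r < rn) \sum_(s < sn) (w r * w' s) * (U n r s x * U m r s y).
Local Notation K := wave_kernel.

(** The inner quadrature is exact for the products of the tangential forms, and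
    turns them into moments over the equatorial sphere. *)
Lemma zon_inner n m : (n + m <= D)%N -> exists2 F, zon (n + m) F &
  forall r x y, dot x x = 1 -> dot y y = 1 ->
   \sum_(s < sn) w' s * (U n r s x * U m r s y) = F (dot (eta r) x) (dot (eta r) y) (dot x y).
Proof.
move=> nmD.
pose Q (k l : nat) (p q t : R) := (((1 - p ^+ 2)%:P + (2 * (t - p * q))%:P * 'X +
  (1 - q ^+ 2)%:P * 'X^2) ^+ (k + l)./2)`_l.
pose c k l : R := ('C(n, k)%:R * Reik R k) * ('C(m, l)%:R * Reik R l) *
  (mom nu i1 (k + l) / 'C(k + l, l)%:R).
exists (fun p q t => \sum_(k < n.+1) \sum_(l < m.+1)
   c k l * ((p ^+ (n - k) * q ^+ (m - l)) * Q k l p q t)).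
  apply: zon_sum => k; apply: zon_sum => l.
  have kn : (k <= n)%N by rewrite -ltnS.
  have lm : (l <= m)%N by rewrite -ltnS.
  have [okl|ekl] := boolP (odd (k + l)).
    apply: eq_zon (zon_cst _ 0) => p q t.
    by rewrite /c (mom_odd hnu Tnu)// mul0r mulr0 mul0r.
  apply: zonZ; apply: (@zon_le _ (((n - k) + (m - l)) + (k + l)./2.*2)).
    by rewrite even_halfK//; lia.
  apply: zonM; last exact: zon_coef.
  by apply: eq_zon (zon_mono (n - k) (m - l) 1) => p q t; rewrite hornerC mulr1.
move=> r x y x1 y1; set u := eta r; have u1 : dot u u = 1 by exact: eta1.
have hQ k l : (k <= n)%N -> (l <= m)%N ->
  \sum_(s < sn) w' s * (dot (tang g u x) (eta' s) ^+ k * dot (tang g u y) (eta' s) ^+ l) =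
  mom nu i1 (k + l) / 'C(k + l, l)%:R * Q k l (dot u x) (dot u y) (dot x y).
  move=> kn lm.
  rewrite -(quadrature_mean hq' (F := fun v => dot (tang g u x) v ^+ k * dot (tang g u y) v ^+ l)).
    apply: (mulfI (_ : 'C(k + l, l)%:R != 0)).
      by rewrite pnatr_eq0 -lt0n bin_gt0 leq_addl.
    rewrite (moment2 hnu Tnu) !(dot_tang hg)// x1 y1 -!expr2.
    rewrite /Q; field.
    by rewrite pnatr_eq0 -lt0n bin_gt0 leq_addl.
  apply: rsp_le (rsp_dotXM _ _ k l); lia.
transitivity (\sum_(s < sn) \sum_(k < n.+1) \sum_(l < m.+1)
   ('C(n, k)%:R * Reik R k) * ('C(m, l)%:R * Reik R l) * (dot u x ^+ (n - k) * dot u y ^+ (m - l)) *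
   (w' s * (dot (tang g u x) (eta' s) ^+ k * dot (tang g u y) (eta' s) ^+ l))).
  apply: eq_bigr => s _; rewrite /U !RePowE big_distrlr/= mulr_sumr.
  apply: eq_bigr => k _; rewrite mulr_sumr; apply: eq_bigr => l _.
  by rewrite !dot_zeta -/u; ring.
rewrite exchange_big/=; apply: eq_bigr => k _; rewrite exchange_big/=; apply: eq_bigr => l _.
rewrite -mulr_sumr hQ; [|by rewrite -ltnS|by rewrite -ltnS]; rewrite /c.
move: (Q _ _ _ _ _) (dot u x ^+ _) (dot u y ^+ _) (mom _ _ _ / _) => q0 a b q1; ring.
Qed.

(** After the inner sum, the outer summand is a polynomial of degree at most n
    + m in the point eta r, and the outer quadrature is exact as well. *)
Lemma wave_kernel_zonal n m : (n + m <= D)%N -> exists k : {poly R},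
  forall x y, dot x x = 1 -> dot y y = 1 -> K n m x y = k.[dot x y].
Proof.
move=> nmD; have [F zF hF] := zon_inner nmD.
have [k hk] := zon_mean zF; exists k => x y x1 y1; rewrite -hk//.
rewrite (quadrature_mean hq (F := fun u => F (dot x u) (dot y u) (dot x y))); last first.
  exact: rsp_le nmD (zon_rsp _ _ zF).
apply: eq_bigr => r _; under eq_bigr do rewrite -mulrA.
by rewrite -mulr_sumr hF// (dotC x (eta r)) (dotC y (eta r)).
Qed.

Lemma mean_wave_geg n l r s x : dot x x = 1 ->
  mean mu (fun y => U n r s y * (geg l).[dot x y]) =
  (if n == l then (@dimH R e.+3 n)^-1 else 0) * U n r s x.
Proof.
move=> x1.
have z1 : dot (zeta g (eta r) (eta' s)) (zeta g (eta r) (eta' s)) = 1 by rewrite (zeta_unit hg).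
have z0 : dot (eta r) (zeta g (eta r) (eta' s)) = 0 by rewrite (zeta_orth hg).
have -> : mean mu (fun y => U n r s y * (geg l).[dot x y]) =
    geg_eigen mu n (geg l) * U n r s x.
  rewrite /geg_eigen mulr_suml.
  have bd k : L1s mu (fun y => U n r s y * dot x y ^+ k).
    by apply/(bmf_L1 mu1)/bmfM; [exact: bmf_RePow|exact/bmfX/bmf_dot].
  transitivity (\sum_(k < size (geg l)) (geg l)`_k * mean mu (fun y => U n r s y * dot x y ^+ k)).
    under eq_bigr do rewrite -meanZ//.
    rewrite -mean_sum//; last by move=> k; exact: L1Z.
    apply: eq_mean => y _; rewrite horner_coef mulr_sumr.
    by apply: eq_bigr => k _; rewrite mulrCA.
  apply: eq_bigr => k _; rewrite -mulrA; congr (_ * _).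
  by rewrite (funk_hecke_monomial hmu Tmu)// x1 expr1n mulr1.
congr (_ * _); have := conv n l x1 x1.
rewrite (mean_geg hmu hnu hg Tnu Hnu)// x1 geg1// !mulr1.
by [].
Qed.

Lemma bmf_wave n r s : bmf (U n r s).
Proof. exact: bmf_RePow. Qed.

(** The kernel is a combination of waves of degree m in its second argument, on
    each of which convolution with a Gegenbauer kernel acts by a scalar. *)
Lemma wave_kernel_convr n m l x z : dot x x = 1 -> dot z z = 1 ->
  mean mu (fun y => K n m x y * (geg l).[dot z y]) =
  (if m == l then (@dimH R e.+3 m)^-1 else 0) * K n m x z.
Proof.
move=> x1 z1; rewrite /K.
under eq_mean do rewrite mulr_suml.
rewrite (mean_sum mu1); last first.
  move=> r; apply/(bmf_L1 mu1)/bmfM; last exact: bmf_hdot.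
  by apply: bmf_sum => s; apply: bmfZ; apply: bmfZ; exact: bmf_wave.
rewrite mulr_sumr; apply: eq_bigr => r _.
under eq_mean do rewrite mulr_suml.
have bd s : L1s mu (fun y => U m r s y * (geg l).[dot z y]).
  by apply/(bmf_L1 mu1)/bmfM; [exact: bmf_wave|exact: bmf_hdot].
rewrite (mean_sum mu1); last first.
  move=> s; apply/(bmf_L1 mu1)/bmfM; last exact: bmf_hdot.
  by apply: bmfZ; apply: bmfZ; exact: bmf_wave.
rewrite mulr_sumr; apply: eq_bigr => s _.
transitivity (mean mu (fun y => (w r * w' s * U n r s x) * (U m r s y * (geg l).[dot z y]))).
  by apply: eq_mean => y _; ring.
by rewrite meanZ// mean_wave_geg//; ring.
Qed.

Lemma wave_kernelC n m x y : K n m x y = K m n y x.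
Proof. by apply: eq_bigr => r _; apply: eq_bigr => s _; rewrite [U n r s x * _]mulrC. Qed.

Lemma binmom_gt0 n : 0 < binmom nu i1 n.
Proof.
elim: n => [|n IH].
  by rewrite (binmomE hnu) big_ord1 bin0 mul1r (mom0 hnu).
have h := binmom_rec hnu Tnu n.
have : 0 < (n + e.+2.-1)%:R * binmom nu i1 n.+1 by rewrite h mulr_gt0// ltr0n /= addnS.
by rewrite pmulr_rgt0// ltr0n /= addnS.
Qed.

(** The leading coefficients of the Gegenbauer polynomials do not vanish. *)
Lemma geg_expand N (p : {poly R}) : (size p <= N)%N ->
  exists b : nat -> R, p = \sum_(l < N) b l *: geg l.
Proof.
elim: N p => [|N IH] p sp.
  by exists (fun=> 0); rewrite big_ord0; apply/eqP; rewrite -size_poly_leq0.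
pose c := p`_N / binmom nu i1 N.
have [|b hb] := IH (p - c *: geg N).
  apply/leq_sizeP => j Nj; rewrite coefB coefZ.
  have [->|jN] := eqVneq j N.
    by rewrite (coef_geg hnu Tnu) /c mulfVK ?subrr// gt_eqF// binmom_gt0.
  have {jN}Nj : (N < j)%N by rewrite ltn_neqAle eq_sym jN.
  by rewrite !nth_default ?mulr0 ?subr0// ?(leq_trans sp)// (leq_trans (size_geg _ _)).
exists (fun l => if l == N then c else b l).
rewrite big_ord_recr/= eqxx -[LHS](subrK (c *: geg N)) hb; congr (_ + _).
by apply: eq_bigr => l _; rewrite ltn_eqF.
Qed.

(** A zonal kernel is a combination of Gegenbauer kernels. Convolution with the
    one of degree m fixes it, up to the factor 1 / dim H_m, and extracts its
    m-th component. *)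
Lemma wave_kernel_geg n m : (n + m <= D)%N -> exists c : R,
  forall x y, dot x x = 1 -> dot y y = 1 -> K n m x y = c * (geg m).[dot x y].
Proof.
move=> nmD; have [k hk] := wave_kernel_zonal nmD.
pose N := maxn (size k) m.+1.
have [b hb] := @geg_expand N k (leq_maxl _ _).
exists (b m) => x z x1 z1.
have dm := dimH_gt0 R e m.
have := wave_kernel_convr n m m x1 z1; rewrite eqxx.
have -> : mean mu (fun y => K n m x y * (geg m).[dot z y]) =
    (@dimH R e.+3 m)^-1 * (b m * (geg m).[dot x z]).
  transitivity (mean mu (fun y => \sum_(l < N) b l * ((geg l).[dot x y] * (geg m).[dot z y]))).
    apply: eq_mean => y /sphereE y1; rewrite hk// hb horner_sum mulr_suml.
    by apply: eq_bigr => l _; rewrite hornerZ mulrA.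
  have bd l : L1s mu (fun y => (geg l).[dot x y] * (geg m).[dot z y]).
    by apply/(bmf_L1 mu1)/bmfM; exact: bmf_hdot.
  rewrite mean_sum//; last by move=> l; exact: L1Z.
  have mN : (m < N)%N by rewrite leq_maxr.
  rewrite (bigD1 (Ordinal mN))//= meanZ// conv// eqxx big1 ?addr0; last first.
    move=> l lm; rewrite meanZ// conv// -(inj_eq val_inj) /= in lm *.
    by rewrite (negPf lm) mul0r mulr0.
  by rewrite mulrCA.
by move/mulfI => <- //; rewrite invr_eq0 gt_eqF.
Qed.

(** The Funk-Hecke formula with x = a + t b gives all the moments of the wave
    against the monomials of which it is itself a combination. For n > 0 the
    even terms of the binomial sum remain, and add up to half of 2^n. *)
Lemma wave_sqnorm n r s : (0 < n)%N ->
  mean mu (fun y => U n r s y ^+ 2) = fh_coef mu i0 n n * (2 ^+ n / 2).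
Proof.
move=> n0; rewrite /U; set a := eta r; set b := zeta g _ _.
have a1 : dot a a = 1 by exact: eta1.
have b1 : dot b b = 1 by rewrite (zeta_unit hg).
have ab : dot a b = 0 by rewrite (zeta_orth hg).
pose V y := RePow n (dot a y) (dot b y).
pose J l := mean mu (fun y => V y * (dot a y ^+ (n - l) * dot b y ^+ l)).
have bd l : L1s mu (fun y => V y * (dot a y ^+ (n - l) * dot b y ^+ l)).
  by apply/(bmf_L1 mu1)/bmfM; [exact: bmf_RePow|apply/bmfM; apply/bmfX/bmf_dot].
have PQ : \poly_(l < n.+1) ('C(n, l)%:R * J l) =
    \poly_(l < n.+1) (fh_coef mu i0 n n * ('C(n, l)%:R * Reik R l)).
  apply: horner_inj => t; rewrite !horner_poly.
  transitivity (mean mu (fun y => V y * dot (a + t *: b) y ^+ n)).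
    transitivity (mean mu (fun y => \sum_(l < n.+1) ('C(n, l)%:R * t ^+ l) *
        (V y * (dot a y ^+ (n - l) * dot b y ^+ l)))).
      rewrite mean_sum//; last by move=> l; exact: L1Z.
      by apply: eq_bigr => l _; rewrite meanZ// /J; ring.
    apply: eq_mean => y _; rewrite dotDl dotZl exprDn mulr_sumr; apply: eq_bigr => l _.
    by rewrite exprMn -mulr_natl; ring.
  rewrite (funk_hecke_monomial hmu Tmu)// subnn expr0 mulr1 !dotDr !dotZr a1 b1 (dotC b) ab.
  rewrite mulr0 addr0 mulr1 add0r RePowE mulr_sumr; apply: eq_bigr => l _.
  by rewrite expr1n; ring.
have hJ l : (l <= n)%N -> J l = fh_coef mu i0 n n * Reik R l.
  move=> ln; have := congr1 (fun p : {poly R} => p`_l) PQ; rewrite !coef_poly ltnS ln.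
  rewrite mulrCA; apply: mulfI; by rewrite pnatr_eq0 -lt0n bin_gt0.
transitivity (\sum_(l < n.+1) ('C(n, l)%:R * Reik R l) * J l).
  under eq_bigr do rewrite /J -meanZ//.
  rewrite -mean_sum//; last by move=> l; exact: L1Z.
  apply: eq_mean => y _; rewrite expr2 {2}RePowE mulr_sumr; apply: eq_bigr => l _.
  by rewrite -/(V y); ring.
have sq l : Reik R l * Reik R l = (1 + (-1) ^+ l) / 2.
  have [ol|el] := boolP (odd l); first by rewrite Reik_odd// -signr_odd ol expr1 subrr !mul0r.
  rewrite -(even_halfK el) Reik_even -exprMn mulrNN mulr1 expr1n.
  by rewrite -signr_odd odd_double expr0; field.
transitivity (fh_coef mu i0 n n * (\sum_(l < n.+1) 'C(n, l)%:R * (1 + (-1) ^+ l) / 2)).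
  rewrite mulr_sumr; apply: eq_bigr => l _; rewrite hJ; last by rewrite -ltnS.
  by rewrite -[in RHS]mulrA -sq; move: (Reik R l) => z; rewrite mulrCA !mulrA.
congr (_ * _); rewrite -mulr_suml; congr (_ / _).
transitivity ((1 + 1) ^+ n + (1 + -1) ^+ n : R); last by rewrite subrr expr0n gtn_eqF// addr0.
rewrite !exprDn -big_split/=; apply: eq_bigr => l _.
by rewrite !expr1n !mul1r mulrDr mulr1 -[1 *+ _]/(_%:R) mulr_natl.
Qed.

Lemma fh_diag_rising n : fh_coef mu i0 n n * 2 ^+ n * rising (e.+3%:R / 2) n = n`!%:R :> R.
Proof.
rewrite /fh_coef ltnn addnn half_double subnn bin0 mul1r /rising.
elim: n => [|n IH]; first by rewrite big_ord0 !expr0 (mom0 hmu) bin0 fact0 !mulr1 divr1.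
have h2 := mom_rec hmu Tmu n.
have h3 := congr1 (fun k => k%:R : R) (central_bin_rec n).
rewrite /= !natrM in h3.
have nz k : k.+1%:R != 0 :> R by rewrite pnatr_eq0.
have Cn : 'C(n.*2, n)%:R != 0 :> R by rewrite pnatr_eq0 -lt0n bin_gt0 -addnn leq_addr.
have hM : mom mu i0 n.+1.*2 = n.*2.+1%:R * mom mu i0 n.*2 / (2 * n + e).+3%:R.
  by rewrite doubleS -h2 !addnS mulrAC divff ?mul1r.
have hC : 'C(n.+1.*2, n.+1)%:R = 2 * n.*2.+1%:R * 'C(n.*2, n)%:R / n.+1%:R :> R.
  by rewrite -h3 mulrAC divff ?mul1r.
rewrite hM hC big_ord_recr/= !exprS (factS n) natrM -IH.
have -> : e.+3%:R / 2 + n%:R = (2 * n + e).+3%:R / 2 :> R.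
  have -> : (2 * n + e).+3%:R = 2 * n%:R + e.+3%:R :> R by rewrite -natrM -natrD !addnS.
  by field.
move: (\prod_(i < n) _) => P.
have alg (z M t C s p : R) : z != 0 -> t != 0 -> C != 0 -> s != 0 ->
    z * M / t / (2 * z * C / s) * (2 * p) * (2 * p) * (P * (t / 2)) =
    s * (M / C * p * p * P).
  by move=> *; field; do ?[apply/andP; split].
exact: alg.
Qed.

Lemma quadrature_weights : \sum_(r < rn) \sum_(s < sn) w r * w' s = 1.
Proof.
have h1 : \sum_(r < rn) w r = 1.
  have := quadrature_mean hq (rsp_cst _ D 1); rewrite mean_cst// => ->.
  by apply: eq_bigr => r _; rewrite mulr1.
have h2 : \sum_(s < sn) w' s = 1.
  have := quadrature_mean hq' (rsp_cst _ D 1); rewrite mean_cst// => ->.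
  by apply: eq_bigr => s _; rewrite mulr1.
by under eq_bigr do rewrite -mulr_sumr h2 mulr1.
Qed.

(** The kernel is a multiple of the Gegenbauer kernel of degree m and, by
    symmetry, of degree n as well; hence it vanishes for n different from m.
    For n = m the factor is the mean of the diagonal, which is the squared norm
    of one wave because the weights sum to 1. *)
Theorem wave_kernelE n m x y : (n + m <= D)%N -> (0 < n)%N ->
  dot x x = 1 -> dot y y = 1 ->
  K n m x y = if n == m then (2 * @A_const R e.+3 n ^+ 2)^-1 * (geg n).[dot x y] else 0.
Proof.
move=> nmD n0 x1 y1.
have [c hc] := wave_kernel_geg nmD.
case: eqVneq => [nm|nm]; last first.
  have mnD : (m + n <= D)%N by rewrite addnC.
  have [c' hc'] := wave_kernel_geg mnD.
  have cc : c = c'.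
    have := hc x x x1 x1; rewrite wave_kernelC hc'// x1 !geg1// !mulr1.
    by [].
  suff c0 : c = 0 by rewrite hc// c0 mul0r.
  have h z : dot z z = 1 -> c * (geg m).[dot x z] = c * (geg n).[dot x z].
    by move=> z1; rewrite -hc// wave_kernelC hc'// -cc dotC.
  have : mean mu (fun z => c * ((geg m).[dot x z] * (geg m).[dot x z])) =
         mean mu (fun z => c * ((geg n).[dot x z] * (geg m).[dot x z])).
    by apply: eq_mean => z /sphereE z1; rewrite mulrA h// -mulrA.
  have bd l l' : L1s mu (fun y => (geg l).[dot x y] * (geg l').[dot x y]).
    by apply/(bmf_L1 mu1)/bmfM; exact: bmf_hdot.
  rewrite !meanZ// !conv// eqxx (negPf nm) mul0r mulr0 x1 geg1// mulr1.
  by move/eqP; rewrite mulf_eq0 invr_eq0 (gt_eqF (dimH_gt0 R e m)) orbF => /eqP.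
subst m; rewrite hc//; congr (_ * _).
have -> : c = mean mu (fun z => K n n z z).
  rewrite -[LHS](mean_cst mu1); apply: eq_mean => z /sphereE z1.
  by rewrite hc// z1 geg1// mulr1.
rewrite /K (mean_sum mu1); last first.
  move=> r; apply/(bmf_L1 mu1)/bmf_sum => s.
  by apply: bmfZ; apply: bmfM; exact: bmf_wave.
transitivity (\sum_(r < rn) \sum_(s < sn) (w r * w' s) * (fh_coef mu i0 n n * (2 ^+ n / 2))).
  apply: eq_bigr => r _; rewrite (mean_sum mu1); last first.
    by move=> s; apply/(bmf_L1 mu1)/bmfZ; apply: bmfM; exact: bmf_wave.
  apply: eq_bigr => s _; rewrite meanZ; last by apply/(bmf_L1 mu1)/bmfM; exact: bmf_wave.
  by rewrite -(wave_sqnorm r s n0).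
under eq_bigr do rewrite -mulr_suml; rewrite -mulr_suml quadrature_weights mul1r.
rewrite A_const_sq//.
have f0 : fh_coef mu i0 n n * 2 ^+ n * rising (e.+3%:R / 2) n != 0 :> R.
  by rewrite fh_diag_rising pnatr_eq0 -lt0n fact_gt0.
have r0 : rising (e.+3%:R / 2) n != 0 :> R by apply: contra_neq f0 => ->; rewrite mulr0.
have F0 : n`!%:R != 0 :> R by rewrite pnatr_eq0 -lt0n fact_gt0.
move: (fh_diag_rising n) r0 F0; move: (rising _ n) (fh_coef _ _ _ _) (2 ^+ n) n`!%:R.
move=> X Y Z F <- X0 F0.
have [Y0 Z0] : Y != 0 /\ Z != 0 by split; apply: contra_neq F0 => ->; rewrite ?mulr0 !mul0r.
by field; rewrite X0 Y0 Z0.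
Qed.

End ZonalKernel.

(** * Reproducing kernels *)

Section Reproducing.
Variables (R : realType) (e : nat).
Variables (mu : probability (borel_vec R e.+3) R) (nu : probability (borel_vec R e.+2) R).
Hypotheses (hmu : rotation_invariant mu) (hnu : rotation_invariant nu).
Let i0 : 'I_e.+3 := ord_max.
Let i1 : 'I_e.+2 := ord_max.
Variable g : 'cV[R]_e.+3 -> 'M[R]_e.+3.
Hypothesis hg : forall u, dot u u = 1 ->
  SOgroup R e.+3 (g u) /\ g u *m unit_vec R e.+3 i0 = u.
Hypothesis Tnu : forall v : 'cV[R]_e.+2, dot v v = 1 ->
  exists2 h, SOgroup R e.+2 h & h *m unit_vec R e.+2 i1 = v.
Hypothesis Hnu : forall N, exists s (pt : 'I_s -> 'cV[R]_e.+2) w,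
  (forall r, dot (pt r) (pt r) = 1) /\ quadrature nu N pt w.
Hypothesis Hmu : forall N, exists s (pt : 'I_s -> 'cV[R]_e.+3) (w : 'I_s -> R),
  [/\ (forall r, dot (pt r) (pt r) = 1), (forall r, 0 <= w r) & quadrature mu N pt w].
Let mu1 : mu (sphere R e.+3) = 1%E := hmu.1.
Implicit Types (x y u z : 'cV[R]_e.+3) (p : {poly R}) (f h : 'cV[R]_e.+3 -> R).
Let Tmu u : dot u u = 1 -> exists2 h, SOgroup R e.+3 h & h *m unit_vec R e.+3 i0 = u.
Proof. by move=> /hg[]; exists (g u). Qed.
Notation geg := (geg nu).
Notation dimH := (@dimH R e.+3).
Notation conv := (geg_conv hmu hnu hg Tnu Hnu).
Notation L2s := (L2s mu).
Notation mean := (mean mu).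

(** The kernel of the orthogonal projection onto polynomials of degree below N.
    *)
Definition kern N : {poly R} := \sum_(n < N) dimH n *: geg n.

Let bp x p : bmf (fun y => p.[dot x y]).
Proof. exact: bmf_hdot. Qed.

Lemma kernS N : kern N.+1 = kern N + dimH N *: geg N.
Proof. by rewrite /kern big_ord_recr. Qed.

Lemma size_kern N : (size (kern N) <= N)%N.
Proof.
apply: (leq_trans (size_sum _ _ _)); apply/bigmax_leqP => n _.
by rewrite (leq_trans (size_scale_leq _ _))// (leq_trans (size_geg _ _)).
Qed.

Lemma mean_kern_geg N l x z : (l < N)%N -> dot x x = 1 -> dot z z = 1 ->
  mean (fun y => (kern N).[dot x y] * (geg l).[dot z y]) = (geg l).[dot x z].
Proof.
move=> lN x1 z1; rewrite /kern.
transitivity (mean (fun y => \sum_(n < N) dimH n * ((geg n).[dot x y] * (geg l).[dot z y]))).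
  apply: eq_mean => y _; rewrite horner_sum mulr_suml; apply: eq_bigr => n _.
  by rewrite hornerZ mulrA.
have bd n : L1s mu (fun y => (geg n).[dot x y] * (geg l).[dot z y]).
  by apply/(bmf_L1 mu1)/bmfM; exact: bp.
rewrite mean_sum//; last by move=> n; exact: L1Z.
rewrite (bigD1 (Ordinal lN))//= meanZ// conv// eqxx mulrA mulfV ?mul1r; last first.
  by rewrite gt_eqF// dimH_gt0.
rewrite big1 ?addr0// => n nl; rewrite meanZ// conv//.
by rewrite -(inj_eq val_inj) /= in nl; rewrite (negPf nl) mul0r mulr0.
Qed.

(** The reproducing property, by expansion into Gegenbauer polynomials. *)
Lemma kern_repr N p x z : (size p <= N)%N -> dot x x = 1 -> dot z z = 1 ->
  mean (fun y => (kern N).[dot x y] * p.[dot z y]) = p.[dot x z].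
Proof.
move=> sp x1 z1; have [b ->] := geg_expand hnu Tnu sp.
transitivity (mean (fun y => \sum_(l < N) b l * ((kern N).[dot x y] * (geg l).[dot z y]))).
  apply: eq_mean => y _; rewrite [X in _ * X]horner_sum mulr_sumr; apply: eq_bigr => n _.
  by rewrite hornerZ mulrCA.
have bd n : L1s mu (fun y => (kern N).[dot x y] * (geg n).[dot z y]).
  by apply/(bmf_L1 mu1)/bmfM; exact: bp.
rewrite mean_sum//; last by move=> n; exact: L1Z.
rewrite horner_sum; apply: eq_bigr => l _.
by rewrite meanZ// mean_kern_geg// hornerZ.
Qed.

Definition zop p f x : R := mean (fun y => p.[dot x y] * f y).

Definition zform p f : R := mean (fun x => f x * zop p f x).

Definition sq f : R := mean (fun x => f x ^+ 2).

Let L1p p f x : L2s f -> L1s mu (fun y => p.[dot x y] * f y).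
Proof. by move=> hf; apply: L2_L1M => //; apply/(bmf_L2 mu1)/bp. Qed.

(** Reproduction written with an exact quadrature: the integral operator has
    finite rank, and iterated integrals become finite sums. *)
Lemma zonal_rank p : exists n (a : 'I_n -> R) (al be : 'I_n -> 'cV[R]_e.+3 -> R),
  [/\ (forall i, bmf (al i)), (forall i, bmf (be i)) &
   forall x y, dot x x = 1 -> dot y y = 1 -> p.[dot x y] = \sum_i a i * (al i x * be i y)].
Proof.
pose N := size p.
have [n [pt [w [p1 _ hq]]]] := Hmu ((size (kern N)).-1 + (size p).-1).
exists n, w, (fun i x => (kern N).[dot x (pt i)]), (fun i y => p.[dot y (pt i)]); split.
- by move=> i; under eq_fun do rewrite dotC; exact: bp.
- by move=> i; under eq_fun do rewrite dotC; exact: bp.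
move=> x y x1 y1; rewrite -(@kern_repr N)//.
by rewrite (quadrature_mean hq)//; apply: rspM; exact: rsp_hdot.
Qed.

Lemma bmf_zop p f : L2s f -> exists2 F, bmf F & forall x, sphere R e.+3 x -> zop p f x = F x.
Proof.
move=> hf; have [n [a [al [be [ba bb e1]]]]] := zonal_rank p.
have bd i : L1s mu (fun y => be i y * f y).
  by apply: L2_L1M => //; exact: bmf_L2.
exists (fun x => \sum_i (a i * mean (fun y => be i y * f y)) * al i x).
  by apply: bmf_sum => i; exact: bmfZ.
move=> x /sphereE x1.
transitivity (mean (fun y => \sum_i (a i * al i x) * (be i y * f y))).
  apply: eq_mean => y /sphereE y1; rewrite e1// mulr_suml; apply: eq_bigr => i _; ring.
rewrite mean_sum//; last by move=> i; exact: L1Z.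
by apply: eq_bigr => i _; rewrite meanZ//; ring.
Qed.

Lemma eq_L1 f h : (forall x, sphere R e.+3 x -> f x = h x) -> L1s mu f -> L1s mu h.
Proof.
by move=> fh; apply: eq_integrable; [exact: measurable_sphere|move=> x; rewrite inE => /fh /= ->].
Qed.

Lemma eq_L2 f h : (forall x, sphere R e.+3 x -> f x = h x) -> L2s f -> L2s h.
Proof.
move=> fh [mf hf]; split.
  by apply: eq_measurable_fun mf => x; rewrite inE => /fh.
by apply: eq_L1 hf => x /fh ->.
Qed.

Lemma L2_zop p f : L2s f -> L2s (zop p f).
Proof.
move=> hf; have [F bF eF] := bmf_zop p hf.
by apply: eq_L2 (bmf_L2 mu1 bF) => x /eF.
Qed.

(** The bridge between frame energies and kernels: a sum of squared
    coefficients is the quadratic form of the sum of the rank-one kernels. *)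
Lemma zformE (I : finType) (a : I -> R) (al : I -> 'cV[R]_e.+3 -> R) p f :
  L2s f -> (forall i, bmf (al i)) ->
  (forall x y, dot x x = 1 -> dot y y = 1 -> p.[dot x y] = \sum_i a i * (al i x * al i y)) ->
  zform p f = \sum_i a i * mean (fun y => f y * al i y) ^+ 2.
Proof.
move=> hf ba e1.
have bd i : L1s mu (fun y => f y * al i y).
  by apply: L2_L1M => //; exact: bmf_L2.
transitivity (mean (fun x => \sum_i (a i * mean (fun y => f y * al i y)) * (f x * al i x))).
  apply: eq_mean => x /sphereE x1; rewrite /zop.
  have -> : mean (fun y => p.[dot x y] * f y) =
      \sum_i a i * mean (fun y => f y * al i y) * al i x.
    transitivity (mean (fun y => \sum_i (a i * al i x) * (f y * al i y))).
      apply: eq_mean => y /sphereE y1; rewrite e1// mulr_suml; apply: eq_bigr => i _; ring.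
    rewrite mean_sum//; last by move=> i; exact: L1Z.
    by apply: eq_bigr => i _; rewrite meanZ//; ring.
  by rewrite mulr_sumr; apply: eq_bigr => i _; ring.
rewrite mean_sum//; last by move=> i; exact: L1Z.
by apply: eq_bigr => i _; rewrite meanZ// -mulrA -expr2.
Qed.

Lemma zopD p q f x : L2s f -> zop (p + q) f x = zop p f x + zop q f x.
Proof.
move=> hf; rewrite -meanD//; do ?exact: L1p.
by apply: eq_mean => y _; rewrite hornerD mulrDl.
Qed.

Lemma zopZ c p f x : L2s f -> zop (c *: p) f x = c * zop p f x.
Proof.
move=> hf; rewrite -meanZ//; last exact: L1p.
by apply: eq_mean => y _; rewrite hornerZ mulrA.
Qed.

Lemma zop_fD p f h x : L2s f -> L2s h -> zop p (fun y => f y + h y) x = zop p f x + zop p h x.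
Proof.
move=> hf hh; rewrite -meanD//; do ?exact: L1p.
by apply: eq_mean => y _; rewrite mulrDr.
Qed.

Lemma zop_fZ p c f x : L2s f -> zop p (fun y => c * f y) x = c * zop p f x.
Proof.
move=> hf; rewrite -meanZ//; last exact: L1p.
by apply: eq_mean => y _; rewrite mulrCA.
Qed.

Lemma zformD p q f : L2s f -> zform (p + q) f = zform p f + zform q f.
Proof.
move=> hf; rewrite -meanD//; do ?[by apply: L2_L1M => //; exact: L2_zop].
by apply: eq_mean => x _; rewrite zopD// mulrDr.
Qed.

Lemma zformZ c p f : L2s f -> zform (c *: p) f = c * zform p f.
Proof.
move=> hf; rewrite -meanZ//; last by apply: L2_L1M => //; exact: L2_zop.
by apply: eq_mean => x _; rewrite zopZ// mulrCA.
Qed.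

Lemma zform0 f : L2s f -> zform 0 f = 0.
Proof. by move=> hf; rewrite -(scale0r 0) zformZ// mul0r. Qed.

Lemma zform_sum N (F : 'I_N -> {poly R}) f : L2s f ->
  zform (\sum_(n < N) F n) f = \sum_(n < N) zform (F n) f.
Proof.
move=> hf; elim/big_rec2: _ => [|n a p _ IH]; first exact: zform0.
by rewrite zformD// IH.
Qed.

(** The kernel convolved with itself is a positive multiple of itself;
    discretised by a quadrature, this is a sum of squares. *)
Lemma zform_geg_ge0 n f : L2s f -> 0 <= zform (dimH n *: geg n) f.
Proof.
move=> hf; have [s [pt [w [p1 w0 hq]]]] := Hmu ((size (geg n)).-1 + (size (geg n)).-1).
rewrite (@zformE 'I_s (fun i => dimH n ^+ 2 * w i) (fun i x => (geg n).[dot x (pt i)]))//.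
- apply: sumr_ge0 => i _; rewrite mulr_ge0 ?sqr_ge0// mulr_ge0 ?sqr_ge0//.
- by move=> i; under eq_fun do rewrite dotC; exact: bp.
move=> x y x1 y1; rewrite hornerZ.
have := conv n n x1 y1; rewrite eqxx (quadrature_mean hq); last by apply: rspM; exact: rsp_hdot.
move=> /(congr1 (fun t => dimH n ^+ 2 * t)) h.
under eq_bigr do rewrite -mulrA; rewrite -mulr_sumr h.
by field; rewrite gt_eqF// dimH_gt0.
Qed.

Lemma zform_kern_mono N M f : (N <= M)%N -> L2s f -> zform (kern N) f <= zform (kern M) f.
Proof.
move=> NM hf; rewrite -(subnK NM); elim: (M - N)%N => [|k IH]; first by rewrite add0n.
by rewrite addSn kernS zformD// (le_trans IH)// lerDl zform_geg_ge0.
Qed.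

Definition res N f : R := sq (fun x => f x - zop (kern N) f x).

(** The kernel is idempotent by reproduction, hence the operator is an
    orthogonal projection and Pythagoras' theorem applies. *)
Lemma resE N f : L2s f -> res N f = sq f - zform (kern N) f.
Proof.
move=> hf; set k := kern N.
have [s [pt [w [p1 w0 hq]]]] := Hmu ((size k).-1 + (size k).-1).
have sk : (size k <= N)%N by exact: size_kern.
have kk x y : dot x x = 1 -> dot y y = 1 -> k.[dot x y] = \sum_r w r * (k.[dot x (pt r)] * k.[dot y (pt r)]).
  move=> x1 y1; rewrite -(@kern_repr N)//.
  by rewrite (quadrature_mean hq)//; apply: rspM; exact: rsp_hdot.
pose c r := mean (fun y => f y * k.[dot y (pt r)]).
have bk r : bmf (fun y => k.[dot y (pt r)]) by under eq_fun do rewrite dotC; exact: bp.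
have zf : zform k f = \sum_r w r * c r ^+ 2 by apply: zformE.
have bd r : L1s mu (fun y => f y * k.[dot y (pt r)]).
  by apply: L2_L1M => //; exact: bmf_L2.
have zo x : dot x x = 1 -> zop k f x = \sum_r (w r * c r) * k.[dot x (pt r)].
  move=> x1; transitivity (mean (fun y => \sum_r (w r * k.[dot x (pt r)]) * (f y * k.[dot y (pt r)]))).
    apply: eq_mean => y /sphereE y1; rewrite kk// mulr_suml; apply: eq_bigr => i _; ring.
  rewrite mean_sum//; last by move=> i; exact: L1Z.
  by apply: eq_bigr => i _; rewrite meanZ// -/(c i); ring.
have zc r : zop k f (pt r) = c r.
  by apply: eq_mean => y _; rewrite mulrC (dotC y).
have bkk r q : L1s mu (fun x => k.[dot x (pt r)] * k.[dot x (pt q)]).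
  by apply/(bmf_L1 mu1)/bmfM; exact: bk.
have sz : sq (zop k f) = zform k f.
  rewrite zf; transitivity (mean (fun x => \sum_r \sum_q ((w r * c r) * (w q * c q)) *
     (k.[dot x (pt r)] * k.[dot x (pt q)]))).
    apply: eq_mean => x /sphereE x1; rewrite zo// expr2 big_distrlr/=.
    by apply: eq_bigr => r _; apply: eq_bigr => q _; ring.
  rewrite (mean_sum mu1); last first.
    by move=> r; apply/(bmf_L1 mu1)/bmf_sum => q; apply/bmfZ/bmfM; exact: bk.
  apply: eq_bigr => r _; rewrite (mean_sum mu1); last first.
    by move=> q; apply/(bmf_L1 mu1)/bmfZ/bmfM; exact: bk.
  transitivity (w r * c r * zop k f (pt r)); last by rewrite zc -mulrA.
  rewrite zo// mulr_sumr; apply: eq_bigr => q _.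
  rewrite meanZ// -mulrA; congr (_ * _).
  rewrite -(@kern_repr N k (pt r) (pt q))//; congr (_ * _).
  by apply: eq_mean => x _; rewrite !(dotC x).
have hT := L2_zop k hf.
have l1 : L1s mu (fun x => f x * zop k f x) by exact: L2_L1M.
rewrite /res.
transitivity (mean (fun x => (f x ^+ 2 + (-2) * (f x * zop k f x)) + zop k f x ^+ 2)).
  by apply: eq_mean => x _; rewrite -/k; ring.
rewrite meanD; [|by apply: L1D; [exact: hf.2|exact: L1Z]|exact: hT.2].
rewrite meanD; [|exact: hf.2|exact: L1Z].
by rewrite meanZ// -/(zform k f) -/(sq (zop k f)) sz -/(sq f); ring.
Qed.

Lemma sq_ge0 f : 0 <= sq f.
Proof. by apply: mean_ge0 => x _; exact: sqr_ge0. Qed.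

Lemma res_ge0 N f : 0 <= res N f. Proof. exact: sq_ge0. Qed.

Lemma res_le_sq N f : L2s f -> res N f <= sq f.
Proof.
move=> hf; rewrite resE// lerBlDr lerDl.
have := zform_kern_mono (leq0n N) hf; by rewrite [kern 0]big_ord0 zform0.
Qed.

Lemma res_antitone N M f : (N <= M)%N -> L2s f -> res M f <= res N f.
Proof.
move=> NM hf; rewrite (resE N hf) (resE M hf); apply: lerB => //.
exact: zform_kern_mono.
Qed.

Lemma sqD f h : L2s f -> L2s h -> sq (fun x => f x + h x) <= 2 * sq f + 2 * sq h.
Proof.
move=> hf hh; rewrite -!meanZ ?hf.2 ?hh.2//; do ?[exact: hf.2|exact: hh.2].
rewrite -meanD; do ?[apply: L1Z; by [exact: hf.2|exact: hh.2]].
apply: le_mean => //.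
- exact: (L2D hf hh).2.
- by apply: L1D; apply: L1Z; [exact: hf.2|exact: hh.2].
- by move=> x _; have := sqr_ge0 (f x - h x); nra.
Qed.

Lemma resD N f h : L2s f -> L2s h -> res N (fun x => f x + h x) <= 2 * res N f + 2 * res N h.
Proof.
move=> hf hh; have := sqD (L2B hf (L2_zop (kern N) hf)) (L2B hh (L2_zop (kern N) hh)).
apply: le_trans; rewrite le_eqVlt; apply/orP; left; apply/eqP; apply: eq_mean => x _.
by rewrite zop_fD//; ring.
Qed.

Lemma resZ N c f : L2s f -> res N (fun x => c * f x) = c ^+ 2 * res N f.
Proof.
move=> hf; rewrite -meanZ; last exact: (L2B hf (L2_zop (kern N) hf)).2.
by apply: eq_mean => x _; rewrite zop_fZ//; ring.
Qed.

(** Sums of zonal polynomials are the explicit elements of the range of the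
    projection that the approximation below produces. *)
Lemma res_zonal N n (a : 'I_n -> R) (z : 'I_n -> 'cV[R]_e.+3) p :
  (size p <= N)%N -> (forall r, dot (z r) (z r) = 1) ->
  res N (fun x => \sum_r a r * p.[dot x (z r)]) = 0.
Proof.
move=> sp z1; rewrite /res -[RHS](mean_cst mu1); apply: eq_mean => x /sphereE x1.
have -> : zop (kern N) (fun x => \sum_r a r * p.[dot x (z r)]) x = \sum_r a r * p.[dot x (z r)].
  have bd r : L1s mu (fun y => (kern N).[dot x y] * p.[dot (z r) y]).
    by apply/(bmf_L1 mu1)/bmfM; exact: bp.
  transitivity (mean (fun y => \sum_r a r * ((kern N).[dot x y] * p.[dot (z r) y]))).
    apply: eq_mean => y _; rewrite mulr_sumr; apply: eq_bigr => r _.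
    by rewrite (dotC y) mulrCA.
  rewrite mean_sum//; last by move=> r; exact: L1Z.
  by apply: eq_bigr => r _; rewrite meanZ// kern_repr.
by rewrite subrr expr0n.
Qed.

(** The closure of the polynomials: functions that the projections recover in
    the limit. *)
Definition dens f := L2s f /\ forall eps : R, 0 < eps -> exists N, res N f <= eps.

Let quarter (eps a b a' b' : R) :
  a <= eps / 4 -> b <= eps / 4 -> b' <= b -> a' <= a -> 2 * a' + 2 * b' <= eps.
Proof. by move=> *; lra. Qed.

Lemma densD f h : dens f -> dens h -> dens (fun x => f x + h x).
Proof.
move=> [hf df] [hh dh]; split; first exact: L2D.
move=> eps e0; have e4 : 0 < eps / 4 by rewrite divr_gt0.
have [N hN] := df _ e4; have [M hM] := dh _ e4.
exists (maxn N M); apply: le_trans (resD _ hf hh) _.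
have := res_antitone (leq_maxl N M) hf; have := res_antitone (leq_maxr N M) hh.
exact: quarter hN hM.
Qed.

Lemma densZ c f : dens f -> dens (fun x => c * f x).
Proof.
move=> [hf df]; split; first exact: L2Z.
move=> eps e0; have c0 : 0 < c ^+ 2 + 1 by rewrite ltr_wpDl ?sqr_ge0.
have [N hN] := df (eps / (c ^+ 2 + 1)) (divr_gt0 e0 c0).
exists N; rewrite resZ//; move: hN; rewrite ler_pdivlMr// => h.
by apply: le_trans h; rewrite mulrC ler_wpM2l ?res_ge0// lerDl.
Qed.

(** The complementary projections are contractions, whence the set is closed in
    L2. *)
Lemma dens_lim f : L2s f ->
  (forall eps : R, 0 < eps -> exists2 h, dens h & sq (fun x => f x - h x) <= eps) -> dens f.
Proof.
move=> hf H; split => // eps e0; have e4 : 0 < eps / 4 by rewrite divr_gt0.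
have [h [hh dh] sfh] := H _ e4; have [N hN] := dh _ e4; exists N.
have -> : f = (fun x => (f x - h x) + h x) by apply/funext => x; rewrite subrK.
apply: le_trans (resD _ (L2B hf hh) hh) _.
exact: quarter sfh hN (lexx _) (res_le_sq N (L2B hf hh)).
Qed.

(** Uniform continuity in the form in which the approximate identity consumes
    it: the modulus is split into a small constant and a multiple of 1 - <x,
    y>, which is half the squared distance. *)
Definition dot_uniform f := forall eps : R, 0 < eps -> exists2 C : R, 0 <= C &
  forall x y, dot x x = 1 -> dot y y = 1 -> `|f y - f x| <= eps + C * (1 - dot x y).

(** The kernel (1 + <x, y>)^M, normalised to mean 1, is nonnegative and
    concentrates on the diagonal: the mean of 1 - <x, y> against it is (d - 1)
    / (M + d - 1) by the recursion of the moments. Its convolution with f,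
    discretised by a quadrature with nonnegative weights, is a polynomial, and
    the error is estimated at the nodes. *)
Lemma dot_uniform_approx f : bmf f -> dot_uniform f -> forall eps : R, 0 < eps ->
  exists2 h, dens h & forall x, dot x x = 1 -> `|f x - h x| <= eps.
Proof.
move=> bf uf eps e0; have e2 : 0 < eps / 2 by rewrite divr_gt0.
have [C C0 hC] := uf _ e2.
pose I M := binmom mu i0 M.
have I0 M : 0 < I M.
  elim: M => [|M IH]; first by rewrite /I (binmomE hmu) big_ord1 bin0 mul1r (mom0 hmu).
  have h := binmom_rec hmu Tmu M.
  have : 0 < (M + e.+3.-1)%:R * binmom mu i0 M.+1 by rewrite h mulr_gt0// ltr0n /= addnS.
  by rewrite pmulr_rgt0// ltr0n /= addnS.
pose delta M : R := (e.+2)%:R / (M + e.+2)%:R.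
have hd M : (2 * I M - I M.+1) / I M = delta M.
  have h : (M%:R + e.+2%:R) * I M.+1 = (2 * M%:R + e.+2%:R) * I M.
    by rewrite -(natrM _ 2 M) -!natrD; exact: (binmom_rec hmu Tmu M).
  rewrite /delta.
  have n0 : M%:R + e.+2%:R != 0 :> R by rewrite -natrD pnatr_eq0 addnS.
  have iM : I M != 0 by rewrite gt_eqF.
  have -> : I M.+1 = (2 * M%:R + e.+2%:R) * I M / (M%:R + e.+2%:R).
    by rewrite -h mulrAC mulfV ?mul1r.
  rewrite natrD.
  by move: n0 iM; move: (I M) (M%:R) (e.+2%:R) => *; field; apply/andP.
(* This M makes C (d - 1) / (M + d - 1) at most eps / 2. *)
pose M := (Num.truncn (2 * C * e.+2%:R / eps)).+1.
have hM : C * delta M <= eps / 2.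
  have p0 : 0 < (M + e.+2)%:R :> R by rewrite ltr0n addnS.
  rewrite /delta mulrA ler_pdivrMr//.
  have : 2 * C * e.+2%:R / eps <= M%:R by exact/ltW/Num.Theory.truncnS_gt.
  rewrite ler_pdivrMr// natrD => h.
  have : 0 <= eps * e.+2%:R by rewrite mulr_ge0 ?ltW.
  by move: h; move: (e.+2%:R) (M%:R) => a b; nra.
pose p : {poly R} := (I M)^-1 *: (1 + 'X) ^+ M.
have sp : (size p <= M.+1)%N.
  rewrite (leq_trans (size_scale_leq _ _))// (leq_trans (size_poly_exp_leq _ _))// ltnS.
  by rewrite -polyC1 addrC size_XaddC mul1n.
have [n [pt [w [p1 w0 hq]]]] := Hmu M.+1.
exists (fun x => \sum_r (w r * f (pt r)) * p.[dot x (pt r)]).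
  split; last by move=> eps' e0'; exists M.+1; rewrite res_zonal// ltW.
  by apply/(bmf_L2 mu1)/bmf_sum => r; apply: bmfZ; under eq_fun do rewrite dotC; exact: bp.
move=> x x1.
have q (F : {poly R}) : (size F <= M.+2)%N -> \sum_r w r * F.[dot x (pt r)] = Lp mu i0 F.
  move=> sF; rewrite -(Lp_unit hmu Tmu _ x1) (quadrature_mean hq)//.
  by apply: rsp_le (rsp_hdot x F); case: (size F) sF.
have q1 : \sum_r w r * p.[dot x (pt r)] = 1.
  by rewrite q ?(leqW sp)// LpZ// -/(binmom mu i0 M) mulVf// gt_eqF.
have q2 : \sum_r w r * (p * (1 - 'X)).[dot x (pt r)] = delta M.
  rewrite q; last first.
    rewrite (leq_trans (size_polyMleq _ _))// -subn1 leq_subLR.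
    rewrite -opprB size_polyN size_XsubC addn2 add1n !ltnS.
    exact: sp.
  have -> : p * (1 - 'X) = (I M)^-1 *: (2 *: (1 + 'X) ^+ M + (-1) *: (1 + 'X) ^+ M.+1).
    by rewrite /p -scalerAl exprS -!mul_polyC rmorphN/= polyC1; ring.
  rewrite LpZ// LpD// !LpZ// -hd mulrC mulN1r.
  by [].
have -> : f x - \sum_r w r * f (pt r) * p.[dot x (pt r)] =
    \sum_r (w r * p.[dot x (pt r)]) * (f x - f (pt r)).
  rewrite -[in LHS](mul1r (f x)) -[X in X * f x]q1 mulr_suml -sumrB.
  by apply: eq_bigr => r _; rewrite mulrBr (mulrAC (w r) (f (pt r))).
apply: le_trans (ler_norm_sum _ _ _) _.
apply: (@le_trans _ _ (\sum_r (eps / 2 * (w r * p.[dot x (pt r)]) +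
    C * (w r * (p * (1 - 'X)).[dot x (pt r)])))).
  apply: ler_sum => r _.
  have t1 : 0 <= 1 + dot x (pt r).
    by have := dot_le1 x1 (p1 r); rewrite ler_norml => /andP[h _]; lra.
  have pp : 0 <= p.[dot x (pt r)].
    rewrite /p hornerZ mulr_ge0 ?invr_ge0 ?(ltW (I0 M))//.
    by rewrite horner_exp hornerD hornerX -polyC1 hornerC exprn_ge0.
  have wp : 0 <= w r * p.[dot x (pt r)] by rewrite mulr_ge0.
  rewrite normrM ger0_norm//.
  have -> : (p * (1 - 'X)).[dot x (pt r)] = p.[dot x (pt r)] * (1 - dot x (pt r)).
    by rewrite hornerM hornerD hornerN hornerX -polyC1 hornerC.
  apply: (le_trans (ler_wpM2l wp (hC _ _ (p1 r) x1))).
  by rewrite (dotC (pt r)) le_eqVlt; apply/orP; left; apply/eqP; ring.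
rewrite big_split/= -!mulr_sumr q1 q2 mulr1.
by move: hM; move: (C * delta M) => *; lra.
Qed.

Lemma dens_dot_uniform f : bmf f -> dot_uniform f -> dens f.
Proof.
move=> bf uf; apply: dens_lim; first exact: bmf_L2.
move=> eps e0; have m0 : 0 < Num.min 1 eps by rewrite lt_min ltr01.
have [h dh hh] := dot_uniform_approx bf uf m0.
exists h => //; rewrite -(mean_cst mu1 eps); apply: le_mean => //.
- exact: (L2B (bmf_L2 mu1 bf) dh.1).2.
- exact/(bmf_L1 mu1)/bmf_cst.
move=> x /sphereE /hh; rewrite le_min => /andP[h1 h2].
rewrite -real_normK ?num_real// expr2 (le_trans _ h2)//.
by rewrite ler_piMr.
Qed.

End Reproducing.

(** * Density of the polynomials in L2 *)

Section SquareSmall.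
Variables (R : realType) (m : nat) (mu : probability (borel_vec R m) R).
Let S : set (borel_vec R m) := sphere R m.
Implicit Types f G : 'cV[R]_m -> R.

Lemma L2_dom f G : measurable_fun S (f : borel_vec R m -> R) -> L2s mu G ->
  (forall x, sphere R m x -> `|f x| <= G x) -> L2s mu f.
Proof.
move=> mf [_ iG] fG; split => //; apply: le_integrable iG.
- exact: measurable_sphere.
- by apply/measurable_EFinP; exact: measurable_funX.
move=> x Sx /=; rewrite lee_fin !normrX lerXn2r ?nnegrE//.
by rewrite (le_trans (fG x Sx))// ler_norm.
Qed.

(** The domination (f - h_n)^2 <= 4 G^2 makes the dominated convergence theorem
    yield convergence in L2. *)
Lemma mean_sqr_dct f (h : nat -> 'cV[R]_m -> R) G :
  (forall n, L2s mu (h n)) -> measurable_fun S (f : borel_vec R m -> R) ->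
  L2s mu G -> (forall n x, sphere R m x -> `|h n x| <= G x) ->
  (forall x, sphere R m x -> (h n x) @[n --> \oo] --> f x) ->
  L2s mu f /\ forall eps : R, 0 < eps ->
    exists n, mean mu (fun x => (f x - h n x) ^+ 2) <= eps.
Proof.
move=> hL mf hG hdom hcvg.
have fG x : sphere R m x -> `|f x| <= G x.
  move=> Sx; apply: (@cvgr_to_le _ \oo _ _ (fun n => `|h n x|)).
    exact: cvg_norm (hcvg x Sx).
  by apply: nearW => n; exact: hdom.
have Lf : L2s mu f by exact: L2_dom hG fG.
split => // eps e0.
have mS : measurable S by exact: measurable_sphere.
pose F n (x : borel_vec R m) : \bar R := (((f x - h n x) ^+ 2)%:E)%E.
have mF n : measurable_fun S (F n).
  by apply/measurable_EFinP/measurable_funX/measurable_funB => //; case: (hL n).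
have F0 : {ae mu, forall x, S x -> F ^~ x @ \oo --> (cst 0%E : borel_vec R m -> \bar R) x}.
  apply: aeW => x Sx; apply: cvg_EFin; first exact: nearW.
  have : (f x - h n x) @[n --> \oo] --> (f x - f x).
    by apply: cvgB; [exact: cvg_cst|exact: hcvg].
  rewrite subrr => /(fun c => cvgM c c); rewrite mulr0.
  by apply: cvg_trans; apply: near_eq_cvg; apply: nearW => n; rewrite /F/= expr2.
have iG : mu.-integrable S (fun x : borel_vec R m => (4 * G x ^+ 2)%:E).
  exact: (L1Z 4 hG.2).
have FG : {ae mu, forall x n, S x -> (`|F n x| <= (4 * G x ^+ 2)%:E)%E}.
  apply: aeW => x n Sx; rewrite lee_fin ger0_norm ?sqr_ge0//.
  have := fG x Sx; have := hdom n x Sx; rewrite !ler_norml => /andP[a b] /andP[c d].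
  by move: a b c d; move: (f x) (h n x) (G x) => p q r *; nra.
have [_ _] := dominated_convergence mS mF (measurable_cst _) F0 iG FG.
rewrite integral0 => /fine_cvgP[_ /cvgrPdist_le /(_ eps e0)[n _ /(_ n)/= hn]].
by exists n; move: (hn (leqnn n)); rewrite sub0r normrN => /(le_trans (ler_norm _)).
Qed.

End SquareSmall.

Section Lipschitz.
Variables (R : realType) (e : nat).
Implicit Types x y : 'cV[R]_e.+3.

Lemma norm_le_dot x : `|x| ^+ 2 <= dot x x.
Proof.
have [/eqP ->|x0] := boolP (x == 0); first by rewrite normr0 expr0n dot_ge0.
have : mx_norm x != 0 by apply: contra x0 => /eqP/mx_norm_eq0 ->.
move=> /mx_norm_neq0[[i j]/=]; rewrite (ord1 j) => xE.
have -> : `|x| = `|x i 0| by [].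
rewrite real_normK ?num_real// /dot (bigD1 i)//= -expr2 lerDl.
by apply: sumr_ge0 => k _; rewrite -expr2 sqr_ge0.
Qed.

Lemma norm_sphere x y : dot x x = 1 -> dot y y = 1 ->
  `|x - y| ^+ 2 <= 2 * (1 - dot x y).
Proof.
move=> x1 y1; apply: le_trans (norm_le_dot _) _.
rewrite !dotDl !dotDr !dotNl !dotNr x1 y1 (dotC y x).
by move: (dot x y) => t; lra.
Qed.

Definition lip (k : R) (f : 'cV[R]_e.+3 -> R) := forall x y, `|f x - f y| <= k * `|x - y|.

Lemma lip_continuous (k : R) f : 0 < k -> lip k f -> continuous f.
Proof.
move=> k0 lf x s /= /(nbhs_ballP (f x)) [eps ep es].
apply/nbhs_ballP; exists (eps / k); first by rewrite /= divr_gt0.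
move=> y; rewrite mx_norm_ball /= => xy; apply: es; rewrite -ball_normE /=.
by rewrite (le_lt_trans (lf x y))// mulrC -ltr_pdivlMr.
Qed.

Lemma continuous_borel (f : 'cV[R]_e.+3 -> R) (D : set (borel_vec R e.+3)) :
  continuous f -> measurable_fun D (f : borel_vec R e.+3 -> R).
Proof.
move=> cf; apply: measurable_funTS.
apply: (measurability _ (RGenOpens.measurableE R)).
move=> _ [_ [a [b ->]] <-]; rewrite setTI; apply: sub_sigma_algebra.
have /continuousP := cf; apply.
exact: interval_open.
Qed.

(** Young's inequality k r <= eps + k^2 r^2 / (2 eps), where r^2 is at most
    twice 1 - <x, y>. *)
Lemma lip_dot_uniform (k : R) f : 0 < k -> lip k f -> dot_uniform f.
Proof.
move=> k0 lf eps ep; exists (k ^+ 2 / eps).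
  by rewrite divr_ge0 ?sqr_ge0 ?(ltW ep).
move=> x y x1 y1; rewrite distrC; apply: le_trans (lf x y) _.
have h : (k * `|x - y|) ^+ 2 <= k ^+ 2 * (2 * (1 - dot x y)).
  by rewrite exprMn ler_wpM2l ?sqr_ge0// norm_sphere.
rewrite -subr_ge0 -(pmulr_rge0 _ ep).
have -> : eps * (eps + k ^+ 2 / eps * (1 - dot x y) - k * `|x - y|) =
    eps ^+ 2 + k ^+ 2 * (1 - dot x y) - eps * (k * `|x - y|).
  by move: `|x - y| (dot x y) => *; field; rewrite gt_eqF.
move: h; move: (k * `|x - y|) (k ^+ 2) (dot x y) => a c t h.
by have := sqr_ge0 (a - eps); have := sqr_ge0 eps; nra.
Qed.

Definition dist_to (C : set 'cV[R]_e.+3) x : R := inf [set `|x - z| | z in C].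

Lemma dist_to_lb (C : set 'cV[R]_e.+3) x : lbound [set `|x - z| | z in C] 0.
Proof. by move=> _ [z _ <-]; exact: normr_ge0. Qed.

Lemma dist_to_le (C : set 'cV[R]_e.+3) x z : C z -> dist_to C x <= `|x - z|.
Proof. by move=> Cz; apply: ge_inf; [exists 0; exact: dist_to_lb|exists z]. Qed.

Lemma dist_to_ge0 (C : set 'cV[R]_e.+3) x : C !=set0 -> 0 <= dist_to C x.
Proof. by case=> z Cz; apply: lb_le_inf (@dist_to_lb C x); exists `|x - z|, z. Qed.

Lemma dist_to_sub (C : set 'cV[R]_e.+3) x y : C !=set0 ->
  dist_to C x <= `|x - y| + dist_to C y.
Proof.
case=> z0 Cz0; rewrite -lerBlDl; apply: lb_le_inf; first by exists `|y - z0|, z0.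
move=> _ [z Cz <-]; rewrite lerBlDl; apply: le_trans (dist_to_le _ Cz) _.
by rewrite -(subrKA y) ler_normD.
Qed.

Lemma dist_to_gt0 (C : set 'cV[R]_e.+3) x : C !=set0 -> open (~` C) -> ~ C x ->
  0 < dist_to C x.
Proof.
case=> z0 Cz0 oC Cx.
have /nbhs_ballP[eps ep hb] : nbhs x (~` C) by apply: open_nbhs_nbhs.
apply: lt_le_trans ep _; apply: lb_le_inf; first by exists `|x - z0|, z0.
move=> _ [z Cz <-]; rewrite leNgt; apply/negP => xz; apply: (hb z) => //.
by rewrite mx_norm_ball.
Qed.

(** These functions increase to the indicator of the complement of C when C is
    closed. *)
Lemma lip_urysohn (C : set 'cV[R]_e.+3) n : C !=set0 ->
  lip n.+1%:R (fun x => Num.min 1 (n.+1%:R * dist_to C x)).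
Proof.
move=> C0 x y; have h1 := dist_to_sub x y C0; have := dist_to_sub y x C0.
rewrite distrC => h2; have n0 : 0 <= n.+1%:R :> R by [].
have : `|n.+1%:R * dist_to C x - n.+1%:R * dist_to C y| <= n.+1%:R * `|x - y|.
  by rewrite -mulrBr normrM ger0_norm// ler_wpM2l// ler_norml; apply/andP; split; lra.
apply: le_trans; move: (n.+1%:R * dist_to C x) (n.+1%:R * dist_to C y) => a b.
case: (lerP 1 a) => ha; case: (lerP 1 b) => hb //; first by rewrite subrr normr0.
  rewrite ger0_norm ?subr_ge0 ?(ltW hb)//; apply: le_trans (ler_norm _).
  by rewrite lerB.
rewrite distrC (distrC a) ger0_norm ?subr_ge0 ?(ltW ha)//; apply: le_trans (ler_norm _).
by rewrite lerB.
Qed.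

End Lipschitz.

Import HBSimple HBNNSimple.

Section Density.
Variables (R : realType) (e : nat).
Variables (mu : probability (borel_vec R e.+3) R) (nu : probability (borel_vec R e.+2) R).
Hypotheses (hmu : rotation_invariant mu) (hnu : rotation_invariant nu).
Let i0 : 'I_e.+3 := ord_max.
Let i1 : 'I_e.+2 := ord_max.
Variable g : 'cV[R]_e.+3 -> 'M[R]_e.+3.
Hypothesis hg : forall u, dot u u = 1 ->
  SOgroup R e.+3 (g u) /\ g u *m unit_vec R e.+3 i0 = u.
Hypothesis Tnu : forall v : 'cV[R]_e.+2, dot v v = 1 ->
  exists2 h, SOgroup R e.+2 h & h *m unit_vec R e.+2 i1 = v.
Hypothesis Hnu : forall N, exists s (pt : 'I_s -> 'cV[R]_e.+2) w,
  (forall r, dot (pt r) (pt r) = 1) /\ quadrature nu N pt w.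
Hypothesis Hmu : forall N, exists s (pt : 'I_s -> 'cV[R]_e.+3) (w : 'I_s -> R),
  [/\ (forall r, dot (pt r) (pt r) = 1), (forall r, 0 <= w r) & quadrature mu N pt w].
Let mu1 : mu (sphere R e.+3) = 1%E := hmu.1.
Let S : set (borel_vec R e.+3) := sphere R e.+3.
Implicit Types (x y z : 'cV[R]_e.+3) (f h : 'cV[R]_e.+3 -> R).
Notation dens := (dens mu nu).

Lemma dens_dct f (h : nat -> 'cV[R]_e.+3 -> R) G :
  (forall n, dens (h n)) -> measurable_fun S (f : borel_vec R e.+3 -> R) ->
  L2s mu G -> (forall n x, sphere R e.+3 x -> `|h n x| <= G x) ->
  (forall x, sphere R e.+3 x -> (h n x) @[n --> \oo] --> f x) -> dens f.
Proof.
move=> hd mf hG hdom hcvg.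
have [Lf hf] := mean_sqr_dct (fun n => (hd n).1) mf hG hdom hcvg.
apply: (dens_lim hmu hnu hg Tnu Hnu Hmu Lf) => eps e0.
by have [n hn] := hf eps e0; exists (h n).
Qed.

Lemma dens_cst c : dens (fun=> c).
Proof.
apply: (dens_dot_uniform hmu hnu hg Tnu Hnu Hmu); first exact: bmf_cst.
by move=> eps e0; exists 0 => // x y _ _; rewrite subrr normr0 mul0r addr0 ltW.
Qed.

Lemma dens_open (U : set 'cV[R]_e.+3) : open U -> dens \1_U.
Proof.
move=> oU; have [UT|/existsNP[z0 Uz0]] := pselect (forall x, U x).
  suff -> : \1_U = (fun=> 1) :> ('cV[R]_e.+3 -> R) by exact: dens_cst.
  by apply/funext => x; rewrite indicE mem_set.
pose C := ~` U; have C0 : C !=set0 by exists z0.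
have oC : open (~` C) by rewrite setCK.
pose u n x : R := Num.min 1 (n.+1%:R * dist_to C x).
have u0 n x : 0 <= u n x by rewrite le_min ler01 mulr_ge0// dist_to_ge0.
have u1 n x : u n x <= 1 by rewrite ge_min lexx.
have n0 n : 0 < n.+1%:R :> R by [].
have du n : dens (u n).
  apply: (dens_dot_uniform hmu hnu hg Tnu Hnu Hmu); last first.
    exact: lip_dot_uniform (n0 n) (@lip_urysohn R e C n C0).
  split; last by exists 1 => x _; rewrite ger0_norm.
  by apply: continuous_borel; exact: lip_continuous (n0 n) (@lip_urysohn R e C n C0).
refine (@dens_dct _ u (fun=> 1) du _ (bmf_L2 mu1 (bmf_cst _ 1)) _ _).
- by apply: measurable_indic; exact: sub_sigma_algebra.
- by move=> n x _; rewrite ger0_norm.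
move=> x _; rewrite indicE; have [Ux|nUx] := pselect (U x).
  have d0 : 0 < dist_to C x by apply: dist_to_gt0 => //; apply.
  rewrite mem_set//; apply: cvg_near_cst.
  exists (Num.truncn (dist_to C x)^-1) => // n /= hn.
  rewrite /u; apply/min_idPl.
  rewrite -ler_pdivrMr// div1r (le_trans (ltW (Num.Theory.truncnS_gt _)))//.
  by rewrite ler_nat.
rewrite memNset//; apply: cvg_near_cst; apply: nearW => n.
rewrite /u; have -> : dist_to C x = 0.
  apply/eqP; rewrite eq_le dist_to_ge0// andbT.
  by rewrite (le_trans (@dist_to_le _ _ C x x nUx))// subrr normr0.
by rewrite mulr0; apply/min_idPr.
Qed.

Lemma dens_sum (I : Type) (r : seq I) (F : I -> 'cV[R]_e.+3 -> R) :
  (forall i, dens (F i)) -> dens (fun x => \sum_(i <- r) F i x).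
Proof.
move=> dF; elim: r => [|i r IH].
  by under eq_fun do rewrite big_nil; exact: dens_cst.
under eq_fun do rewrite big_cons.
exact: (densD hmu hnu hg Tnu Hnu Hmu (dF i) IH).
Qed.

(** Open sets form a pi-system that generates the Borel sets, and the sets
    whose indicator is approximable form a lambda-system. *)
Lemma dens_indic (A : set (borel_vec R e.+3)) : measurable A ->
  dens (\1_A : 'cV[R]_e.+3 -> R).
Proof.
move=> mA; apply: (@dynkin_induction _ (borel_vec R e.+3) (@open 'cV[R]_e.+3)
  (fun A => dens (\1_A : 'cV[R]_e.+3 -> R)) erefl _ _ _ _ _ A mA).
- by move=> U V; exact: openI.
- suff -> : (\1_[set: borel_vec R e.+3]) = (fun=> 1) :> ('cV[R]_e.+3 -> R) by exact: dens_cst.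
  by apply/funext => x; rewrite indicE in_setT.
- by move=> U; exact: dens_open.
- move=> {mA}A _ dA.
  have := densD hmu hnu hg Tnu Hnu Hmu (dens_cst 1) (densZ hmu hnu hg Tnu Hnu Hmu (-1) dA).
  congr dens; apply/funext => x; rewrite !indicE in_setC.
  by case: (x \in A); rewrite /= ?mulr1 ?subrr// mulr0 addr0.
move=> F mF tF dF.
have FE x k0 k : F k0 x -> \1_(F k) x = (k0 == k)%:R :> R.
  move=> Fx; rewrite indicE; case: eqVneq => [<-|nk]; first by rewrite mem_set.
  rewrite memNset// => Fk; move/eqP: nk; apply.
  by apply: (tF k0 k) => //; exists x.
pose s n x : R := \sum_(k <- iota 0 n) \1_(F k) x.
have sE n x k0 : F k0 x -> s n x = (k0 < n)%N%:R.
  move=> Fx; rewrite /s; under eq_bigr do rewrite (FE x k0)//.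
  have [kn|kn] := ltnP k0 n.
    rewrite (bigD1_seq k0) ?iota_uniq ?mem_iota//= eqxx big1 ?addr0// => i /negPf.
    by rewrite eq_sym => ->.
  rewrite big_seq big1// => i; rewrite mem_iota/= add0n => /leq_trans/(_ kn).
  by rewrite ltn_neqAle eq_sym => /andP[/negPf ->].
have sE0 n x : ~ (\bigcup_k F k) x -> s n x = 0.
  move=> nF; rewrite /s big1// => k _; rewrite indicE memNset// => Fx.
  by apply: nF; exists k.
refine (@dens_dct _ s (fun=> 1) _ _ _ _ _).
- by move=> n; exact: dens_sum.
- by apply: measurable_indic; exact: bigcupT_measurable.
- exact/(bmf_L2 mu1)/bmf_cst.
- move=> n x _; have [[k0 _ Fx]|nF] := pselect ((\bigcup_k F k) x).
    by rewrite (sE _ _ k0)//; case: ltnP; rewrite ?normr1 ?normr0.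
  by rewrite sE0// normr0.
move=> x _; rewrite indicE; have [[k0 _ Fx]|nF] := pselect ((\bigcup_k F k) x).
  rewrite mem_set; last by exists k0.
  by apply: cvg_near_cst; exists k0.+1 => // n /= hn; rewrite (sE _ _ k0)// hn.
by rewrite memNset//; apply: cvg_near_cst; apply: nearW => n; exact: sE0.
Qed.

Lemma dens_nonneg f : L2s mu f -> (forall x, sphere R e.+3 x -> 0 <= f x) -> dens f.
Proof.
move=> hf f0; have [mf _] := hf.
have mS : measurable S by exact: measurable_sphere.
have mF : measurable_fun S (EFin \o (f : borel_vec R e.+3 -> R)) by exact/measurable_EFinP.
have F0 x : S x -> (0 <= (EFin \o (f : borel_vec R e.+3 -> R)) x)%E.
  by move=> Sx; rewrite lee_fin f0.
pose a (n : nat) : borel_vec R e.+3 -> R := nnsfun_approx mS mF n.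
refine (@dens_dct f a f _ mf hf _ _).
- move=> n; have -> : a n = _ := funext (fimfunEord (nnsfun_approx mS mF n)).
  apply: dens_sum => i; apply: (densZ hmu hnu hg Tnu Hnu Hmu).
  by apply: dens_indic; exact: measurable_funPTI.
- move=> n x Sx; rewrite /a ger0_norm//.
  have := @le_approx _ (borel_vec R e.+3) R S (EFin \o (f : borel_vec R e.+3 -> R)) n x F0 Sx.
  by rewrite -(nnsfun_approxE mS mF) lee_fin.
move=> x Sx; have := cvg_nnsfun_approx mS mF F0 Sx.
by move=> /fine_cvgP[].
Qed.

Lemma L2_dens f : L2s mu f -> dens f.
Proof.
move=> hf; have mS : measurable S by exact: measurable_sphere.
have pos h : L2s mu h -> dens (fun x => Num.max (h x) 0).
  move=> hh; apply: dens_nonneg => [|x _]; last by rewrite le_max lexx orbT.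
  have mm : measurable_fun S ((fun x => Num.max (h x) 0) : borel_vec R e.+3 -> R).
    by apply: measurable_maxr; [exact: hh.1|exact: measurable_cst].
  split => //; apply: le_integrable hh.2 => //.
    by apply/measurable_EFinP; exact: measurable_funX.
  move=> x _ /=; rewrite lee_fin !normrX lerXn2r ?nnegrE//.
  by case: (lerP (h x) 0) => //; rewrite normr0.
have := densD hmu hnu hg Tnu Hnu Hmu (pos _ hf)
  (densZ hmu hnu hg Tnu Hnu Hmu (-1) (pos _ (L2N hf))).
congr dens; apply/funext => x; case: (lerP (f x) 0) => fx.
  by rewrite max_l ?oppr_ge0// add0r mulN1r opprK.
by rewrite max_r ?oppr_le0 1?ltW// mulr0 addr0.
Qed.

End Density.

(** * The energy of a dyadic level *)

Lemma big_oo_finite (R : realType) (F : nat -> R) N : (forall n, (N <= n)%N -> F n = 0) ->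
  \big[+%R/0]_(0 <= n <oo) F n = \sum_(n < N) F n.
Proof.
move=> F0; apply: lim_near_cst => //; exists N => // n /= Nn.
rewrite (@big_cat_nat _ _ _ N)//= [X in _ + X]big_nat_cond [X in _ + X]big1 ?addr0 ?big_mkord// => k.
by rewrite andbT => /andP[Nk _]; exact: F0.
Qed.

Section Window.
Variables (R : realType) (phi : R -> R).
Hypotheses (phi_noninc : forall s t : R, 0 <= s -> s <= t -> phi t <= phi s)
  (phi1 : forall t : R, 0 <= t -> t <= 2^-1 -> phi t = 1)
  (phi0 : forall t : R, 1 <= t -> phi t = 0).

Lemma phi_ge0 t : 0 <= t -> 0 <= phi t.
Proof.
move=> t0; have t1 : t <= Num.max t 1 by rewrite le_max lexx.
by have := phi_noninc t0 t1; rewrite phi0// le_max lexx orbT.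
Qed.

Lemma phi_le1 t : 0 <= t -> phi t <= 1.
Proof. by move=> t0; have := phi_noninc (lexx 0) t0; rewrite (phi1 (lexx 0))// invr_ge0. Qed.

Lemma kappa_sq t : 0 <= t -> kappa phi t ^+ 2 = phi (t / 2) ^+ 2 - phi t ^+ 2.
Proof.
move=> t0; rewrite sqr_sqrtr// subr_ge0 lerXn2r// ?nnegrE ?phi_ge0 ?divr_ge0//.
by apply: phi_noninc; rewrite ?divr_ge0//; lra.
Qed.

(** The squared windows of consecutive levels telescope. *)
Lemma kappa_dyadic j n : kappa phi (n%:R / 2 ^+ j) ^+ 2 =
  phi (n%:R / 2 ^+ j.+1) ^+ 2 - phi (n%:R / 2 ^+ j) ^+ 2.
Proof.
by rewrite kappa_sq ?divr_ge0 ?exprn_ge0//; congr (phi _ ^+ 2 - _); rewrite exprSr invfM mulrA.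
Qed.

Lemma phi_dyadic0 j n : (2 ^ j <= n)%N -> phi (n%:R / 2 ^+ j) = 0.
Proof.
by move=> jn; rewrite phi0// ler_pdivlMr ?exprn_gt0// mul1r -natrX ler_nat.
Qed.

Lemma phi_dyadic1 j n : (n <= 2 ^ j)%N -> phi (n%:R / 2 ^+ j.+1) = 1.
Proof.
move=> jn; apply: phi1; first by rewrite divr_ge0 ?exprn_ge0.
rewrite ler_pdivrMr ?exprn_gt0// exprS mulrA mulVf ?pnatr_eq0// mul1r.
by rewrite -natrX ler_nat.
Qed.

Lemma kappa_dyadic0 j n : (2 ^ j.+1 <= n)%N -> kappa phi (n%:R / 2 ^+ j) = 0.
Proof.
move=> jn; apply/eqP; rewrite -sqrf_eq0 kappa_dyadic !phi_dyadic0 ?expr0n ?subrr//.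
by apply: leq_trans jn; rewrite leq_exp2l.
Qed.

Lemma kappa0 j : kappa phi (0%:R / 2 ^+ j) = 0.
Proof.
apply/eqP; rewrite -sqrf_eq0 kappa_dyadic phi_dyadic1// mul0r.
by rewrite phi1 ?expr1n ?subrr ?invr_ge0.
Qed.

End Window.

Section Curvelet.
Variables (R : realType) (e : nat).
Variables (mu : probability (borel_vec R e.+3) R) (nu : probability (borel_vec R e.+2) R).
Hypotheses (hmu : rotation_invariant mu) (hnu : rotation_invariant nu).
Let i0 : 'I_e.+3 := ord_max.
Let i1 : 'I_e.+2 := ord_max.
Variable g : 'cV[R]_e.+3 -> 'M[R]_e.+3.
Hypothesis hg : forall u, dot u u = 1 ->
  SOgroup R e.+3 (g u) /\ g u *m unit_vec R e.+3 i0 = u.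
Hypothesis Tnu : forall v : 'cV[R]_e.+2, dot v v = 1 ->
  exists2 h, SOgroup R e.+2 h & h *m unit_vec R e.+2 i1 = v.
Hypothesis Hnu : forall N, exists s (pt : 'I_s -> 'cV[R]_e.+2) w,
  (forall r, dot (pt r) (pt r) = 1) /\ quadrature nu N pt w.
Hypothesis Hmu : forall N, exists s (pt : 'I_s -> 'cV[R]_e.+3) (w : 'I_s -> R),
  [/\ (forall r, dot (pt r) (pt r) = 1), (forall r, 0 <= w r) & quadrature mu N pt w].
Let mu1 : mu (sphere R e.+3) = 1%E := hmu.1.
Implicit Types (x y z : 'cV[R]_e.+3) (f : 'cV[R]_e.+3 -> R).
Variable h : 'cV[R]_e.+2 -> 'M[R]_e.+3.
Hypothesis hh : forall v, dot v v = 1 ->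
  SOstab R e.+3 (h v) /\ h v *m unit_vec R e.+3 e.+1 = @embed0 R e.+3 v.
Variable phi : R -> R.
Hypotheses (phi_noninc : forall s t : R, 0 <= s -> s <= t -> phi t <= phi s)
  (phi1 : forall t : R, 0 <= t -> t <= 2^-1 -> phi t = 1)
  (phi0 : forall t : R, 1 <= t -> phi t = 0).
Variables (rn sn : nat -> nat)
    (eta : forall j, 'I_(rn j) -> 'cV[R]_e.+3)
    (eta' : forall j, 'I_(sn j) -> 'cV[R]_e.+2)
    (w : forall j, 'I_(rn j) -> R) (w' : forall j, 'I_(sn j) -> R).
Arguments eta : clear implicits.
Arguments eta' : clear implicits.
Arguments w : clear implicits.
Arguments w' : clear implicits.
Hypotheses (eta1 : forall j r, dot (eta j r) (eta j r) = 1)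
    (eta'1 : forall j s, dot (eta' j s) (eta' j s) = 1)
    (w_gt0 : forall j r, 0 < w j r)
    (w'_gt0 : forall j s, 0 < w' j s)
    (hquad : forall j, (0 < j)%N -> quadrature mu (2 ^ j.+1) (eta j) (w j))
    (hquad' : forall j, (0 < j)%N -> quadrature nu (2 ^ j.+1) (eta' j) (w' j))
    (rn0 : rn 0%N = 1%N) (sn0 : sn 0%N = 1%N)
    (w0 : forall r : 'I_(rn 0%N), w 0%N r = 1)
    (w'0 : forall s : 'I_(sn 0%N), w' 0%N s = 1).
Notation dimH := (@dimH R e.+3).
Notation geg := (geg nu).
Notation A n := (@A_const R e.+3 n).

Definition wave_coef j n : R := Num.sqrt (dimH n) * kappa phi (n%:R / 2 ^+ j.-1) * A n.

(** The rotated, weighted curvelets are real and are finite combinations of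
    waves: the window cuts the series off at degree 2^j. *)
Definition rcurvelet j r s x : R :=
  if j == 0%N then 1 else
  Num.sqrt (w j r * w' j s) * (Num.sqrt 2 *
    \sum_(n < 2 ^ j) wave_coef j n * frame_wave g (eta j) (eta' j) n r s x).
Arguments rcurvelet : clear implicits.

Lemma invmx_SO (m : nat) (G : 'M[R]_m) : SOgroup R m G -> invmx G = G^T.
Proof.
move=> [G1 _]; have [uG _] := mulmx1_unit G1.
by rewrite -[LHS]mulmx1 -G1 mulmxA mulVmx ?mul1mx.
Qed.

Lemma coordn_dot m (x : 'cV[R]_m) k (km : (k < m)%N) : coordn x k = dot (unit_vec R m k) x.
Proof.
rewrite /coordn; case: insubP => [i _ ik|]; last by rewrite km.
by rewrite -ik dotC dot_unit_vec.
Qed.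

(** Only the last two coordinates of (g h)^-1 x enter the series. By
    orthogonality they are the inner products of x with the images under g h of
    the last two basis vectors e^(d-1) and e^d, and h fixes e^d. *)
Lemma curvelet_rotE j r s x :
  curvelet_rot phi g h j (w j r) (w' j s) (eta j r) (eta' j s) x = (rcurvelet j r s x)%:C.
Proof.
rewrite /curvelet_rot /rotate /curvelet /rcurvelet; case: (eqVneq j 0%N) => [j0|j0].
  by move: r s; rewrite j0 => r s; rewrite w0 w'0 mulr1 sqrtr1 mul1r.
rewrite -rmorphM/=; congr (_ * _)%:C; rewrite /curvelet_series; congr (_ * _).
have [[G1 Gd] Ge] := hg (eta1 r).
have [[[H1 Hd] He] Hu] := hh (eta'1 s).
set G := g _ *m _.
have SG : SOgroup R e.+3 G.
  split; last by rewrite det_mulmx Gd Hd mulr1.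
  by rewrite /G trmx_mul mulmxA -(mulmxA _ _ (h _)^T) H1 mulmx1.
rewrite invmx_SO//.
have c1 : coordn (G^T *m x) e.+2 = dot (eta j r) x.
  by rewrite coordn_dot// -dot_mulmx /G -mulmxA He Ge.
have c2 : coordn (G^T *m x) e.+1 = dot (zeta g (eta j r) (eta' j s)) x.
  by rewrite coordn_dot// -dot_mulmx /G -mulmxA Hu.
rewrite (@big_oo_finite _ _ (2 ^ j)).
  by apply: eq_bigr => n _; rewrite c1 c2.
move=> n jn; have -> : kappa phi (n%:R / 2 ^+ j.-1) = 0; last by rewrite mulr0 !mul0r.
by case: (j) j0 jn => // k _; exact: (kappa_dyadic0 phi_noninc phi0).
Qed.

Lemma bmf_rcurvelet j r s : bmf (rcurvelet j r s).
Proof.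
rewrite /rcurvelet; case: eqP => _; first exact: bmf_cst.
by do 2!apply: bmfZ; apply: bmf_sum => n; apply: bmfZ; exact: bmf_wave.
Qed.

(** The kernel of the sum of the levels 0 to j. *)
Definition level_poly j : {poly R} :=
  \sum_(n < 2 ^ j) phi (n%:R / 2 ^+ j) ^+ 2 *: (dimH n *: geg n).

Lemma A_sq_neq0 n : A n ^+ 2 != 0.
Proof.
rewrite A_const_sq// gt_eqF// divr_gt0 ?ltr0n ?fact_gt0//.
by apply: prodr_gt0 => i _; rewrite ltr_wpDr// divr_gt0.
Qed.

(** The degrees that occur are below 2^j, so that products have degree below
    2^(j+1), where the quadratures are exact: the different degrees decouple,
    and the constant A_n is exactly what turns the factor of the degree n into
    dim H_n. At degree 0, where that factor would be different, the window
    vanishes. *)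
Lemma rcurvelet_kernel j x y : (0 < j)%N -> dot x x = 1 -> dot y y = 1 ->
  \sum_(r < rn j) \sum_(s < sn j) rcurvelet j r s x * rcurvelet j r s y =
  (level_poly j - level_poly j.-1).[dot x y].
Proof.
move=> j0 x1 y1.
pose c := wave_coef j.
pose U n r s z := frame_wave g (eta j) (eta' j) n r s z.
transitivity (\sum_(n < 2 ^ j) \sum_(m < 2 ^ j) 2 * (c n * c m) *
    wave_kernel g (eta j) (w j) (eta' j) (w' j) n m x y).
  transitivity (\sum_(r < rn j) \sum_(s < sn j) \sum_(n < 2 ^ j) \sum_(m < 2 ^ j)
     2 * (c n * c m) * (w j r * w' j s * (U n r s x * U m r s y))).
    apply: eq_bigr => r _; apply: eq_bigr => s _.
    rewrite /rcurvelet gtn_eqF//.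
    set X := \sum_(n < 2 ^ j) wave_coef j n * frame_wave _ _ _ n r s x.
    set Y := \sum_(n < 2 ^ j) wave_coef j n * frame_wave _ _ _ n r s y.
    transitivity (Num.sqrt (w j r * w' j s) ^+ 2 * (Num.sqrt 2 ^+ 2 * (X * Y))).
      by move: (Num.sqrt _) (Num.sqrt _) X Y => *; ring.
    rewrite !sqr_sqrtr ?mulr_ge0 ?(ltW (w_gt0 _))  ?(ltW (w'_gt0 _))//.
    rewrite big_distrlr/= !mulr_sumr; apply: eq_bigr => n _.
    rewrite !mulr_sumr; apply: eq_bigr => m _.
    rewrite /c /U; move: (wave_coef j n) (wave_coef j m) => cn cm.
    move: (frame_wave _ _ _ n r s x) (frame_wave _ _ _ m r s y) (w j r) (w' j s) => *.
    by ring.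
  rewrite /wave_kernel.
  under eq_bigr do rewrite exchange_big/=; rewrite exchange_big/=.
  apply: eq_bigr => n _.
  under eq_bigr do rewrite exchange_big/=; rewrite exchange_big/=.
  apply: eq_bigr => m _.
  by rewrite mulr_sumr; apply: eq_bigr => r _; rewrite mulr_sumr.
transitivity (\sum_(n < 2 ^ j) kappa phi (n%:R / 2 ^+ j.-1) ^+ 2 * (dimH n * (geg n).[dot x y])).
  apply: eq_bigr => -[n nj] _ /=.
  case: n nj => [|n] nj.
    rewrite (kappa0 phi_noninc phi1 phi0) expr0n mul0r big1// => m _.
    by rewrite /c {1}/wave_coef (kappa0 phi_noninc phi1 phi0) mulr0 !mul0r mulr0 mul0r.
  have K m : (m < 2 ^ j)%N -> wave_kernel g (eta j) (w j) (eta' j) (w' j) n.+1 m x y =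
     if n.+1 == m then (2 * A m ^+ 2)^-1 * (geg m).[dot x y] else 0.
    move=> mj; rewrite (wave_kernelE hmu hnu hg Tnu Hnu (@eta1 j) (@eta'1 j) (hquad j0) (hquad' j0))//.
      by case: eqP => [->|].
    by rewrite expnS mul2n -addnn leq_add// ltnW.
  rewrite (bigD1 (Ordinal nj))//= K// eqxx big1 ?addr0.
    rewrite /c /wave_coef.
    rewrite -[in RHS](sqr_sqrtr (ltW (dimH_gt0 R e n.+1))).
    have := A_sq_neq0 n.+1; move: (A _) (Num.sqrt _) (kappa _ _) (geg _).[_] => a d k q a0.
    by field; move: a0; rewrite sqrf_eq0.
  move=> m mn; rewrite K//; case: eqP => [nm|]; last by rewrite mulr0.
  by case/eqP: mn; apply: val_inj.
case: j {c U} j0 => // j _.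
rewrite /level_poly hornerD hornerN !horner_sum /=.
have -> : \sum_(n < 2 ^ j) (phi (n%:R / 2 ^+ j) ^+ 2 *: (dimH n *: geg n)).[dot x y] =
   \sum_(n < 2 ^ j.+1) (phi (n%:R / 2 ^+ j) ^+ 2 *: (dimH n *: geg n)).[dot x y].
  rewrite (big_ord_widen_cond (2 ^ j.+1) xpredT (fun n => (phi (n%:R / 2 ^+ j) ^+ 2 *: (dimH n *: geg n)).[dot x y])); last by rewrite leq_exp2l.
  rewrite [RHS](bigID (fun n : 'I_(2 ^ j.+1) => (n < 2 ^ j)%N))/= [X in _ + X]big1 ?addr0//.
  by move=> n; rewrite -leqNgt => nj; rewrite (phi_dyadic0 phi0)// expr0n scale0r horner0.
rewrite -sumrB; apply: eq_bigr => n _.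
by rewrite !hornerZ (kappa_dyadic phi_noninc phi0) mulrBl.
Qed.

Definition energy j f : R :=
  \sum_(r < rn j) \sum_(s < sn j) mean mu (fun x => f x * rcurvelet j r s x) ^+ 2.

Lemma energyE j p f : L2s mu f ->
  (forall x y, dot x x = 1 -> dot y y = 1 -> p.[dot x y] =
    \sum_(r < rn j) \sum_(s < sn j) rcurvelet j r s x * rcurvelet j r s y) ->
  energy j f = zform mu p f.
Proof.
move=> hf hp; rewrite (@zformE _ _ _ hmu ('I_(rn j) * 'I_(sn j))%type (fun=> 1)
  (fun rs => rcurvelet j rs.1 rs.2))//.
- by rewrite /energy pair_bigA/=; apply: eq_bigr => rs _; rewrite mul1r.
- by move=> rs; exact: bmf_rcurvelet.
by move=> x y x1 y1; rewrite hp// pair_bigA/=; apply: eq_bigr => rs _; rewrite mul1r.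
Qed.

Lemma energy0 f : L2s mu f -> energy 0 f = zform mu (level_poly 0) f.
Proof.
move=> hf; apply: energyE => // x y x1 y1.
have -> : \sum_(r < rn 0) \sum_(s < sn 0) rcurvelet 0 r s x * rcurvelet 0 r s y = 1.
  rewrite /rcurvelet/=; under eq_bigr do rewrite mulr1 sumr_const card_ord sn0.
  by rewrite sumr_const card_ord rn0.
rewrite /level_poly big_ord1 /= mul0r phi1 ?invr_ge0// expr1n scale1r hornerZ.
have /size1_polyC gC : (size (geg 0) <= 1)%N by exact: size_geg.
have := geg1 hnu 0; rewrite gC !hornerC => ->.
rewrite dimHE !muln0 !add0n muln1 factS natrM mulfV ?mul1r//.
Qed.

Lemma energyS j f : L2s mu f ->
  energy j.+1 f = zform mu (level_poly j.+1) f - zform mu (level_poly j) f.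
Proof.
move=> hf; rewrite (@energyE _ (level_poly j.+1 - level_poly j))//; last first.
  by move=> x y x1 y1; rewrite rcurvelet_kernel.
rewrite -scaleN1r (zformD hmu hnu hg Tnu Hnu Hmu)// (zformZ hmu hnu hg Tnu Hnu Hmu)//.
by rewrite mulN1r.
Qed.

Lemma energy_sum J f : L2s mu f -> \sum_(j < J.+1) energy j f = zform mu (level_poly J) f.
Proof.
move=> hf; elim: J => [|J IH]; first by rewrite big_ord1 energy0.
transitivity (\sum_(j < J.+1) energy j f + energy J.+1 f); first exact: big_ord_recr.
have telescope (a b c z : R) : a = b -> c = z - b -> a + c = z.
  by move=> -> ->; rewrite addrC subrK.
exact: telescope IH (energyS J hf).
Qed.

Lemma level_polyE J f : L2s mu f -> zform mu (level_poly J) f =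
  \sum_(n < 2 ^ J) phi (n%:R / 2 ^+ J) ^+ 2 * zform mu (dimH n *: geg n) f.
Proof.
move=> hf; rewrite (zform_sum hmu hnu hg Tnu Hnu Hmu)//; apply: eq_bigr => n _.
by rewrite (zformZ hmu hnu hg Tnu Hnu Hmu).
Qed.

Lemma level_poly_le J f : L2s mu f -> zform mu (level_poly J) f <= sq mu f.
Proof.
move=> hf; apply: (@le_trans _ _ (zform mu (kern nu (2 ^ J)) f)); last first.
  by have := res_ge0 mu nu (2 ^ J) f; rewrite (resE hmu hnu hg Tnu Hnu Hmu)// subr_ge0.
rewrite level_polyE// (zform_sum hmu hnu hg Tnu Hnu Hmu)//; apply: ler_sum => n _.
rewrite ler_piMl ?(zform_geg_ge0 hmu hnu hg Tnu Hnu Hmu)//.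
have n0 : 0 <= n%:R / 2 ^+ J :> R by rewrite divr_ge0 ?exprn_ge0.
by rewrite exprn_ile1// ?(phi_ge0 phi_noninc phi0)// (phi_le1 phi_noninc phi1).
Qed.

(** The window is 1 on the lower half of the degrees. *)
Lemma level_poly_ge J f : L2s mu f ->
  zform mu (kern nu (2 ^ J)) f <= zform mu (level_poly J.+1) f.
Proof.
move=> hf; rewrite level_polyE// (zform_sum hmu hnu hg Tnu Hnu Hmu)//.
pose F n := phi (n%:R / 2 ^+ J.+1) ^+ 2 * zform mu (dimH n *: geg n) f.
rewrite (eq_bigr (fun n : 'I_(2 ^ J) => F n)); last first.
  move=> n _; rewrite /F (phi_dyadic1 phi1) ?expr1n ?mul1r//.
  exact: ltnW.
have le2 : (2 ^ J <= 2 ^ J.+1)%N by rewrite leq_exp2l.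
rewrite (big_ord_widen_cond _ xpredT F le2)/=.
rewrite [leRHS](bigID (fun n : 'I_(2 ^ J.+1) => (n < 2 ^ J)%N))/= lerDl.
apply: sumr_ge0 => n _; rewrite mulr_ge0 ?sqr_ge0//.
exact: (zform_geg_ge0 hmu hnu hg Tnu Hnu Hmu).
Qed.

Lemma energy_le J f : L2s mu f -> \sum_(j < J) energy j f <= sq mu f.
Proof.
case: J => [|J] hf; first by rewrite big_ord0 sq_ge0.
by rewrite energy_sum// level_poly_le.
Qed.

Lemma energy_lim f (eps : R) : L2s mu f -> 0 < eps ->
  exists J, sq mu f - eps <= \sum_(j < J) energy j f.
Proof.
move=> hf e0; have [_ /(_ _ e0)[N hN]] := L2_dens hmu hnu hg Tnu Hnu Hmu hf.
exists N.+2; rewrite energy_sum//; apply: le_trans (level_poly_ge N hf).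
have := res_antitone hmu hnu hg Tnu Hnu Hmu (ltnW (ltn_expl N (ltnSn 1))) hf.
move=> /le_trans/(_ hN); rewrite (resE hmu hnu hg Tnu Hnu Hmu (2 ^ N) hf).
by rewrite lerBlDr -lerBlDl.
Qed.

End Curvelet.

(** * Parseval frames of real functions *)

Lemma sum_uniq_le (R : realType) (I : eqType) (F : I -> R) (s t : seq I) :
  (forall i, 0 <= F i) -> uniq s -> uniq t -> {subset s <= t} ->
  \sum_(i <- s) F i <= \sum_(i <- t) F i.
Proof.
move=> F0 us ut st; rewrite [leRHS](bigID (mem s))/=.
have pst : perm_eq s [seq i <- t | i \in s].
  apply: uniq_perm => //; first exact: filter_uniq.
  by move=> i; rewrite mem_filter; case: (boolP (i \in s)) => // /st ->.
by rewrite (perm_big _ pst) big_filter lerDl sumr_ge0.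
Qed.

Section RealFrame.
Variables (R : realType) (e : nat) (mu : probability (borel_vec R e.+3) R).
Hypothesis mu1 : mu (sphere R e.+3) = 1%E.
Variables (I : choiceType) (psi : I -> 'cV[R]_e.+3 -> R).
Hypothesis Lpsi : forall i, L2s mu (psi i).
Let S : set (borel_vec R e.+3) := sphere R e.+3.
Implicit Types (u v : 'cV[R]_e.+3 -> R) (f : 'cV[R]_e.+3 -> R[i]) (s : seq I).
Notation sq := (sq mu).
Notation mean := (mean mu).

Definition coef u i : R := mean (fun x => u x * psi i x).

Definition partial u s x : R := \sum_(i <- s) coef u i * psi i x.

(** Parseval's identity for real functions, split into inequalities for
    finite families of indices. *)
Hypothesis bessel : forall u s, L2s mu u -> uniq s -> \sum_(i <- s) coef u i ^+ 2 <= sq u.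
Hypothesis exhaust : forall u (eps : R), L2s mu u -> 0 < eps ->
  exists2 s, uniq s & sq u - eps <= \sum_(i <- s) coef u i ^+ 2.

Let L1c u i : L2s mu u -> L1s mu (fun x => u x * psi i x).
Proof. by move=> hu; apply: L2_L1M. Qed.

Lemma L2_partial u s : L2s mu (partial u s).
Proof. by apply: (L2_sum mu1) => i; exact: L2Z. Qed.

Lemma mean_partial u v s : L2s mu v ->
  mean (fun x => v x * partial u s x) = \sum_(i <- s) coef u i * coef v i.
Proof.
move=> hv; transitivity (mean (fun x => \sum_(i <- s) coef u i * (v x * psi i x))).
  by apply: eq_mean => x _; rewrite mulr_sumr; apply: eq_bigr => i _; rewrite mulrCA.
rewrite (mean_sum mu1); last by move=> i; apply: L1Z; exact: L1c.
by apply: eq_bigr => i _; rewrite meanZ//; exact: L1c.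
Qed.

(** The synthesis operator is the adjoint of the analysis operator, and has
    norm at most 1 with it. Apply Bessel's inequality to the partial sum
    itself, whose squared norm is the sum of the products of the two families
    of coefficients. *)
Lemma sq_partial u s : uniq s -> sq (partial u s) <= \sum_(i <- s) coef u i ^+ 2.
Proof.
move=> us; have hp := L2_partial u s.
have spE : sq (partial u s) = \sum_(i <- s) coef u i * coef (partial u s) i.
  by rewrite -mean_partial//; apply: eq_mean => x _; rewrite expr2.
have := bessel hp us.
have : sq (partial u s) <= \sum_(i <- s) (2^-1 * coef u i ^+ 2 + 2^-1 * coef (partial u s) i ^+ 2).
  rewrite spE; apply: ler_sum => i _.
  by have := sqr_ge0 (coef u i - coef (partial u s) i); nra.
rewrite big_split/= -!mulr_sumr.
by move: (sq _) (\sum_(i <- s) _) (\sum_(i <- s) _) => *; lra.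
Qed.

(** Expanding the square gives the inner product of u with its partial sum,
    which is the sum of the squared coefficients, with the factor -2; the
    partial sum itself gives back at most one such sum. *)
Lemma sq_residual u s : L2s mu u -> uniq s ->
  sq (fun x => u x - partial u s x) <= sq u - \sum_(i <- s) coef u i ^+ 2.
Proof.
move=> hu us; have hp := L2_partial u s.
have -> : sq (fun x => u x - partial u s x) =
   sq u + (-2) * mean (fun x => u x * partial u s x) + sq (partial u s).
  rewrite -meanZ; last exact: L2_L1M.
  rewrite -meanD; [|exact: hu.2|by apply: L1Z; exact: L2_L1M].
  rewrite -meanD; [|by apply: L1D; [exact: hu.2|by apply: L1Z; exact: L2_L1M]|exact: hp.2].
  by apply: eq_mean => x _; ring.
rewrite mean_partial//; under [X in _ * X]eq_bigr do rewrite -expr2.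
have := sq_partial u us.
by move: (sq _) (sq _) (\sum_(i <- s) _) => *; lra.
Qed.

Lemma normc_sq (z : R[i]) :
  ComplexField.Normc.normc z ^+ 2 = complex.Re z ^+ 2 + complex.Im z ^+ 2.
Proof. by case: z => a b /=; rewrite sqr_sqrtr// addr_ge0 ?sqr_ge0. Qed.

Lemma sqnormE f : L2s mu (fun x => complex.Re (f x)) -> L2s mu (fun x => complex.Im (f x)) ->
  sqnorm mu f = (sq (fun x => complex.Re (f x)) + sq (fun x => complex.Im (f x)))%:E.
Proof.
move=> hu hv; rewrite /sqnorm -meanD; [|exact: hu.2|exact: hv.2].
rewrite /mean /Rintegral fineK.
  by apply: eq_integral => x _; rewrite normc_sq.
by apply: integrable_fin_num; [exact: measurable_sphere|exact: (L1D hu.2 hv.2)].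
Qed.

Lemma L2_ReIm f : L2 mu f ->
  L2s mu (fun x => complex.Re (f x)) /\ L2s mu (fun x => complex.Im (f x)).
Proof.
move=> [mr mi fo].
have i2 : L1s mu (fun x => ComplexField.Normc.normc (f x) ^+ 2).
  apply/integrableP; split.
    apply/measurable_EFinP.
    rewrite (_ : (fun x => _) = (fun x => complex.Re (f x) ^+ 2 + complex.Im (f x) ^+ 2)).
      by apply: measurable_funD; apply: measurable_funX.
    by apply/funext => x; rewrite normc_sq.
  by under eq_integral do rewrite gee0_abs ?lee_fin ?sqr_ge0//.
have dom (u : 'cV[R]_e.+3 -> R) : measurable_fun S (u : borel_vec R e.+3 -> R) ->
    (forall x, u x ^+ 2 <= ComplexField.Normc.normc (f x) ^+ 2) -> L2s mu u.
  move=> mu' hu; split => //; apply: le_integrable i2; first exact: measurable_sphere.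
    by apply/measurable_EFinP; exact: measurable_funX.
  by move=> x _ /=; rewrite lee_fin !ger0_norm ?sqr_ge0.
by split; apply: dom => // x; rewrite normc_sq ?lerDl ?lerDr sqr_ge0.
Qed.

Lemma ReIm_L2 f : L2s mu (fun x => complex.Re (f x)) -> L2s mu (fun x => complex.Im (f x)) ->
  L2 mu f.
Proof. by move=> hu hv; split; [exact: hu.1|exact: hv.1|rewrite sqnormE// ltry]. Qed.

Lemma inner_real f i : inner mu f (fun x => (psi i x)%:C) =
  coef (fun x => complex.Re (f x)) i +i* coef (fun x => complex.Im (f x)) i.
Proof.
rewrite /inner /cintegral /coef; congr (_ +i* _);
  by apply: eq_mean => x _; case: (f x) => a b /=; simpc.
Qed.

Definition energyC f i : R := coef (fun x => complex.Re (f x)) i ^+ 2 +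
  coef (fun x => complex.Im (f x)) i ^+ 2.

(** Real frame elements act separately on real and imaginary parts. *)
Lemma residualC f s : L2 mu f -> uniq s ->
  exists2 r : R, 0 <= r <= sq (fun x => complex.Re (f x)) + sq (fun x => complex.Im (f x)) -
       \sum_(i <- s) energyC f i &
  sqnorm mu (fun x => f x - \sum_(i <- s)
    inner mu f (fun x => (psi i x)%:C) * (psi i x)%:C) = r%:E.
Proof.
move=> /L2_ReIm[hu hv] us; set U := fun x => _ in hu *; set V := fun x => _ in hv *.
set F := fun x => f x - _.
have FE x : F x = (U x - partial U s x) +i* (V x - partial V s x).
  rewrite /F; have -> : \sum_(i <- s) inner mu f (fun x => (psi i x)%:C) * (psi i x)%:C =
      partial U s x +i* partial V s x.
    rewrite /partial; elim: s {us F} => [|i s IH]; first by rewrite !big_nil.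
    by rewrite !big_cons IH inner_real -/U -/V; simpc.
  by rewrite /U /V; case: (f x) => a b; simpc.
have ru := sq_residual hu us; have rv := sq_residual hv us.
exists (sq (fun x => U x - partial U s x) + sq (fun x => V x - partial V s x)).
  rewrite addr_ge0 ?sq_ge0//= (le_trans (lerD ru rv))//.
  by rewrite /energyC big_split/= opprD addrACA.
rewrite sqnormE.
- by congr (_ + _)%:E; apply: eq_mean => x _; rewrite FE.
- by under eq_fun do rewrite FE; apply: L2B => //; exact: L2_partial.
- by under eq_fun do rewrite FE; apply: L2B => //; exact: L2_partial.
Qed.

Lemma energyC_ge0 f i : 0 <= energyC f i.
Proof. by rewrite addr_ge0 ?sqr_ge0. Qed.

Lemma exhaustC f (eps : R) : L2 mu f -> 0 < eps ->
  exists2 s, uniq s &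
  sq (fun x => complex.Re (f x)) + sq (fun x => complex.Im (f x)) - eps <=
    \sum_(i <- s) energyC f i.
Proof.
move=> /L2_ReIm[hu hv] e0; have e2 : 0 < eps / 2 by rewrite divr_gt0.
have [s us hs] := exhaust hu e2; have [t ut ht] := exhaust hv e2.
exists (undup (s ++ t)); first exact: undup_uniq.
rewrite big_split/=.
have h1 : \sum_(i <- s) coef (fun x => complex.Re (f x)) i ^+ 2 <=
    \sum_(i <- undup (s ++ t)) coef (fun x => complex.Re (f x)) i ^+ 2.
  apply: sum_uniq_le => //; [by move=> i; exact: sqr_ge0|exact: undup_uniq|].
  by move=> i si; rewrite mem_undup mem_cat si.
have h2 : \sum_(i <- t) coef (fun x => complex.Im (f x)) i ^+ 2 <=
    \sum_(i <- undup (s ++ t)) coef (fun x => complex.Im (f x)) i ^+ 2.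
  apply: sum_uniq_le => //; [by move=> i; exact: sqr_ge0|exact: undup_uniq|].
  by move=> i si; rewrite mem_undup mem_cat si orbT.
move: (le_trans hs h1) (le_trans ht h2).
by move: (sq _) (sq _) (\sum_(i <- _) _) (\sum_(i <- _) _) => *; lra.
Qed.

(** The bound of the residual involves the finite set of indices alone, so that
    any exhausting sequence of finite sets gives convergence. *)
Lemma frame_cvg f (s : nat -> seq I) : L2 mu f -> (forall N, uniq (s N)) ->
  (forall t : seq I, exists N0, forall N, (N0 <= N)%N -> {subset t <= s N}) ->
  L2_cvg mu (fun N x => \sum_(i <- s N)
    inner mu f (fun x => (psi i x)%:C) * (psi i x)%:C) f.
Proof.
move=> hf us cov; rewrite /L2_cvg.
(* The squared norms are finite; r N is the real value of the N-th one. *)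
pose r N := xget 0 [set r : R | sqnorm mu (fun x => f x - \sum_(i <- s N)
    inner mu f (fun x => (psi i x)%:C) * (psi i x)%:C) = r%:E].
have rE N : sqnorm mu (fun x => f x - \sum_(i <- s N)
    inner mu f (fun x => (psi i x)%:C) * (psi i x)%:C) = (r N)%:E.
  rewrite /r; case: xgetP => [y _ ->//|/(_ _)h].
  by have [y _ hy] := residualC hf (us N); case: (h y).
have rle N : 0 <= r N <= sq (fun x => complex.Re (f x)) + sq (fun x => complex.Im (f x)) -
       \sum_(i <- s N) energyC f i.
  by have [y hy] := residualC hf (us N); rewrite rE => -[->].
under eq_fun do rewrite rE.
apply: cvg_EFin; first exact: nearW.
apply/cvgrPdist_le => eps e0.
have [t ut ht] := exhaustC hf e0; have [N0 hN0] := cov t.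
exists N0 => // N /= /hN0 st; rewrite sub0r normrN ger0_norm ?(andP (rle N)).1//.
have /andP[_ /le_trans] := rle N; apply.
rewrite lerBlDr -lerBlDl (le_trans ht)//.
by apply: sum_uniq_le => // i; exact: energyC_ge0.
Qed.

Lemma frame_parseval : parseval_frame mu (fun i x => (psi i x)%:C).
Proof.
split=> [i|f hf].
  by apply: ReIm_L2 => //=; exact/(bmf_L2 mu1)/bmf_cst.
have [hu hv] := L2_ReIm hf.
rewrite sqnormE//.
under eq_esum do rewrite normc_sq inner_real -/(energyC f _).
apply/eqP; rewrite eq_le; apply/andP; split.
  apply: ge_ereal_sup => _ [A [finA _] <-].
  rewrite fsbig_finite//= sumEFin lee_fin /energyC big_split/=.
  by rewrite lerD// bessel.
apply/lee_addgt0Pr => eps e0; have [s us hs] := exhaustC hf e0.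
have : ((\sum_(i <- s) energyC f i)%:E <= \esum_(i in [set: I]) (energyC f i)%:E)%E.
  apply: esum_ge; exists [set` s]; first by split => //; exact: finite_seq.
  by rewrite -fsbig_seq//= sumEFin.
move=> h; have := leeD2r eps%:E h; apply: le_trans.
by rewrite -EFinD lee_fin -lerBlDr.
Qed.

Lemma frame_unconditional f : L2 mu f ->
  unconditional_L2_sum mu (fun i x => inner mu f (fun x => (psi i x)%:C) * (psi i x)%:C) f.
Proof.
move=> hf enum [d de ed].
have := @frame_cvg f (fun N => [seq enum k | k <- iota 0 N]) hf.
have -> : (fun (N : nat) x => \sum_(i <- [seq enum k | k <- iota 0 N])
    inner mu f (fun x => (psi i x)%:C) * (psi i x)%:C) =
    (fun (N : nat) x => \sum_(k < N)
    inner mu f (fun x => (psi (enum k) x)%:C) * (psi (enum k) x)%:C).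
  apply/funext => N; apply/funext => x.
  by rewrite big_map -{1}(subn0 N) -[iota _ _]/(index_iota 0 N) big_mkord.
apply.
  by move=> N; rewrite map_inj_uniq ?iota_uniq//; exact: can_inj de.
move=> t; exists (\max_(i <- t) (d i).+1)%N => N hN i ti.
rewrite -(ed i); apply: map_f; rewrite mem_iota/= add0n.
apply: leq_trans hN; exact: (leq_bigmax_seq _ ti).
Qed.

End RealFrame.

(** * The curvelet frame *)

Section Levels.
Variables (rn sn : nat -> nat).
Notation index := {j : nat & ('I_(rn j) * 'I_(sn j))%type}.

(** The first N levels as one duplicate-free list, which puts the ordered
    triple sum and arbitrary rearrangements on the same footing. *)
Definition levels N : seq index :=
  [seq Tagged (fun j => ('I_(rn j) * 'I_(sn j))%type) rs |
    j <- iota 0 N, rs <- enum {: 'I_(rn j) * 'I_(sn j)}].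

Lemma mem_levels N (i : index) : (i \in levels N) = (tag i < N)%N.
Proof.
apply/allpairsPdep/idP => [[j [rs [jN _ ->]]]|iN].
  by move: jN; rewrite mem_iota add0n.
case: i iN => j rs /= jN; exists j, rs; split => //.
  by rewrite mem_iota add0n.
by rewrite mem_enum.
Qed.

Lemma uniq_levels N : uniq (levels N).
Proof.
apply: allpairs_uniq_dep; first exact: iota_uniq.
  by move=> j _; exact: enum_uniq.
by move=> [j rs] [k ts] _ _ /= H; exact: H.
Qed.

Lemma sum_levels (V : zmodType) N (F : index -> V) :
  \sum_(i <- levels N) F i = \sum_(j < N) \sum_(r < rn j) \sum_(s < sn j)
    F (Tagged (fun j => ('I_(rn j) * 'I_(sn j))%type) (r, s)).
Proof.
rewrite big_allpairs_dep/= -{1}(subn0 N) -[iota _ _]/(index_iota 0 N) big_mkord.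
apply: eq_bigr => j _; rewrite big_enum/= pair_bigA/=.
by apply: eq_bigr => -[r s].
Qed.

Lemma levels_cover (t : seq index) :
  exists N0, forall N, (N0 <= N)%N -> {subset t <= levels N}.
Proof.
exists (\max_(i <- t) (tag i).+1)%N => N hN i ti; rewrite mem_levels.
by apply: leq_trans hN; exact: (leq_bigmax_seq _ ti).
Qed.

End Levels.

Theorem proposition3p1 (R : realType) (d : nat) (hd : (3 <= d)%N)
    (omega : probability (borel_vec R d) R)
    (homega : rotation_invariant omega)
    (omega' : probability (borel_vec R d.-1) R)
    (homega' : rotation_invariant omega')
    (g : 'cV[R]_d -> 'M[R]_d)
    (hg : forall nu, sphere R d nu ->
       SOgroup R d (g nu) /\ g nu *m unit_vec R d d.-1 = nu)
    (h : 'cV[R]_d.-1 -> 'M[R]_d)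
    (hh : forall nu, sphere R d.-1 nu ->
       SOstab R d (h nu) /\ h nu *m unit_vec R d d.-2 = embed0 nu)
    (q : nat) (hq : (0 < q)%N) (phi : R -> R)
    (phi_Cq : C_halfline q phi)
    (phi_noninc : forall s t : R, 0 <= s -> s <= t -> phi t <= phi s)
    (phi1 : forall t : R, 0 <= t -> t <= 2^-1 -> phi t = 1)
    (phi0 : forall t : R, 1 <= t -> phi t = 0)
    (rn sn : nat -> nat)
    (eta : forall j, 'I_(rn j) -> 'cV[R]_d)
    (eta' : forall j, 'I_(sn j) -> 'cV[R]_d.-1)
    (w : forall j, 'I_(rn j) -> R)
    (w' : forall j, 'I_(sn j) -> R)
    (eta_sphere : forall j r, sphere R d (eta j r))
    (eta'_sphere : forall j s, sphere R d.-1 (eta' j s))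
    (w_gt0 : forall j r, 0 < w j r)
    (w'_gt0 : forall j s, 0 < w' j s)
    (hquad : forall j, (0 < j)%N ->
       quadrature omega (2 ^ j.+1) (eta j) (w j))
    (hquad' : forall j, (0 < j)%N ->
       quadrature omega' (2 ^ j.+1) (eta' j) (w' j))
    (rn0 : rn 0%N = 1%N) (sn0 : sn 0%N = 1%N)
    (w0 : forall r : 'I_(rn 0%N), w 0%N r = 1)
    (w'0 : forall s : 'I_(sn 0%N), w' 0%N s = 1) :
  let Psi (j : nat) (r : 'I_(rn j)) (s : 'I_(sn j)) : 'cV[R]_d -> R[i] :=
    curvelet_rot phi g h j (w j r) (w' j s) (eta j r) (eta' j s) in
  let X (i : {j : nat & ('I_(rn j) * 'I_(sn j))%type}) : 'cV[R]_d -> R[i] :=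
    Psi (tag i) (tagged i).1 (tagged i).2 in
  parseval_frame omega X /\
  forall f : 'cV[R]_d -> R[i], L2 omega f ->
    L2_cvg omega
      (fun N x => \sum_(j < N) \sum_(r < rn j) \sum_(s < sn j)
                    inner omega f (Psi j r s) * Psi j r s x) f /\
    unconditional_L2_sum omega (fun i x => inner omega f (X i) * X i x) f.
Proof.
case: d hd omega homega omega' homega' g hg h hh eta eta' eta_sphere eta'_sphere hquad hquad'
  => [|[|[|e]]]// _ mu hmu nu hnu {}g hg {}h hh {}eta {}eta' eta_S eta'_S {}hquad {}hquad'.
have {}hg u : dot u u = 1 -> SOgroup R e.+3 (g u) /\ g u *m unit_vec R e.+3 e.+2 = u.
  by move=> /sphereE; exact: hg.
have {}hh v : dot v v = 1 ->
    SOstab R e.+3 (h v) /\ h v *m unit_vec R e.+3 e.+1 = @embed0 R e.+3 v.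
  by move=> /sphereE; exact: hh.
have Tnu (v : 'cV[R]_e.+2) : dot v v = 1 ->
    exists2 h, SOgroup R e.+2 h & h *m unit_vec R e.+2 e.+1 = v.
  move=> /hh[hs hv]; exists (restr_mx (h v)); first exact: SO_restr_mx hs.
  by apply: (restr_mx_mul hs); rewrite -hv; congr (_ *m _); exact: embed0_unit_vec.
have eta1 j (r : 'I_(rn j)) : dot (eta j r) (eta j r) = 1 by apply/sphereE; exact: eta_S.
have eta'1 j (s : 'I_(sn j)) : dot (eta' j s) (eta' j s) = 1 by apply/sphereE; exact: eta'_S.
have le2 N : (N <= 2 ^ N.+2)%N.
  by apply: leq_trans (ltnW (ltn_expl N (ltnSn 1))) _; rewrite leq_exp2l// leqW.
have Hnu N : exists s (pt : 'I_s -> 'cV[R]_e.+2) w,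
    (forall r, dot (pt r) (pt r) = 1) /\ quadrature nu N pt w.
  exists (sn N.+1), (eta' N.+1), (w' N.+1); split; first exact: eta'1.
  by apply: quadrature_le (le2 N) _; exact: hquad'.
have Hmu N : exists s (pt : 'I_s -> 'cV[R]_e.+3) (w : 'I_s -> R),
    [/\ (forall r, dot (pt r) (pt r) = 1), (forall r, 0 <= w r) & quadrature mu N pt w].
  exists (rn N.+1), (eta N.+1), (w N.+1); split; first exact: eta1.
    by move=> r; exact/ltW/w_gt0.
  by apply: quadrature_le (le2 N) _; exact: hquad.
move=> Psi X.
pose psi (i : {j : nat & ('I_(rn j) * 'I_(sn j))%type}) :=
  rcurvelet g phi eta eta' w w' (tagged i).1 (tagged i).2.
have PsiE j r s : Psi j r s = fun x => (psi (Tagged (fun j => ('I_(rn j) * 'I_(sn j))%type) (r, s)) x)%:C.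
  by apply/funext => x; exact: (curvelet_rotE hg hh phi_noninc phi0 eta1 eta'1 w0 w'0).
have XE : X = fun i x => (psi i x)%:C.
  by apply/funext => -[j [r s]]; exact: PsiE.
have mu1 : mu (sphere R e.+3) = 1%E := hmu.1.
have Lpsi i : L2s mu (psi i) by apply/(bmf_L2 mu1); exact: bmf_rcurvelet.
have energyE N u : \sum_(j < N) energy mu g phi eta eta' w w' j u =
    \sum_(i <- levels rn sn N) coef mu psi u i ^+ 2.
  by rewrite sum_levels.
have bessel u (t : seq {j : nat & ('I_(rn j) * 'I_(sn j))%type}) : L2s mu u -> uniq t ->
    \sum_(i <- t) coef mu psi u i ^+ 2 <= sq mu u.
  move=> hu ut; have [N /(_ N (leqnn N)) tN] := levels_cover t.
  apply: le_trans (energy_le hmu hnu hg Tnu Hnu Hmu phi_noninc phi1 phi0 eta1 eta'1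
    w_gt0 w'_gt0 hquad hquad' rn0 sn0 N hu).
  rewrite energyE; apply: sum_uniq_le => // [i|]; [exact: sqr_ge0|exact: uniq_levels].
have exhaust u (eps : R) : L2s mu u -> 0 < eps ->
    exists2 t : seq {j : nat & ('I_(rn j) * 'I_(sn j))%type},
    uniq t & sq mu u - eps <= \sum_(i <- t) coef mu psi u i ^+ 2.
  move=> hu e0; have [N hN] := energy_lim hmu hnu hg Tnu Hnu Hmu phi_noninc phi1 phi0 eta1 eta'1
    w_gt0 w'_gt0 hquad hquad' rn0 sn0 hu e0.
  by exists (levels rn sn N); [exact: uniq_levels|rewrite -energyE].
split; first by rewrite XE; exact: frame_parseval.
move=> f hf; split; last by rewrite XE; exact: frame_unconditional.
have := frame_cvg mu1 Lpsi bessel exhaust hf (@uniq_levels rn sn) (@levels_cover rn sn).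
congr (L2_cvg mu _ f); apply/funext => N; apply/funext => x; rewrite sum_levels.
by apply: eq_bigr => j _; apply: eq_bigr => r _; apply: eq_bigr => s _; rewrite PsiE.
Qed.
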